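(* Suppose $E \subseteq \mathbb{R}^{2}$ is measurable and satisfies the property that the function $$\omega \mapsto \mathcal{H}^1\{t \in \mathbb{R} : R_{\omega}\chi_{\bar{E}}(t) \neq 0 \}$$ is bounded on $S^1$, where $\bar{E}$ is the closure of $E$. Then $\mathrm{Lip}_{E} \notin L^{2}(S^1)$, and therefore $\mathrm{Lip}_E$ cannot be bounded.
   Context: $S^1 \subset \mathbb{R}^2$ is the unit circle (with arc-length measure), $\mathcal{H}^1$ is one-dimensional Hausdorff measure, and $\chi_E$ is the characteristic function of $E$. For $(\omega,t) \in S^1 \times \mathbb{R}$ let $\ell_{\omega}(t) := \{x \in \mathbb{R}^2 : \langle x, \omega \rangle = t\}$. The (classical) Radon transform of a function $f$ on $\mathbb{R}^2$ in direction $\omega$ is $$R_{\omega}f(t) := \int_{\ell_{\omega}(t)} f \, d\mathcal{H}^1, \qquad t \in \mathbb{R},$$ each function $R_\omega f$ being well-defined in an almost-everywhere sense for $f \in L^1(\mathbb{R}^2)$; in particular $R_{\omega}\chi_E(t) = \mathcal{H}^1(E \cap \ell_{\omega}(t)) \in [0,\infty]$. For a measurable set $E \subseteq \mathbb{R}^2$ and $\omega \in S^1$, $\mathrm{Lip}_E(\omega) \in [0,\infty]$ denotes the Lipschitz constant of the function $R_{\omega}\chi_E$ on $\mathbb{R}$ (equal to $\infty$ if this function is not Lipschitz), with the understanding that $\mathrm{Lip}_E(\omega) := \infty$ if $R_{\omega}\chi_E(t) = \infty$ for any $t \in \mathbb{R}$.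
   Formalization: The formal statement additionally assumes that E has positive Lebesgue measure (is not a null set); without this the claim fails, e.g. for E empty or a single point, where Lip_E is identically 0. *)

(* Defs.v *)
From HB Require Import structures.
From mathcomp Require Import all_boot all_order all_algebra.
From mathcomp Require Import all_classical all_reals all_analysis.
From mathcomp Require Import measurable_realfun.

Set Implicit Arguments.
Unset Strict Implicit.
Unset Printing Implicit Defensive.
Import Order.TTheory GRing.Theory Num.Theory.
Import numFieldNormedType.Exports.

Local Open Scope classical_set_scope.
Local Open Scope ring_scope.
Local Open Scope ereal_scope.

Section hausdorff.
Context {R : realType} {T : Type} (d : T -> T -> R).

(* The point 0 makes the diameter of the empty set 0 rather than -oo. *)
Definition diameter (A : set T) : \bar R :=
  ereal_sup (0 |` [set (d p.1 p.2)%:E | p in A `*` A]).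

Definition hausdorff1_premeasure (delta : R) (A : set T) : \bar R :=
  ereal_inf [set \sum_(0 <= i <oo) diameter (U i) | U in
    [set U : (set T)^nat |
      A `<=` \bigcup_i U i /\ forall i, diameter (U i) <= delta%:E]].

(* This is the outer measure, defined on all subsets of T. *)
Definition hausdorff1 (A : set T) : \bar R :=
  ereal_sup [set hausdorff1_premeasure delta A | delta in
    [set delta : R | (0 < delta)%R]].

End hausdorff.

Section plane.
Context {R : realType}.
Implicit Types (x y w : R * R) (t : R) (E : set (R * R)).

Definition inner x y : R := (x.1 * y.1 + x.2 * y.2)%R.

(* The norm that the library puts on R * R is the sup norm (which induces the
   same topology, hence the same closures). *)
Definition euclidean_dist x y : R :=
  Num.sqrt ((x.1 - y.1) ^+ 2 + (x.2 - y.2) ^+ 2).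

Definition unit_circle : set (R * R) := [set w | inner w w = 1%R].

Definition line w t : set (R * R) := [set x | inner x w = t].

Definition radon_indic E w t : \bar R :=
  hausdorff1 euclidean_dist (E `&` line w t).

Definition Lip E w : \bar R :=
  if `[< exists t, radon_indic E w t = +oo >] then +oo
  else ereal_inf [set k%:E | k in
         [set k : R | k.-lipschitz (fun t => fine (radon_indic E w t) : R)]].

Definition plane_measure :
    {measure set (measurableTypeR R * measurableTypeR R) -> \bar R} :=
  lebesgue_measure \x lebesgue_measure.

(* Lebesgue (not only Borel) measurable sets. *)
Definition plane_measurable : set (set (R * R)) :=
  completed_algebra_gen plane_measure.

Definition circle_param (a : R) : R * R := (cos a, sin a).

Lemma measurable_circle_param : measurable_fun setT circle_param.
Proof.
by apply/measurable_fun_pairP; split; apply: continuous_measurable_fun;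
  [exact: continuous_cos|exact: continuous_sin].
Qed.

Definition lebesgue_turn : {measure set (measurableTypeR R) -> \bar R} :=
  mrestr lebesgue_measure
    (measurable_itv `[0%R, (2 * pi)%R[ : measurable (_ : set (measurableTypeR R))).

(* A measure on the plane, carried by the unit circle. *)
Definition arc_length : set (R * R) -> \bar R :=
  pushforward lebesgue_turn circle_param.

HB.instance Definition _ := Measure.copy arc_length
  (@measure_function_pushforward__canonical__measure_function_Measure
     _ _ _ _ _ lebesgue_turn _ measurable_circle_param).

(* The integral of a nonnegative function is the supremum over the simple
   functions below it, so that it makes sense without measurability: not being
   square integrable means that the integral of the square is infinite, and is
   never a mere failure of measurability. *)
Definition square_integrable_S1 (f : R * R -> \bar R) : Prop :=
  Lnorm arc_length 2%:E f < +oo.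

End plane.

(* Main.v *)
From HB Require Import structures.
Require Import Defs.
From mathcomp Require Import all_boot all_order all_algebra.
From mathcomp Require Import all_classical all_reals all_analysis.
From mathcomp Require Import measurable_realfun ring lra.

Import Order.TTheory GRing.Theory Num.Theory.
Import numFieldNormedType.Exports.

Local Open Scope classical_set_scope.
Local Open Scope ring_scope.
Local Open Scope ereal_scope.

(** The Borel kernel [A] of [E] has the same line integrals as [E] on almost every
    line of each direction. Let [f] be its indicator function, and let [g a b] be
    the measure of the overlap of [A] with its translate by [- (a, b)]. If
    [Lip E] were square integrable, the overlaps would be both too regular and too
    singular near the origin.

    Regularity. In the direction [w] the line integrals of [E] form a function
    that is Lipschitz with constant [Lip E w] and vanishes off a set of bounded
    measure. Hence its increments over a step [d] have square integral at most
    [C * d ^+ 2 * Lip E w ^+ 2] ([slice_Lip_bounds]), and averaged over all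
    directions they are of order [d ^+ 2]. On the other hand the correlations of
    the line integrals in one direction are the integrals of [g] along the lines of
    that direction ([slice_corrE]). Averaging over the slopes of one of the two
    charts [y = u - m * x] and [x = u - m * y] with a piecewise linear weight turns
    these line integrals into integrals of [g] against tents, with the density
    [1 / a ^+ 2] at horizontal distance [a] ([weight_average]). After smoothing
    [g] at scale [d], an exchange of the widths of two tents
    ([tent_swap]) turns the second difference in the offset of the lines into a
    second difference of the smoothed [g] along a few fixed directions
    ([chart_identity]). The weight is chosen so that the two charts together leave
    only the axes, and the result is [energy_two_charts]: the integral over [a] of
    [1 / a ^+ 2] times the loss of the smoothed overlap from [0] to [(a, 0)] is at
    most [d ^+ 2] times the mean increment, hence at most [C * d ^+ 4].

    Singularity. The loss [mass f - g a 0] is the measure of the points of [A]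
    whose translate by [(a, 0)] leaves [A]. It is subadditive in [a]
    ([autocorr_subadditive]) and at least half of the mass for large [a], so it is
    at least [c * a] for small [a] ([autocorr_linear_growth]), with [c > 0] when
    [A] has positive measure. Smoothing at scale [d] only multiplies it by
    [d ^+ 4], up to an error that tends to [0] with [d] ([oscillation_ge]). The
    integral of [c * a / a ^+ 2] diverges at [0], and this contradicts the bound
    [C] ([energy_bound_mass0]).

    It remains to compare Hausdorff measure with Lebesgue measure on lines, and
    the slopes of a chart with the angles of the circle. Both comparisons rest on
    the fact that a Lipschitz map multiplies Hausdorff measure by at most its
    constant ([hausdorff1_image]). A bounded [Lip E] is square integrable, which
    gives the last claim. *)

(** * Iterated integrals and affine changes of variable *)

Section measurability.
Context {R : realType}.
Notation mu := (@lebesgue_measure R).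
Notation X := (measurableTypeR R).

Lemma measurable_integral d (T : measurableType d) (h : T -> X -> \bar R) :
  measurable_fun setT (fun p : T * X => h p.1 p.2) ->
  (forall t x, 0 <= h t x) ->
  measurable_fun setT (fun t => \int[mu]_x h t x).
Proof.
move=> mh h0.
exact: (@measurable_fun_fubini_tonelli_F _ _ _ _ _ mu (fun p => h p.1 p.2)).
Qed.

Lemma tonelli (h : X -> X -> \bar R) :
  measurable_fun setT (fun p : X * X => h p.1 p.2) ->
  (forall x y, 0 <= h x y) ->
  \int[mu]_x \int[mu]_y h x y = \int[mu]_y \int[mu]_x h x y.
Proof.
by move=> mh h0; exact: (@fubini_tonelli _ _ _ _ _ mu mu (fun p => h p.1 p.2)).
Qed.

End measurability.

Section change_of_variables.
Context {R : realType}.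
Notation mu := (@lebesgue_measure R).
Notation X := (measurableTypeR R).

Lemma measurable_shift (a : R) : measurable_fun setT (fun x : X => (x + a)%R : X).
Proof. by apply: measurable_funD. Qed.

Lemma measurable_scale (c : R) : measurable_fun setT (fun x : X => (c * x)%R : X).
Proof. by apply: measurable_funM. Qed.

Lemma lebesgue_measure_shift (a : R) (A : set X) : measurable A ->
  pushforward mu (fun x : X => (x + a)%R : X) A = mu A.
Proof.
have ms := measurable_shift a.
move=> mA; apply/esym/lebesgue_measure_unique => //= _ [[u v]] _ <-.
rewrite /pushforward [X in _ = mu X](_ : _ = `](u - a)%R, (v - a)%R]%classic); last first.
  by apply/seteqP; split => x /=; rewrite !in_itv/= ltrBlDr lerBrDr.
by rewrite !lebesgue_measure_itv/= !lte_fin ltrD2r; case: ifP => // _;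
  rewrite -!EFinD; congr (_%:E); ring.
Qed.

Lemma lebesgue_measure_scale (c : R) (A : set X) : (0 < c)%R -> measurable A ->
  pushforward mu (fun x : X => (c * x)%R : X) A = c^-1%:E * mu A.
Proof.
move=> c0 mA; have ms := measurable_scale c.
have c1 : (0 <= c)%R by exact: ltW.
have := @lebesgue_measure_unique R
  (mscale (NngNum c1) (pushforward mu (fun x : X => (c * x)%R : X))).
move=> ->//; last first.
  move=> _ [[u v]] _ <-.
  rewrite /mscale/= /pushforward.
  rewrite [X in _ = _ * mu X](_ : _ = `](u / c)%R, (v / c)%R]%classic); last first.
    apply/seteqP; split => x /=; rewrite !in_itv/=.
      by rewrite ltr_pdivrMr// ler_pdivlMr// ![(x * c)%R]mulrC.
    by rewrite ltr_pdivrMr// ler_pdivlMr// ![(x * c)%R]mulrC.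
  rewrite !lebesgue_measure_itv/= !lte_fin ltr_pM2r ?invr_gt0//.
  case: ifP => // _; last by rewrite mule0.
  by rewrite -!EFinD -EFinM; congr (_%:E); field; rewrite gt_eqF.
by rewrite /mscale/= muleA -EFinM mulVf ?gt_eqF// mul1e.
Qed.

Section integrals.
Variables (h : R -> \bar R) (mh : measurable_fun setT h).
Hypothesis h0 : forall x, 0 <= h x.

Lemma integral_shift (a : R) : \int[mu]_x h (x + a)%R = \int[mu]_x h x.
Proof.
transitivity (\int[pushforward mu (fun x : X => (x + a)%R : X)]_x h x).
  by rewrite ge0_integral_pushforward//; exact: measurable_shift.
apply: (eq_measure_integral mu) => [|mf A mA _]; first exact: measurable_shift.
exact: lebesgue_measure_shift.
Qed.

Lemma integral_opp : \int[mu]_x h (- x)%R = \int[mu]_x h x.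
Proof.
transitivity (\int[pushforward mu (fun x : X => (- x)%R : X)]_x h x).
  by rewrite ge0_integral_pushforward//; exact: oppr_measurable.
apply: (eq_measure_integral mu) => [|mf A mA _]; first exact: oppr_measurable.
exact: lebesgue_measureN.
Qed.

End integrals.

Lemma integral_scale (h : R -> \bar R) (c : R) : measurable_fun setT h ->
    (forall x, 0 <= h x) -> c != 0%R ->
  \int[mu]_x h (c * x)%R = `|c|^-1%:E * \int[mu]_x h x.
Proof.
move=> mh h0 c0.
have posc (k : R -> \bar R) (b : R) : measurable_fun setT k ->
    (forall x, 0 <= k x) -> (0 < b)%R ->
    \int[mu]_x k (b * x)%R = b^-1%:E * \int[mu]_x k x.
  move=> mk k0 b0.
  transitivity (\int[pushforward mu (fun x : X => (b * x)%R : X)]_x k x).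
    by rewrite ge0_integral_pushforward//; exact: measurable_scale.
  have b1 : (0 <= b^-1)%R by rewrite invr_ge0 ltW.
  have := @ge0_integral_mscale _ X R mu setT measurableT (NngNum b1) k mk.
  move=> /= <-//; apply: (eq_measure_integral (mscale (NngNum b1) mu)) => [|mf A mA _].
    exact: measurable_scale.
  exact: lebesgue_measure_scale.
have [cp|cn] := ltP 0%R c; first by rewrite gtr0_norm// posc.
have {c0}cn : (c < 0)%R by rewrite lt_neqAle c0.
rewrite ltr0_norm//.
transitivity (\int[mu]_x h (- (- c * x))%R).
  by apply: eq_integral => x _; rewrite mulNr opprK.
rewrite (posc (fun x => h (- x)%R)) ?oppr_gt0//; last first.
  exact: measurableT_comp.
by rewrite integral_opp.
Qed.

End change_of_variables.

(** * Measurability and sign of iterated integrals *)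

Lemma measurable_inv {R : realType} :
  measurable_fun setT (fun x : measurableTypeR R => x^-1 : measurableTypeR R)%R.
Proof.
rewrite -(setvU [set (0 : R)%R]); apply/measurable_funU.
- by apply: measurableC; exact: measurable_set1.
- exact: measurable_set1.
split; last exact: measurable_fun_set1.
apply: open_continuous_measurable_fun; last first.
  by apply/in_setP => x /= /eqP x0; exact: inv_continuous.
by rewrite openC; exact: closed_eq.
Qed.

Section measurability_rules.
Context {d} {T : measurableType d} {R : realType}.
Notation mu := (@lebesgue_measure R).
Notation X := (measurableTypeR R).

Lemma meas_idX : measurable_fun setT (fun x : T => x).
Proof. exact: measurable_id. Qed.

Lemma meas_cst d' (U : measurableType d') (c : U) :
  measurable_fun setT (fun _ : T => c).
Proof. exact: measurable_cst. Qed.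

Lemma meas_fst d1 d2 (T1 : measurableType d1) (T2 : measurableType d2)
    (a : T -> T1 * T2) :
  measurable_fun setT a -> measurable_fun setT (fun t => (a t).1).
Proof. by move=> ma; exact: (measurableT_comp measurable_fst ma). Qed.

Lemma meas_snd d1 d2 (T1 : measurableType d1) (T2 : measurableType d2)
    (a : T -> T1 * T2) :
  measurable_fun setT a -> measurable_fun setT (fun t => (a t).2).
Proof. by move=> ma; exact: (measurableT_comp measurable_snd ma). Qed.

Lemma meas_pair d1 d2 (T1 : measurableType d1) (T2 : measurableType d2)
    (a : T -> T1) (b : T -> T2) :
  measurable_fun setT a -> measurable_fun setT b ->
  measurable_fun setT (fun t => (a t, b t)).
Proof. by move=> ma mb; apply/measurable_fun_pairP; split. Qed.

Lemma meas_add (a b : T -> X) : measurable_fun setT a -> measurable_fun setT b ->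
  measurable_fun setT (fun t => a t + b t : X)%R.
Proof. by move=> *; exact: measurable_funD. Qed.

Lemma meas_mul (a b : T -> X) : measurable_fun setT a -> measurable_fun setT b ->
  measurable_fun setT (fun t => a t * b t : X)%R.
Proof. by move=> *; exact: measurable_funM. Qed.

Lemma meas_opp (a : T -> X) : measurable_fun setT a ->
  measurable_fun setT (fun t => - a t : X)%R.
Proof. by move=> *; exact: measurableT_comp. Qed.

Lemma meas_sqr (a : T -> X) : measurable_fun setT a ->
  measurable_fun setT (fun t => a t ^+ 2 : X)%R.
Proof.
move=> ma.
by under eq_fun do rewrite expr2; exact: meas_mul.
Qed.

Lemma meas_inv (a : T -> X) : measurable_fun setT a ->
  measurable_fun setT (fun t => (a t)^-1 : X)%R.
Proof. by move=> ma; exact: (measurableT_comp measurable_inv ma). Qed.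

Lemma meas_EFin (a : T -> X) : measurable_fun setT a ->
  measurable_fun setT (fun t => (a t)%:E : \bar R).
Proof. by move=> ma; apply/measurable_EFinP. Qed.

Lemma meas_fine (a : T -> \bar R) : measurable_fun setT a ->
  measurable_fun setT (fun t => fine (a t) : X).
Proof. by move=> ma; apply: (measurableT_comp (@fine_measurable _ setT measurableT) ma). Qed.

Lemma meas_eadd (a b : T -> \bar R) :
  measurable_fun setT a -> measurable_fun setT b ->
  measurable_fun setT (fun t => a t + b t).
Proof. by move=> *; exact: emeasurable_funD. Qed.

Lemma meas_emul (a b : T -> \bar R) :
  measurable_fun setT a -> measurable_fun setT b ->
  measurable_fun setT (fun t => a t * b t).
Proof. by move=> *; exact: emeasurable_funM. Qed.

Lemma meas_comp1 d' (U : measurableType d') (g : X -> U) (a : T -> X) :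
  measurable_fun setT g -> measurable_fun setT a ->
  measurable_fun setT (fun t => g (a t)).
Proof. by move=> mg ma; exact: (measurableT_comp mg ma). Qed.

Lemma meas_comp2 d' (U : measurableType d') (g : X -> X -> U) (a b : T -> X) :
  measurable_fun setT (fun p : X * X => g p.1 p.2) ->
  measurable_fun setT a -> measurable_fun setT b ->
  measurable_fun setT (fun t => g (a t) (b t)).
Proof.
move=> mg ma mb.
exact: (@measurableT_comp _ _ _ _ _ _ (fun p : X * X => g p.1 p.2) _
  (fun t => (a t, b t)) mg (meas_pair _ _ _ _ _ _ ma mb)).
Qed.

End measurability_rules.

Lemma eq_mule {R : realType} (a b c e : \bar R) : a = c -> b = e -> a * b = c * e.
Proof. by move=> -> ->. Qed.

(** The side conditions of the lemmas on integrals are measurability and sign: [meas]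
    and [nonneg] settle them by recursion on the integrand, and [side] dispatches
    between the two. *)
Ltac meas_hyp :=
  match goal with
  | H : measurable_fun _ ?g |- measurable_fun _ (fun t => ?g (@?a t)) =>
      refine (@meas_comp1 _ _ _ _ _ g a H _); cbv beta
  | H : measurable_fun _ (fun p => ?g p.1 p.2)
    |- measurable_fun _ (fun t => ?g (@?a t) (@?b t)) =>
      refine (@meas_comp2 _ _ _ _ _ g a b H _ _); cbv beta
  | H : measurable_fun _ (fun p => ?g p.1 p.2) |- measurable_fun _ (?g ?u) =>
      refine (@meas_comp2 _ _ _ _ _ g (fun=> u) (fun t => t) H _ _)
  | H : measurable_fun _ ?g |- measurable_fun _ ?g => exact H
  end.

Ltac meas1 :=
  lazymatch goal with
  | |- measurable_fun _ (fun _ => ?c) => exact (meas_cst _ _ c)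
  | |- measurable_fun _ fst => exact measurable_fst
  | |- measurable_fun _ snd => exact measurable_snd
  | |- measurable_fun _ (fun t => t) => exact meas_idX
  | |- measurable_fun _ (fun t => (@?a t).1) => refine (meas_fst _ _ _ _ a _); cbv beta
  | |- measurable_fun _ (fun t => (@?a t).2) => refine (meas_snd _ _ _ _ a _); cbv beta
  | |- measurable_fun _ (fun t => (@?a t + @?b t)%R) =>
      first [refine (meas_add a b _ _) | refine (meas_eadd a b _ _)]; cbv beta
  | |- measurable_fun _ (fun t => (@?a t * @?b t)%R) =>
      first [refine (meas_mul a b _ _) | refine (meas_emul a b _ _)]; cbv beta
  | |- measurable_fun _ (fun t => (- @?a t)%R) => refine (meas_opp a _); cbv beta
  | |- measurable_fun _ (fun t => (@?a t ^+ 2)%R) => refine (meas_sqr a _); cbv beta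
  | |- measurable_fun _ (fun t => ((@?a t)^-1)%R) => refine (meas_inv a _); cbv beta
  | |- measurable_fun _ (fun t => (@?a t)%:E) => refine (meas_EFin a _); cbv beta
  | |- measurable_fun _ (fun t => @fine _ (@?a t)) => refine (meas_fine a _); cbv beta
  | |- measurable_fun _ (fun t => @?a t + @?b t) => refine (meas_eadd a b _ _); cbv beta
  | |- measurable_fun _ (fun t => @?a t * @?b t) => refine (meas_emul a b _ _); cbv beta
  | |- measurable_fun _ (fun t => \int[_]_x (@?h t x)) => refine (measurable_integral _ _ h _ _); cbv beta
  | |- _ => meas_hyp
  end.

Ltac nonneg_hyp :=
  match goal with
  | H : forall x y, is_true (_ <= ?g x y) |- is_true (_ <= ?g _ _) => exact (H _ _)
  | H : forall x y, is_true (_ <= ?g x y)%R |- is_true (_ <= ?g _ _)%R => exact (H _ _)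
  | H : forall x, is_true (_ <= ?g x) |- is_true (_ <= ?g _) => exact (H _)
  | H : forall x, is_true (_ <= ?g x)%R |- is_true (_ <= ?g _)%R => exact (H _)
  | H : is_true (_ <= ?u)%R |- is_true (_ <= ?u)%R => exact H
  | H : is_true (_ <= ?u) |- is_true (_ <= ?u) => exact H
  end.

Ltac nonneg1 :=
  lazymatch goal with
  | |- is_true (_ <= \int[_]_(_ in _) _) => apply: integral_ge0 => /= ? _
  | |- is_true (_ <= (_)%:E) => rewrite lee_fin
  | |- is_true (_ <= _ * _) => first [apply: mule_ge0 | apply: mulr_ge0]
  | |- is_true (_ <= _ + _) => first [apply: adde_ge0 | apply: addr_ge0]
  | |- is_true (_ <= _ * _)%R => first [apply: mulr_ge0 | apply: mule_ge0]
  | |- is_true (_ <= _ + _)%R => first [apply: addr_ge0 | apply: adde_ge0]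
  | |- is_true (_ <= _ ^+ 2)%R => exact: sqr_ge0
  | |- is_true (_ <= _^-1)%R => rewrite invr_ge0
  | |- is_true (_ <= _%:R)%R => exact: ler0n
  | |- _ => first [done | apply: adde_ge0 | apply: mule_ge0]
  end.

Ltac nonneg := intros; cbv beta; repeat first [nonneg_hyp | nonneg1].

Ltac meas := repeat meas1; try solve [nonneg].

Ltac side :=
  lazymatch goal with
  | |- measurable_fun _ _ => meas
  | |- measurable _ => exact: measurableT
  | |- forall _, _ => try (solve [nonneg])
  | |- is_true (0%R <= _) => nonneg
  | |- _ => idtac
  end.

Lemma meas_swap {R : realType} d' (U : measurableType d')
    (g : measurableTypeR R -> measurableTypeR R -> U) :
  measurable_fun setT (fun p : measurableTypeR R * measurableTypeR R => g p.1 p.2) ->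
  measurable_fun setT (fun p : measurableTypeR R * measurableTypeR R => g p.2 p.1).
Proof. by move=> mg; meas. Qed.

(** * Tents and boxes *)

Section tent.
Context {R : realType}.
Notation mu := (@lebesgue_measure R).
Notation X := (measurableTypeR R).

Definition tent (a x : R) : R := Num.max (a - `|x|)%R 0%R.
Definition box (a x : R) : R := \1_(`[0%R, a]%classic : set R) x.

Lemma tent_ge0 a x : (0 <= tent a x)%R.
Proof. by rewrite /tent le_max lexx orbT. Qed.

Lemma box_ge0 a x : (0 <= box a x)%R.
Proof. by rewrite /box indicE. Qed.

(** A tent is a second difference of the absolute value. *)
Lemma tentE a x : (0 <= a)%R ->
  (2 * tent a x = `|x + a| + `|x - a| - 2 * `|x|)%R.
Proof.
move=> a0; rewrite /tent.
case: (leP 0%R x) => hx.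
  rewrite (ger0_norm hx) (@ger0_norm _ (x + a)%R); last lra.
  case: (leP a x) => ha.
    by rewrite (ger0_norm (_ : 0 <= x - a)%R) ?subr_ge0// max_r; lra.
  by rewrite (ltr0_norm (_ : x - a < 0)%R) ?subr_lt0// max_l; lra.
rewrite (ltr0_norm hx) (@ltr0_norm _ (x - a)%R); last lra.
case: (leP (- a)%R x) => ha.
  by rewrite (@ger0_norm _ (x + a)%R) ?max_l; lra.
by rewrite (@ltr0_norm _ (x + a)%R) ?max_r; lra.
Qed.

(** Both sides are the second difference at scale [d] of the second difference
    at scale [a] of the absolute value, up to a factor. *)
Lemma tent_swap a d x : (0 <= a)%R -> (0 <= d)%R ->
  (2 * tent a x - tent a (x + d) - tent a (x - d) =
   2 * tent d x - tent d (x + a) - tent d (x - a))%R.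
Proof.
move=> a0 d0.
suff: (2 * (2 * tent a x) - 2 * tent a (x + d) - 2 * tent a (x - d) =
   2 * (2 * tent d x) - 2 * tent d (x + a) - 2 * tent d (x - a))%R by lra.
rewrite !tentE//.
have -> : (x + a + d = x + d + a)%R by ring.
have -> : (x - a - d = x - d - a)%R by ring.
have -> : (x + a - d = x - d + a)%R by ring.
have -> : (x - a + d = x + d - a)%R by ring.
by ring.
Qed.

Lemma tent_scale a c x : (0 < c)%R -> (tent (c * a) (c * x) = c * tent a x)%R.
Proof.
move=> c0; rewrite /tent normrM gtr0_norm// -mulrBr.
by rewrite -[X in Num.max _ X](mulr0 c) maxr_pMr// ltW.
Qed.

Lemma measurable_tent a : measurable_fun setT (tent a : X -> X).
Proof.
by apply: measurable_maxr => //; apply: measurable_funB.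
Qed.

Lemma measurable_box a : measurable_fun setT (box a : X -> X).
Proof. by apply: measurable_indic. Qed.

Lemma box_tent d s : (0 <= d)%R ->
  \int[mu]_p (box d p * box d (p + s))%:E = (tent d s)%:E.
Proof.
move=> d0.
transitivity (\int[mu]_p (\1_(`[(Num.max 0 (- s))%R, (Num.min d (d - s))%R]%classic : set R) p)%:E).
  apply: eq_integral => p _; rewrite /box !indicE -natrM mulnb; congr (_%:R%:E).
  congr nat_of_bool; apply/idP/idP; rewrite !mem_setE !in_itv/= ge_max le_min.
    move=> /andP[/andP[? ?] /andP[? ?]].
    by apply/andP; split; apply/andP; split; lra.
  move=> /andP[/andP[? ?] /andP[? ?]].
  by apply/andP; split; apply/andP; split; lra.
rewrite integral_indic// setIT [LHS]lebesgue_measure_itv/= lte_fin /tent.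
case: (leP 0%R s) => hs.
  rewrite (ger0_norm hs) max_l ?oppr_le0// min_r; last lra.
  by case: ltP => h; rewrite ?oppr0 ?adde0 ?max_l ?max_r//; lra.
rewrite (ltr0_norm hs) max_r; last lra; rewrite min_l; last lra.
case: ltP => h; last by rewrite max_r//; lra.
by rewrite max_l; [rewrite -EFinB; congr (_%:E); lra|lra].
Qed.

Lemma integral_box d : (0 <= d)%R -> \int[mu]_p (box d p)%:E = d%:E.
Proof.
move=> d0; rewrite /box integral_indic// setIT [LHS]lebesgue_measure_itv/= lte_fin.
by case: ltP; rewrite ?oppr0 ?adde0// => ?; congr (_%:E); lra.
Qed.

Lemma integral_tent d : (0 <= d)%R -> \int[mu]_s (tent d s)%:E = (d ^+ 2)%:E.
Proof.
move=> d0.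
have mb := measurable_box d; have mt := measurable_tent d.
have b0 := box_ge0 d.
transitivity (\int[mu]_s \int[mu]_p (box d p * box d (p + s))%:E).
  by apply: eq_integral => s _; rewrite box_tent.
rewrite tonelli; [|by meas|by nonneg].
transitivity (\int[mu]_p ((box d p)%:E * d%:E)).
  apply: eq_integral => p _; under eq_integral do rewrite EFinM.
  rewrite ge0_integralZl//; [|by meas|by nonneg|by nonneg].
  congr (_ * _); rewrite -[RHS](integral_box _ d0) -(integral_shift (fun x => (box d x)%:E) _ _ p); [|by meas|by nonneg].
  by apply: eq_integral => s _; rewrite addrC.
rewrite ge0_integralZr//; [|by meas|by nonneg].
by rewrite integral_box// -EFinM expr2.
Qed.

(** Averaging both factors over a box of length [d] averages their correlation
    against the tent of width [d], the autocorrelation of that box. *)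
Lemma box_correlation d (g h : X -> \bar R) : (0 <= d)%R ->
    measurable_fun setT g -> measurable_fun setT h ->
    (forall x, 0 <= g x) -> (forall x, 0 <= h x) ->
  \int[mu]_x ((\int[mu]_p ((box d p)%:E * g (x + p)%R)) *
              (\int[mu]_q ((box d q)%:E * h (x + q)%R))) =
  \int[mu]_s ((tent d s)%:E * \int[mu]_x (g x * h (x + s)%R)).
Proof.
move=> d0 mg mh g0 h0.
have mb := measurable_box d; have mt := measurable_tent d.
have b0 := box_ge0 d; have t0 := tent_ge0 d.
pose K s := \int[mu]_x (g x * h (x + s)%R).
have mK : measurable_fun setT K by rewrite /K; meas.
have K0 s : 0 <= K s by rewrite /K; nonneg.
transitivity (\int[mu]_x \int[mu]_p \int[mu]_q
    (((box d p)%:E * g (x + p)%R) * ((box d q)%:E * h (x + q)%R))).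
  apply: eq_integral => x _.
  rewrite -ge0_integralZr//; [|by meas|by nonneg|by nonneg].
  apply: eq_integral => p _.
  by rewrite -ge0_integralZl//; [meas|move=> *; nonneg|nonneg].
rewrite tonelli; [|by meas|by nonneg].
transitivity (\int[mu]_p \int[mu]_s ((box d p * box d (p + s))%:E * K s)).
  apply: eq_integral => p _.
  rewrite tonelli; [|by meas|by nonneg].
  rewrite -(integral_shift _ _ _ p) /=; [|by meas|by nonneg].
  apply: eq_integral => s _; rewrite [(s + p)%R]addrC /K.
  rewrite -ge0_integralZl//; [|by meas|by nonneg|by nonneg].
  rewrite -(integral_shift (fun x => (box d p * box d (p + s))%:E * _) _ _ p); [|by meas|by nonneg].
  apply: eq_integral => x _.
  by rewrite addrA EFinM muleACA.
rewrite tonelli; [|by meas|by nonneg].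
apply: eq_integral => s _.
rewrite ge0_integralZr//; [|by meas|by nonneg].
by rewrite box_tent.
Qed.

End tent.

(** * Correlations of a plane function *)

HB.lock Definition autocorr {R : realType}
    (f : measurableTypeR R -> measurableTypeR R -> R)
    (a b : measurableTypeR R) : \bar R :=
  \int[lebesgue_measure]_x \int[lebesgue_measure]_y
    (f x y * f (x + a)%R (y + b)%R)%:E.

(** The average of [autocorr f] around [(a, b)] against a product of tents, which is
    the autocorrelation of [average d f] by [smooth_corrE]. *)
HB.lock Definition smooth_corr {R : realType} (d : R)
    (f : measurableTypeR R -> measurableTypeR R -> R)
    (a b : measurableTypeR R) : \bar R :=
  \int[lebesgue_measure]_s ((tent d s)%:E *
    \int[lebesgue_measure]_t ((tent d t)%:E * autocorr f (a + s)%R (b + t)%R)).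

(** A moving average without the normalization [d ^- 2]. *)
HB.lock Definition average {R : realType} (d : R)
    (f : measurableTypeR R -> measurableTypeR R -> R)
    (x y : measurableTypeR R) : R :=
  fine (\int[lebesgue_measure]_p ((box d p)%:E *
    \int[lebesgue_measure]_q ((box d q)%:E * (f (x + p) (y + q))%:E))).

(** The factor [2^-1] makes this the loss of [smooth_corr d f] from [(0, 0)] to
    [(a, b)], by [smooth_corrD_oscillation]. *)
HB.lock Definition oscillation {R : realType} (d : R)
    (f : measurableTypeR R -> measurableTypeR R -> R)
    (a b : measurableTypeR R) : \bar R :=
  \int[lebesgue_measure]_x \int[lebesgue_measure]_y
    (2^-1 * (average d f (x + a)%R (y + b)%R - average d f x y) ^+ 2)%:E.

HB.lock Definition mass {R : realType}
    (f : measurableTypeR R -> measurableTypeR R -> R) : \bar R :=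
  \int[lebesgue_measure]_x \int[lebesgue_measure]_y (f x y)%:E.

Section correlation.
Context {R : realType}.
Notation mu := (@lebesgue_measure R).
Notation X := (measurableTypeR R).

Section fixed_function.
Variable f : X -> X -> R.
Hypothesis mf : measurable_fun setT (fun p : X * X => f p.1 p.2).
Hypothesis f0 : forall x y, (0 <= f x y)%R.
Hypothesis f1 : forall x y, (f x y <= 1)%R.

Lemma measurable_autocorr :
  measurable_fun setT (fun p : X * X => autocorr f p.1 p.2).
Proof. by rewrite autocorr.unlock; meas. Qed.

Lemma autocorr_ge0 a b : 0 <= autocorr f a b.
Proof. by rewrite autocorr.unlock; nonneg. Qed.

Lemma autocorr_le_mass a b : autocorr f a b <= mass f.
Proof.
rewrite autocorr.unlock mass.unlock.
apply: ge0_le_integral => //; [by nonneg|by meas|by meas|move=> x _].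
apply: ge0_le_integral => //; [by nonneg|by meas|by meas|move=> y _].
by rewrite lee_fin -[leRHS]mulr1 ler_wpM2l.
Qed.

Lemma mass_ge0 : 0 <= mass f.
Proof. by rewrite mass.unlock; nonneg. Qed.

Section smoothing.
Variable d : R.
Hypothesis d0 : (0 <= d)%R.
Let mb := measurable_box d.
Let mt := measurable_tent d.
Let b0 := box_ge0 d.
Let t0 := tent_ge0 d.
Let mg := measurable_autocorr.
Let g0 := autocorr_ge0.

Lemma smooth_corr_ge0 a b : 0 <= smooth_corr d f a b.
Proof. by rewrite smooth_corr.unlock; nonneg. Qed.

Lemma integral_tent_le (k : X -> \bar R) M : measurable_fun setT k ->
  (forall x, 0 <= k x) -> (forall x, k x <= M) ->
  \int[mu]_s ((tent d s)%:E * k s) <= (d ^+ 2)%:E * M.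
Proof.
move=> mk k0 kM; have M0 : 0 <= M by exact: le_trans (k0 0%R) _.
apply: (@le_trans _ _ (\int[mu]_s ((tent d s)%:E * M))).
  apply: ge0_le_integral => //; [by nonneg|by meas|by meas|move=> x _].
  by apply: lee_wpmul2l; rewrite ?lee_fin.
rewrite ge0_integralZr//; [|by meas|by nonneg].
by rewrite integral_tent.
Qed.

Lemma smooth_corr_le a b : smooth_corr d f a b <= (d ^+ 2)%:E * ((d ^+ 2)%:E * mass f).
Proof.
rewrite smooth_corr.unlock.
apply: integral_tent_le; [by meas|by nonneg|move=> s].
apply: integral_tent_le; [by meas|by nonneg|move=> t].
exact: autocorr_le_mass.
Qed.

Lemma averageE x y : (average d f x y)%:E = \int[mu]_p ((box d p)%:E *
    \int[mu]_q ((box d q)%:E * (f (x + p) (y + q))%:E)).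
Proof.
rewrite average.unlock fineK//.
have bnd (k : X -> \bar R) M : measurable_fun setT k ->
    (forall x, 0 <= k x) -> (forall x, k x <= M) ->
    \int[mu]_s ((box d s)%:E * k s) <= d%:E * M.
  move=> mk k0 kM; have M0 : 0 <= M by exact: le_trans (k0 0%R) _.
  apply: (@le_trans _ _ (\int[mu]_s ((box d s)%:E * M))).
    apply: ge0_le_integral => //; [by nonneg|by meas|by meas|move=> z _].
    by apply: lee_wpmul2l; rewrite ?lee_fin.
  rewrite ge0_integralZr//; [|by meas|by nonneg].
  by rewrite integral_box.
rewrite ge0_fin_numE; last by nonneg.
apply: (@le_lt_trans _ _ (d%:E * (d%:E * 1%:E))); last by rewrite -!EFinM ltry.
apply: (bnd); [by meas|by nonneg|move=> p].
apply: (bnd); [by meas|by nonneg|move=> q].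
by rewrite lee_fin.
Qed.

Lemma measurable_average :
  measurable_fun setT (fun p : X * X => average d f p.1 p.2 : X).
Proof. by rewrite average.unlock; meas. Qed.

Lemma average_ge0 x y : (0 <= average d f x y)%R.
Proof. by rewrite -lee_fin averageE; nonneg. Qed.

Let ma := measurable_average.
Let a0 := average_ge0.

(** [box_correlation] in each of the two variables. *)
Lemma smooth_corrE a b : smooth_corr d f a b =
  \int[mu]_x \int[mu]_y (average d f x y * average d f (x + a)%R (y + b)%R)%:E.
Proof.
rewrite smooth_corr.unlock.
have [h hE] : {h : X -> X -> \bar R | h = fun y x =>
    \int[mu]_q ((box d q)%:E * (f x (y + q)%R)%:E)} by eexists.
have h0 y x : 0 <= h y x by rewrite hE; nonneg.
have mh : measurable_fun setT (fun p : X * X => h p.1 p.2) by rewrite hE; meas.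
transitivity (\int[mu]_y \int[mu]_s ((tent d s)%:E *
    \int[mu]_x (h y x * h (y + b)%R (x + a + s)%R))); last first.
  rewrite [RHS]tonelli; [|by meas|by nonneg].
  apply: eq_integral => y _.
  transitivity (\int[mu]_s ((tent d s)%:E *
      \int[mu]_x (h y x * h (y + b)%R (x + s + a)%R))).
    apply: eq_integral => s _; apply: eq_mule => //; apply: eq_integral => x _.
    by rewrite [(x + a + s)%R]addrAC.
  have mh1 : measurable_fun setT (fun x : X => h y x) by meas.
  have mh2 : measurable_fun setT (fun x : X => h (y + b)%R (x + a)%R) by meas.
  rewrite -(box_correlation d (h y) _ d0 mh1 mh2 (h0 y) (fun x => h0 _ _)).
  apply: eq_integral => x _.
  rewrite EFinM hE; apply: eq_mule; first by apply/esym/averageE.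
  apply: etrans; last by apply/esym/averageE.
  by apply: eq_integral => q _; rewrite [(x + a + q)%R]addrAC.
rewrite tonelli; [|by meas|by nonneg].
apply: eq_integral => s _.
rewrite [RHS]ge0_integralZl//; [|by meas|by nonneg|by nonneg].
apply: eq_mule => //.
rewrite tonelli; [|by meas|by nonneg].
transitivity (\int[mu]_x \int[mu]_t ((tent d t)%:E * \int[mu]_y
    ((f x y)%:E * (f (x + a + s)%R (y + b + t)%R)%:E))); last first.
  apply: eq_integral => x _.
  transitivity (\int[mu]_t ((tent d t)%:E * \int[mu]_y
    ((f x y)%:E * (f (x + a + s)%R (y + t + b)%R)%:E))).
    apply: eq_integral => t _; apply: eq_mule => //; apply: eq_integral => y _.
    by rewrite [(y + b + t)%R]addrAC.
  have mh1 : measurable_fun setT (fun y : X => (f x y)%:E) by meas.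
  have mh2 : measurable_fun setT (fun y : X => (f (x + a + s)%R (y + b)%R)%:E) by meas.
  have h1 y : 0 <= (f x y)%:E by rewrite lee_fin.
  have h2 y : 0 <= (f (x + a + s)%R (y + b)%R)%:E by rewrite lee_fin.
  rewrite -(box_correlation d _ _ d0 mh1 mh2 h1 h2).
  apply: eq_integral => y _; rewrite hE; apply: eq_mule => //; apply: eq_integral => q _.
  by rewrite [(y + b + q)%R]addrAC.
rewrite tonelli; [|by meas|by nonneg].
apply: eq_integral => t _.
rewrite [RHS]ge0_integralZl; [|exact: measurableT|by meas|by nonneg|by nonneg].
apply: eq_mule; first by []; rewrite autocorr.unlock.
by apply: eq_integral => x _; apply: eq_integral => y _; rewrite EFinM !addrA.
Qed.

End smoothing.
End fixed_function.
End correlation.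

Section oscillation.
Context {R : realType}.
Notation mu := (@lebesgue_measure R).
Notation X := (measurableTypeR R).

Lemma integral_shift2 (h : X -> X -> \bar R) (a b : X) :
  measurable_fun setT (fun p : X * X => h p.1 p.2) -> (forall x y, 0 <= h x y) ->
  \int[mu]_x \int[mu]_y h (x + a)%R (y + b)%R = \int[mu]_x \int[mu]_y h x y.
Proof.
move=> mh h0.
rewrite -[RHS](integral_shift _ _ _ a); side.
apply: eq_integral => x _.
by rewrite -[RHS](integral_shift _ _ _ b); side.
Qed.

Lemma integral2_lincomb (h g : X -> X -> \bar R) :
  measurable_fun setT (fun p : X * X => h p.1 p.2) -> (forall x y, 0 <= h x y) ->
  measurable_fun setT (fun p : X * X => g p.1 p.2) -> (forall x y, 0 <= g x y) ->
  2%:E * \int[mu]_x \int[mu]_y h x y + 2%:E * \int[mu]_x \int[mu]_y g x y =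
  \int[mu]_x \int[mu]_y (2%:E * h x y + 2%:E * g x y).
Proof.
move=> mh h0 mg g0.
rewrite -ge0_integralZl; side.
rewrite -ge0_integralZl; side.
rewrite -ge0_integralD; side.
apply: eq_integral => x _.
rewrite -ge0_integralZl; side.
rewrite -ge0_integralZl; side.
by rewrite -ge0_integralD; side.
Qed.

(** [tent_swap] under the integral: the second difference with step [c] of the
    averages against [tent d] is symmetric in [c] and [d]. *)
Lemma tent_average_swap (k : X -> \bar R) (c d : R) :
    measurable_fun setT k -> (forall x, 0 <= k x) -> (0 <= c)%R -> (0 <= d)%R ->
  2%:E * \int[mu]_s ((tent c s)%:E * k s) +
    (\int[mu]_s ((tent d s)%:E * k (c + s)%R) + \int[mu]_s ((tent d s)%:E * k (- c + s)%R)) =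
  2%:E * \int[mu]_s ((tent d s)%:E * k s) +
    (\int[mu]_s ((tent c s)%:E * k (d + s)%R) + \int[mu]_s ((tent c s)%:E * k (- d + s)%R)).
Proof.
move=> mk k0 c0 d0.
have shiftE e z : \int[mu]_s ((tent e s)%:E * k (z + s)%R) =
    \int[mu]_s ((tent e (s - z)%R)%:E * k s).
  have mt := measurable_tent e; have t0 := tent_ge0 e.
  rewrite -[RHS](integral_shift _ _ _ z); side.
  by apply: eq_integral => s _; rewrite addrK [(s + z)%R]addrC.
have sumE e z : 2%:E * \int[mu]_s ((tent e s)%:E * k s) +
    (\int[mu]_s ((tent z s)%:E * k (e + s)%R) + \int[mu]_s ((tent z s)%:E * k (- e + s)%R)) =
    \int[mu]_s ((2 * tent e s + (tent z (s - e) + tent z (s + e)))%:E * k s).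
  have mt := measurable_tent e; have t0 := tent_ge0 e.
  have mt' := measurable_tent z; have t0' := tent_ge0 z.
  rewrite !shiftE -ge0_integralZl; side.
  rewrite -ge0_integralD; side.
  rewrite -ge0_integralD; side.
  apply: eq_integral => s _.
  by rewrite opprK muleA -EFinM -ge0_muleDl ?lee_fin// -EFinD -ge0_muleDl ?lee_fin ?addr_ge0 ?mulr_ge0// -EFinD.
rewrite !sumE; apply: eq_integral => s _; congr (_%:E * _).
by have := tent_swap c d s c0 d0; lra.
Qed.

Section fixed_function.
Variable f : X -> X -> R.
Hypothesis mf : measurable_fun setT (fun p : X * X => f p.1 p.2).
Hypothesis f0 : forall x y, (0 <= f x y)%R.
Hypothesis f1 : forall x y, (f x y <= 1)%R.
Variable d : R.
Hypothesis d0 : (0 <= d)%R.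

Let ma := measurable_average f mf f0 d.
Let a0 := average_ge0 f mf f0 f1 d d0.
Let mt := measurable_tent d.
Let t0 := tent_ge0 d.
Let mg := measurable_autocorr f mf f0.
Let g0 := autocorr_ge0 f f0.

Let half0 : (0 <= 2^-1 :> R)%R. Proof. by rewrite invr_ge0. Qed.

Lemma measurable_oscillation :
  measurable_fun setT (fun p : X * X => oscillation d f p.1 p.2).
Proof. by rewrite oscillation.unlock; meas. Qed.

Lemma oscillation_ge0 a b : 0 <= oscillation d f a b.
Proof. by rewrite oscillation.unlock; nonneg. Qed.

(** Expand the square: the two square terms have the same integral by translation
    invariance. *)
Lemma smooth_corrD_oscillation a b :
  smooth_corr d f a b + oscillation d f a b = smooth_corr d f 0%R 0%R.
Proof.
rewrite !smooth_corrE// oscillation.unlock.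
have [F FE] : {F | F = average d f} by eexists.
have mF : measurable_fun setT (fun p : X * X => F p.1 p.2 : X) by rewrite FE.
have F0 x y : (0 <= F x y)%R by rewrite FE.
rewrite -FE.
have [h hE] : {h : X -> X -> \bar R | h = fun x y => (2^-1 * F x y ^+ 2)%:E}.
  by eexists.
have mh : measurable_fun setT (fun p : X * X => h p.1 p.2) by rewrite hE; meas.
have h0 x y : 0 <= h x y by rewrite hE; nonneg.
rewrite -ge0_integralD; side.
transitivity (\int[mu]_x \int[mu]_y (h x y + h (x + a)%R (y + b)%R)).
  apply: eq_integral => x _.
  rewrite -ge0_integralD; side.
  by apply: eq_integral => y _; rewrite hE -!EFinD; congr (_%:E); field.
transitivity (\int[mu]_x \int[mu]_y h x y + \int[mu]_x \int[mu]_y h (x + a)%R (y + b)%R).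
  rewrite -ge0_integralD; side.
  by apply: eq_integral => x _; rewrite ge0_integralD; side.
rewrite (integral_shift2 h); side.
rewrite -ge0_integralD; side.
apply: eq_integral => x _.
rewrite -ge0_integralD; side.
by apply: eq_integral => y _; rewrite hE !addr0 -!EFinD; congr (_%:E); field.
Qed.

(** Go from [(x, y)] to [(x + a, y + b)] through [(x, y + b)]. *)
Lemma oscillation_le_axes a b :
  oscillation d f a b <= 2%:E * oscillation d f a 0%R + 2%:E * oscillation d f 0%R b.
Proof.
rewrite oscillation.unlock.
have [F FE] : {F | F = average d f} by eexists.
have mF : measurable_fun setT (fun p : X * X => F p.1 p.2 : X) by rewrite FE.
have F0 x y : (0 <= F x y)%R by rewrite FE.
rewrite -FE.
have [h hE] : {h : X -> X -> \bar R |
  h = fun x y => (2^-1 * (F (x + a) y - F x y) ^+ 2)%:E} by eexists.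
have [g gE] : {g : X -> X -> \bar R |
  g = fun x y => (2^-1 * (F x (y + b) - F x y) ^+ 2)%:E} by eexists.
have mh : measurable_fun setT (fun p : X * X => h p.1 p.2) by rewrite hE; meas.
have h0 x y : 0 <= h x y by rewrite hE; nonneg.
have mg' : measurable_fun setT (fun p : X * X => g p.1 p.2) by rewrite gE; meas.
have g0' x y : 0 <= g x y by rewrite gE; nonneg.
have -> : \int[mu]_x \int[mu]_y (2^-1 * (F (x + a) (y + 0) - F x y) ^+ 2)%:E =
    \int[mu]_x \int[mu]_y h (x + 0)%R (y + b)%R.
  rewrite (integral_shift2 h); side.
  by apply: eq_integral => x _; apply: eq_integral => y _; rewrite hE addr0.
have -> : \int[mu]_x \int[mu]_y (2^-1 * (F (x + 0) (y + b) - F x y) ^+ 2)%:E =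
    \int[mu]_x \int[mu]_y g x y.
  by apply: eq_integral => x _; apply: eq_integral => y _; rewrite gE addr0.
rewrite integral2_lincomb; side.
apply: ge0_le_integral; side; move=> x _.
apply: ge0_le_integral; side; move=> y _.
rewrite hE gE -!EFinM -EFinD lee_fin !addr0.
by have := sqr_ge0 (F (x + a) (y + b) + F x y - 2 * F x (y + b))%R; nra.
Qed.

Lemma smooth_corr_fin_num a b : mass f < +oo -> smooth_corr d f a b \is a fin_num.
Proof.
move=> fin; have S0 := smooth_corr_ge0 f f0 d a b.
rewrite ge0_fin_numE//.
apply: le_lt_trans (smooth_corr_le f mf f0 f1 d d0 a b) _.
have /fineK <- : mass f \is a fin_num by rewrite ge0_fin_numE// mass_ge0.
by rewrite -!EFinM ltry.
Qed.

(** The exchange of tents bounds the second difference of [smooth_corr d f] with step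
    [a] by twice an average against the tent of width [`|a|], whose integral is
    [a ^+ 2]. *)
Lemma oscillation_first_axis a : mass f < +oo ->
  oscillation d f a 0%R <= (2 * (a ^+ 2 * d ^+ 2))%:E * mass f.
Proof.
move=> fin.
have [k kE] : {k : X -> \bar R | k = fun s => \int[mu]_t ((tent d t)%:E *
    autocorr f s (0 + t)%R)} by eexists.
have mk : measurable_fun setT k by rewrite kE; meas.
have k0 s : 0 <= k s by rewrite kE; nonneg.
have kM s : k s <= (d ^+ 2)%:E * mass f.
  by rewrite kE; apply: (integral_tent_le d d0); side; move=> t; exact: autocorr_le_mass.
have SE z : smooth_corr d f z 0%R = \int[mu]_s ((tent d s)%:E * k (z + s)%R).
  by rewrite smooth_corr.unlock kE.
have V0 := oscillation_ge0.
have [c [cE c0 c2]] : exists c : R, [/\ c = `|a|%R, (0 <= c)%R & (c ^+ 2 = a ^+ 2)%R].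
  by exists `|a|%R; rewrite normr_ge0 real_normK ?num_real.
apply: (@le_trans _ _ (oscillation d f c 0%R + oscillation d f (- c)%R 0%R)).
  rewrite cE; case: (ger0P a) => _; first by apply: leeDl; exact: V0.
  by rewrite opprK; apply: leeDr; exact: V0.
have J0 := tent_ge0 c.
have := tent_average_swap k c d mk k0 c0 d0.
have : \int[mu]_s ((tent c s)%:E * k s) <= (c ^+ 2)%:E * ((d ^+ 2)%:E * mass f).
  exact: (integral_tent_le c c0).
rewrite c2 -!SE => Jle.
have -> : \int[mu]_s ((tent d s)%:E * k s) = smooth_corr d f 0%R 0%R.
  by rewrite SE; apply: eq_integral => s _; rewrite add0r.
set K := (X in _ = _ + X).
have mtc := measurable_tent c.
have K0 : 0 <= K by rewrite /K; nonneg.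
have := smooth_corrD_oscillation c 0%R.
have := smooth_corrD_oscillation (- c)%R 0%R.
have fS z := smooth_corr_fin_num z 0%R fin.
have J1 : 0 <= \int[mu]_s ((tent c s)%:E * k s) by nonneg.
have mE : mass f = (fine (mass f))%:E.
  by rewrite fineK// ge0_fin_numE// mass_ge0.
move: Jle J1 K0; rewrite {}mE; move: (\int[mu]_s ((tent c s)%:E * k s)) K => J K.
rewrite -(fineK (fS 0%R)) -(fineK (fS c)) -(fineK (fS (- c)%R)).
move: (V0 c 0%R) (V0 (- c)%R 0%R).
move: (oscillation _ _ _ _) (oscillation _ _ _ _) => [v| |] [w| |]//= v0 w0.
case: J => [J| |]//= Jle J0' K0 [E1] [E2]; case: K K0 => [K| |]//= K0 [E3].
move: Jle K0; rewrite -EFinD -!EFinM !lee_fin => Jle K0.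
clear -Jle K0 E1 E2 E3; move: Jle E1 E2 E3.
move: (fine (mass f)) (fine (smooth_corr d f c 0%R)) (fine (smooth_corr d f (- c)%R 0%R))
  (fine (smooth_corr d f 0%R 0%R)) => M s1 s2 s3.
by rewrite mulrA => Jle E1 E2 E3; lra.
Qed.

Lemma mass_swap : mass (fun x y => f y x) = mass f.
Proof. by rewrite mass.unlock tonelli; side. Qed.

Lemma oscillation_swap a b : oscillation d (fun x y => f y x) a b = oscillation d f b a.
Proof.
have avE x y : average d (fun x y => f y x) x y = average d f y x.
  apply: EFin_inj; rewrite (averageE f mf f0 f1 d d0) (averageE (fun x y => f y x)
    (meas_swap _ _ _ mf) (fun x y => f0 y x) (fun x y => f1 y x) d d0).
  have mb := measurable_box d; have b0 := box_ge0 d.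
  transitivity (\int[mu]_p \int[mu]_q ((box d p)%:E * ((box d q)%:E * (f (y + q) (x + p))%:E))).
    by apply: eq_integral => p _; rewrite [RHS]ge0_integralZl; side.
  rewrite tonelli; side.
  apply: eq_integral => q _; rewrite -[RHS]ge0_integralZl; side.
  by apply: eq_integral => p _; rewrite muleCA.
rewrite oscillation.unlock; under eq_integral => x _ do under eq_integral => y _ do rewrite !avE.
by rewrite tonelli; side.
Qed.

End fixed_function.
End oscillation.

(** * Slices along the lines of a given slope *)

HB.lock Definition slice {R : realType}
    (f : measurableTypeR R -> measurableTypeR R -> R)
    (m u : measurableTypeR R) : \bar R :=
  \int[lebesgue_measure]_x (f x (u - m * x)%R)%:E.

HB.lock Definition slice_corr {R : realType}
    (f : measurableTypeR R -> measurableTypeR R -> R)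
    (m b : measurableTypeR R) : \bar R :=
  \int[lebesgue_measure]_u (slice f m u * slice f m (u + b)%R).

HB.lock Definition slice_increment {R : realType}
    (f : measurableTypeR R -> measurableTypeR R -> R)
    (d m : measurableTypeR R) : \bar R :=
  \int[lebesgue_measure]_u
    ((fine (slice f m (u + d)%R) - fine (slice f m u)) ^+ 2)%:E.

Section chart.
Context {R : realType}.
Notation mu := (@lebesgue_measure R).
Notation X := (measurableTypeR R).

(** As a distribution, the second derivative of [weight] is [2] at the slope [0], [1]
    at the slopes [2] and [-2], and [-2] at the slopes [1 / 2] and [- 1 / 2]. Exchanging
    the axes exchanges the last two pairs up to a factor [2], and the sum over the
    two charts of these masses then only involves the slope [0]. *)
Definition weight (m : R) : R := (tent 2 m - 2 * tent 2^-1 m)%R.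

Lemma weight_ge0 m : (0 <= weight m)%R.
Proof.
rewrite /weight /tent; have := normr_ge0 m.
by case: (leP (2 - `|m|)%R 0%R) => ?; case: (leP (2^-1 - `|m|)%R 0%R) => ?; lra.
Qed.

Lemma measurable_weight : measurable_fun setT (weight : X -> X).
Proof.
have h2 := measurable_tent (2 : R)%R; have h3 := measurable_tent (2^-1 : R)%R.
by rewrite (_ : weight = fun m => tent 2 m - 2 * tent 2^-1 m)%R//; meas.
Qed.

(** At the horizontal distance [a] the slope [m] is the height [m * a], so that the
    tents of [weight] become tents in the height. *)
Lemma weight_average (k : X -> \bar R) (a b : R) : measurable_fun setT k ->
    (forall x, 0 <= k x) -> a != 0%R ->
  (a ^+ 2)%:E * \int[mu]_m ((weight m)%:E * k (b - m * a)%R) +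
    2%:E * \int[mu]_s ((tent (2^-1 * `|a|) s)%:E * k (b + s)%R) =
  \int[mu]_s ((tent (2 * `|a|) s)%:E * k (b + s)%R).
Proof.
move=> mk k0 a0.
have a_gt0 : (0 < `|a|)%R by rewrite normr_gt0.
have mw := measurable_weight; have w0 := weight_ge0.
have scaleE (c : R) : \int[mu]_s ((tent (c * `|a|) s)%:E * k (b + s)%R) =
    (a ^+ 2)%:E * \int[mu]_m ((tent c m)%:E * k (b - m * a)%R).
  have mtc := measurable_tent c; have mtc' := measurable_tent (c * `|a|)%R.
  have tc := tent_ge0 c; have tc' := tent_ge0 (c * `|a|)%R.
  have Na0 : (- a != 0)%R by rewrite oppr_eq0.
  have := integral_scale (fun s => (tent (c * `|a|) s)%:E * k (b + s)%R) (- a)%R.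
  move=> /(_ _ _ Na0) H.
  have {}H : \int[mu]_x ((tent (c * `|a|) (- a * x))%:E * k (b + - a * x)%R) =
    (`|- a|%R^-1)%:E * \int[mu]_s ((tent (c * `|a|) s)%:E * k (b + s)%R).
    by apply: H; side.
  rewrite normrN in H.
  have <- : `|a|%:E * \int[mu]_x ((tent (c * `|a|) (- a * x))%:E * k (b + - a * x)%R)
     = \int[mu]_s ((tent (c * `|a|) s)%:E * k (b + s)%R).
    by rewrite H muleA -EFinM mulfV ?gt_eqF// mul1e.
  transitivity (`|a|%:E * \int[mu]_m (`|a|%:E * ((tent c m)%:E * k (b - m * a)%R))).
    apply: eq_mule => //; apply: eq_integral => m _.
    rewrite muleA -EFinM -tent_scale// [(c * _)%R]mulrC; congr (_%:E * k _).
      by rewrite /tent !normrM normrN normr_id.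
    by ring.
  rewrite ge0_integralZl; side.
  by rewrite muleA -EFinM -expr2 real_normK ?num_real.
rewrite !scaleE.
have mt := measurable_tent (2^-1 : R); have t0 := tent_ge0 (2^-1 : R).
rewrite muleCA -ge0_muleDr; side.
apply: eq_mule => //.
rewrite -ge0_integralZl; side.
rewrite -ge0_integralD; side.
apply: eq_integral => m _.
rewrite muleA -EFinM -ge0_muleDl; side.
by rewrite /weight -EFinD; congr (_%:E * _); ring.
Qed.

Section fixed_function.
Variable f : X -> X -> R.
Hypothesis mf : measurable_fun setT (fun p : X * X => f p.1 p.2).
Hypothesis f0 : forall x y, (0 <= f x y)%R.
Hypothesis f1 : forall x y, (f x y <= 1)%R.

Lemma measurable_slice : measurable_fun setT (fun p : X * X => slice f p.1 p.2).
Proof. by rewrite slice.unlock; meas. Qed.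

Lemma slice_ge0 m u : 0 <= slice f m u.
Proof. by rewrite slice.unlock; nonneg. Qed.

Let ms := measurable_slice.
Let s0 := slice_ge0.

Lemma measurable_slice_corr :
  measurable_fun setT (fun p : X * X => slice_corr f p.1 p.2).
Proof. by rewrite slice_corr.unlock; meas. Qed.

Lemma slice_corr_ge0 m b : 0 <= slice_corr f m b.
Proof. by rewrite slice_corr.unlock; nonneg. Qed.

Lemma integral_slice m : \int[mu]_u slice f m u = mass f.
Proof.
rewrite slice.unlock mass.unlock tonelli; side.
apply: eq_integral => x _.
by rewrite (integral_shift (fun y => (f x y)%:E)); side.
Qed.

(** Two points [(x, y)] and [(x + a, y')] lie on lines of slope [- m] whose offsets
    differ by [b] when [y' - y = b - m * a]. *)
Lemma slice_corrE m b :
  slice_corr f m b = \int[mu]_a autocorr f a (b - m * a)%R.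
Proof.
rewrite slice_corr.unlock autocorr.unlock.
transitivity (\int[mu]_u \int[mu]_x \int[mu]_a
    ((f x (u - m * x)%R)%:E * (f (x + a)%R (u + b - m * (x + a))%R)%:E)).
  apply: eq_integral => u _; rewrite {1}slice.unlock.
  rewrite -ge0_integralZr; side.
  apply: eq_integral => x _; rewrite slice.unlock.
  rewrite -ge0_integralZl; side.
  rewrite -[LHS](integral_shift _ _ _ x); side.
  by apply: eq_integral => a _; rewrite [(a + x)%R]addrC.
rewrite tonelli; side.
transitivity (\int[mu]_x \int[mu]_y \int[mu]_a
    ((f x y)%:E * (f (x + a)%R (y + (b - m * a))%R)%:E)).
  apply: eq_integral => x _.
  rewrite -[RHS](integral_shift _ _ _ (- (m * x))%R); side.
  apply: eq_integral => y _; apply: eq_integral => a _; congr (_ * (f _ _)%:E).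
  by ring.
transitivity (\int[mu]_x \int[mu]_a \int[mu]_y
    ((f x y)%:E * (f (x + a)%R (y + (b - m * a))%R)%:E)).
  by apply: eq_integral => x _; rewrite tonelli; side.
by rewrite tonelli; side.
Qed.

(** For a fixed horizontal distance [a], averaging over the slopes gives tents of
    widths [2 * `|a|] and [2^-1 * `|a|] in the height, by [weight_average];
    [tent_average_swap] exchanges them with the tent of width [d], and the
    smoothed correlations that appear are constants minus oscillations. The
    second difference in the offset with step [d] thereby becomes one with
    steps [2 * a] and [2^-1 * a]. *)
Lemma chart_identity d a : (0 <= d)%R -> mass f < +oo -> a != 0%R ->
  (a^-1 ^+ 2)%:E * (2%:E * oscillation d f a 0%R +
      (oscillation d f a (2 * a)%R + oscillation d f a (- (2 * a))%R)) +
    (\int[mu]_m ((weight m)%:E * \int[mu]_s ((tent d s)%:E *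
        autocorr f (a + s)%R (d - m * a)%R)) +
     \int[mu]_m ((weight m)%:E * \int[mu]_s ((tent d s)%:E *
        autocorr f (a + s)%R (- d - m * a)%R))) =
  2%:E * \int[mu]_m ((weight m)%:E * \int[mu]_s ((tent d s)%:E *
        autocorr f (a + s)%R (0 - m * a)%R)) +
  (a^-1 ^+ 2)%:E * (2%:E * (oscillation d f a (2^-1 * a)%R +
      oscillation d f a (- (2^-1 * a))%R)).
Proof.
move=> d0 fin a0.
have mg := measurable_autocorr f mf f0; have g0 := autocorr_ge0 f f0.
have mt := measurable_tent d; have t0 := tent_ge0 d.
have [k kE] : {k : X -> \bar R | k = fun b => \int[mu]_s ((tent d s)%:E *
    autocorr f (a + s)%R b)} by eexists.
have mk : measurable_fun setT k by rewrite kE; meas.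
have k0 s : 0 <= k s by rewrite kE; nonneg.
have [M M0 kM] : exists2 M : R, (0 <= M)%R & forall s, k s <= M%:E.
  have fM : mass f \is a fin_num by rewrite ge0_fin_numE// mass_ge0.
  exists (d ^+ 2 * fine (mass f))%R.
    by rewrite mulr_ge0 ?sqr_ge0// fine_ge0// mass_ge0.
  move=> s; rewrite EFinM fineK// kE.
  by apply: (integral_tent_le d d0); side; move=> t; exact: autocorr_le_mass.
have -> : (fun m : X => (weight m)%:E * \int[mu]_s ((tent d s)%:E *
    autocorr f (a + s)%R (d - m * a)%R)) = fun m => (weight m)%:E * k (d - m * a)%R.
  by rewrite kE.
have -> : (fun m : X => (weight m)%:E * \int[mu]_s ((tent d s)%:E *
    autocorr f (a + s)%R (- d - m * a)%R)) = fun m => (weight m)%:E * k (- d - m * a)%R.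
  by rewrite kE.
have -> : (fun m : X => (weight m)%:E * \int[mu]_s ((tent d s)%:E *
    autocorr f (a + s)%R (0 - m * a)%R)) = fun m => (weight m)%:E * k (0 - m * a)%R.
  by rewrite kE.
have SE b : smooth_corr d f a b = \int[mu]_s ((tent d s)%:E * k (b + s)%R).
  rewrite smooth_corr.unlock kE.
  transitivity (\int[mu]_s \int[mu]_t ((tent d s)%:E * ((tent d t)%:E *
      autocorr f (a + s)%R (b + t)%R))).
    by apply: eq_integral => s _; rewrite ge0_integralZl; side.
  rewrite tonelli; side; apply: eq_integral => t _.
  rewrite -[RHS]ge0_integralZl; side.
  by apply: eq_integral => s _; rewrite muleCA.
have a_ge0 : (0 <= `|a|)%R := normr_ge0 a.
have pairE (V : X -> \bar R) c : V (c * a)%R + V (- (c * a))%R =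
    V (c * `|a|)%R + V (- (c * `|a|))%R.
  by case: (ger0P a) => // _; rewrite mulrN opprK addeC.
rewrite (pairE (oscillation d f a)) (pairE (oscillation d f a) 2^-1%R).
have Jfin c b : (0 <= c)%R ->
    {r | \int[mu]_s ((tent c s)%:E * k (b + s)%R) = r%:E}.
  move=> c0; exists (fine (\int[mu]_s ((tent c s)%:E * k (b + s)%R))).
  have mtc := measurable_tent c; have tc := tent_ge0 c.
  rewrite fineK// ge0_fin_numE; side.
  apply: (@le_lt_trans _ _ ((c ^+ 2)%:E * M%:E)); last by rewrite -EFinM ltry.
  by apply: (integral_tent_le c c0); side; move=> s; exact: kM.
have Wfin b : {r | \int[mu]_m ((weight m)%:E * k (b - m * a)%R) = r%:E}.
  exists (fine (\int[mu]_m ((weight m)%:E * k (b - m * a)%R))).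
  have mw := measurable_weight; have w0 := weight_ge0.
  have mt2 := measurable_tent (2 : R)%R; have t2 := tent_ge0 (2 : R)%R.
  rewrite fineK// ge0_fin_numE; side.
  apply: (@le_lt_trans _ _ (((2 : R) ^+ 2)%:E * M%:E)); last by rewrite -EFinM ltry.
  apply: (@le_trans _ _ (\int[mu]_m ((tent 2 m)%:E * k (b - m * a)%R))); last first.
    by apply: (integral_tent_le 2%R (ler0n _ 2)); side; move=> s; exact: kM.
  apply: ge0_le_integral; side; move=> m _.
  apply: lee_wpmul2r => //; rewrite lee_fin /weight.
  by have := tent_ge0 2^-1 m; lra.
have c2 : (0 <= 2 * `|a|)%R by rewrite mulr_ge0.
have ch : (0 <= 2^-1 * `|a|)%R by rewrite mulr_ge0.
have WE b := weight_average k a b mk k0 a0.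
have := WE 0%R; have := WE d; have := WE (- d)%R.
have := tent_average_swap k _ d mk k0 c2 d0.
have := tent_average_swap k _ d mk k0 ch d0.
have add0 c : \int[mu]_s ((tent c s)%:E * k s) = \int[mu]_s ((tent c s)%:E * k (0 + s)%R).
  by apply: eq_integral => s _; rewrite add0r.
rewrite !add0.
have VE b := smooth_corrD_oscillation f mf f0 f1 d d0 a b.
have Sfin := smooth_corr_fin_num f mf f0 f1 d d0 0%R 0%R fin.
move: VE Sfin; move: (smooth_corr d f 0%R 0%R) => S00 VE /fineK S00E.
have {VE} VE b : \int[mu]_s ((tent d s)%:E * k (b + s)%R) + oscillation d f a b = S00.
  by rewrite -SE.
have V0 b := oscillation_ge0 f d a b.
clear pairE SE WE add0 mt t0 mg g0.
move: c2 ch; move: (2 * `|a|)%R (2^-1 * `|a|)%R => c2 ch hc2 hch.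
have := VE 0%R; have := VE c2; have := VE (- c2)%R; have := VE ch; have := VE (- ch)%R.
have [jd0 ->] := Jfin d 0%R d0.
have [jdc2 ->] := Jfin d c2 d0.
have [jdc2' ->] := Jfin d (- c2)%R d0.
have [jdch ->] := Jfin d ch d0.
have [jdch' ->] := Jfin d (- ch)%R d0.
have [j2 ->] := Jfin c2 0%R hc2.
have [j2d ->] := Jfin c2 d hc2.
have [j2d' ->] := Jfin c2 (- d)%R hc2.
have [jh ->] := Jfin ch 0%R hch.
have [jhd ->] := Jfin ch d hch.
have [jhd' ->] := Jfin ch (- d)%R hch.
have [w0 ->] := Wfin 0%R.
have [wd ->] := Wfin d.
have [wd' ->] := Wfin (- d)%R.
move: (V0 0%R) (V0 c2) (V0 (- c2)%R) (V0 ch) (V0 (- ch)%R).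
move: (oscillation d f a 0%R) (oscillation d f a c2) (oscillation d f a (- c2)%R)
  (oscillation d f a ch) (oscillation d f a (- ch)%R) => v0 v2 v2' vh vh'.
rewrite -S00E; move: (fine S00) => S; clear -a0.
move: v0 v2 v2' vh vh' => [v0| |] [v2| |] [v2'| |] [vh| |] [vh'| |] // _ _ _ _ _.
move=> [Eh'] [Eh] [E2'] [E2] [E0] [Th] [T2] [Wd'] [Wd] [W0].
suff H : (a^-1 ^+ 2 * (2 * v0 + (v2 + v2')) + (wd + wd') =
    2 * w0 + a^-1 ^+ 2 * (2 * (vh + vh')))%R by exact: (congr1 EFin H).
have q : (a^-1 ^+ 2 * a ^+ 2 = 1)%R by rewrite -exprMn mulVf// expr1n.
have aE w z y : (a ^+ 2 * w + 2 * z = y -> w = a^-1 ^+ 2 * (y - 2 * z))%R.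
  by move=> <-; rewrite addrK mulrA q mul1r.
move/aE: W0 => ->; move/aE: Wd => ->; move/aE: Wd' => ->.
have {aE} H : (2 * v0 + (v2 + v2') + ((j2d - 2 * jhd) + (j2d' - 2 * jhd')) =
    2 * (j2 - 2 * jh) + 2 * (vh + vh'))%R by lra.
transitivity (a^-1 ^+ 2 * (2 * v0 + (v2 + v2') + ((j2d - 2 * jhd) + (j2d' - 2 * jhd'))))%R.
  by ring.
by rewrite H; ring.
Qed.

End fixed_function.
End chart.

(** * The energy inequality in one chart *)

(** The oscillation along the line spanned by [(p, q)]. *)
HB.lock Definition energy {R : realType} (d : R)
    (f : measurableTypeR R -> measurableTypeR R -> R) (p q : R) : \bar R :=
  \int[lebesgue_measure]_a
    ((a^-1 ^+ 2)%R%:E * oscillation d f (p * a)%R (q * a)%R).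

Section energy.
Context {R : realType}.
Notation mu := (@lebesgue_measure R).
Notation X := (measurableTypeR R).

Lemma ae_neq0 : {ae mu, forall a : X, a != 0%R}.
Proof.
exists [set 0%R]; split => //; first exact: lebesgue_measure_set1.
by move=> x /= /negP; rewrite negbK => /eqP.
Qed.

Lemma ae_shift (P : X -> Prop) (b : X) : {ae mu, forall x, P x} ->
  {ae mu, forall x, P (x + b)%R}.
Proof.
move=> [N [mN N0 PN]]; exists ((fun x : X => (x + b)%R : X) @^-1` N); split.
- by rewrite -[X in measurable X]setTI; apply: measurable_shift.
- by have := lebesgue_measure_shift b N mN; rewrite /pushforward => ->.
- by move=> x /= nP; apply: PN.
Qed.

Section fixed_function.
Variable f : X -> X -> R.
Hypothesis mf : measurable_fun setT (fun p : X * X => f p.1 p.2).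
Hypothesis f0 : forall x y, (0 <= f x y)%R.
Hypothesis f1 : forall x y, (f x y <= 1)%R.
Hypothesis fin : mass f < +oo.

Let ms := measurable_slice f mf f0.
Let s0 := slice_ge0 f f0.
Let mc := measurable_slice_corr f mf f0.
Let c0 := slice_corr_ge0 f f0.

Lemma ae_slice_fin m : {ae mu, forall u, slice f m u \is a fin_num}.
Proof.
have : mu.-integrable setT (slice f m).
  apply/integrableP; split; first by meas.
  under eq_integral => u _ do rewrite gee0_abs//.
  by rewrite integral_slice.
by move=> /(integrable_ae measurableT); apply: filterS => u /(_ I).
Qed.

Lemma slice_corr_fine m b :
  slice_corr f m b = \int[mu]_u (fine (slice f m u) * fine (slice f m (u + b)%R))%:E.
Proof.
have g0 u : (0 <= fine (slice f m u))%R by apply: fine_ge0.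
rewrite slice_corr.unlock; apply: ge0_ae_eq_integral; side.
have h1 := ae_slice_fin m; have h2 := ae_shift _ b (ae_slice_fin m).
by apply: filterS2 h1 h2 => u h1 h2 _; rewrite EFinM !fineK.
Qed.

(** Expanding the product of the increments at [u] and [u + b], which is at most
    the mean of their squares. *)
Lemma slice_corr_increment m b d :
  2%:E * slice_corr f m b <=
  slice_corr f m (d + b)%R + slice_corr f m (- d + b)%R + slice_increment f d m.
Proof.
rewrite !slice_corr_fine slice_increment.unlock.
have [g gE] : {g : X -> X | g = fun u => fine (slice f m u)} by eexists.
have mg : measurable_fun setT g by rewrite gE; meas.
have g0 u : (0 <= g u)%R by rewrite gE; apply: fine_ge0.
have half0 : (0 <= 2^-1 :> R)%R by rewrite invr_ge0.
have E1 b' : \int[mu]_u (fine (slice f m u) * fine (slice f m (u + b')%R))%:E =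
    \int[mu]_u (g u * g (u + b')%R)%:E by rewrite gE.
have -> : \int[mu]_u ((fine (slice f m (u + d)%R) - fine (slice f m u)) ^+ 2)%:E =
    \int[mu]_u ((g (u + d)%R - g u) ^+ 2)%:E by rewrite gE.
rewrite !E1.
have E2 : 2%:E * \int[mu]_u (g u * g (u + b)%R)%:E =
    \int[mu]_u (g (u + d) * g (u + d + b) + g u * g (u + b))%:E.
  under [RHS]eq_integral => u _ do rewrite EFinD.
  rewrite [RHS]ge0_integralD; side.
  rewrite (integral_shift (fun u => (g u * g (u + b))%:E) _ _ d); side.
  by rewrite -mule2n mule_natl.
have E3 : \int[mu]_u ((g (u + d)%R - g u) ^+ 2)%:E =
    \int[mu]_u (2^-1 * (g (u + d) - g u) ^+ 2 + 2^-1 * (g (u + b + d) - g (u + b)) ^+ 2)%:E.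
  under [RHS]eq_integral => u _ do rewrite EFinD (EFinM 2^-1%R) (EFinM 2^-1%R).
  rewrite [RHS]ge0_integralD; side.
  rewrite (integral_shift (fun u => 2^-1%:E * ((g (u + d) - g u) ^+ 2)%:E) _ _ b); side.
  rewrite ge0_integralZl; side.
  rewrite -ge0_muleDl; side.
  by rewrite -EFinD (_ : 2^-1 + 2^-1 = 1)%R ?mul1e//; field.
have E4 : \int[mu]_u (g u * g (u + (- d + b)))%:E = \int[mu]_u (g (u + d) * g (u + b))%:E.
  rewrite -(integral_shift (fun u => (g u * g (u + (- d + b)))%:E) _ _ d); side.
  by apply: eq_integral => u _; congr (_ * g _)%:E; ring.
rewrite E2 E3 E4.
rewrite -ge0_integralD; side.
rewrite -ge0_integralD; side.
apply: ge0_le_integral; side; move=> u _.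
rewrite -!EFinD lee_fin.
have -> : (u + (d + b) = u + d + b)%R by ring.
have -> : (u + b + d = u + d + b)%R by ring.
set p := g (u + d)%R; set q := g u; set r := g (u + d + b)%R; set t := g (u + b)%R.
by have := sqr_ge0 ((p - q) - (r - t))%R; nra.
Qed.

(** The inequality between a product and the mean of the squares. *)
Lemma slice_corr_le0 m b : slice_corr f m b <= slice_corr f m 0%R.
Proof.
rewrite !slice_corr_fine.
have [g gE] : {g : X -> X | g = fun u => fine (slice f m u)} by eexists.
have mg : measurable_fun setT g by rewrite gE; meas.
have g0 u : (0 <= g u)%R by rewrite gE; apply: fine_ge0.
have half0 : (0 <= 2^-1 :> R)%R by rewrite invr_ge0.
have E1 b' : \int[mu]_u (fine (slice f m u) * fine (slice f m (u + b')%R))%:E =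
    \int[mu]_u (g u * g (u + b')%R)%:E by rewrite gE.
rewrite !E1.
have -> : \int[mu]_u (g u * g (u + 0))%:E = \int[mu]_u (2^-1 * g u ^+ 2 + 2^-1 * g (u + b) ^+ 2)%:E.
  under [RHS]eq_integral => u _ do rewrite EFinD.
  rewrite [RHS]ge0_integralD; side.
  rewrite (integral_shift (fun u => (2^-1 * g u ^+ 2)%:E) _ _ b); side.
  rewrite -ge0_integralD; side.
  by apply: eq_integral => u _; rewrite addr0 -EFinD; congr (_%:E); field.
apply: ge0_le_integral; side; move=> u _; rewrite lee_fin.
by have := sqr_ge0 (g u - g (u + b))%R; nra.
Qed.

End fixed_function.
End energy.

(** The three terms of [slice_corr_increment] under the weighted integral over
    slopes, with [e] standing for the total weight of the tent. *)
Lemma weighted_bound {R : realType} (w e : R) (s s1 s2 q : \bar R) :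
    (0 <= w)%R -> (0 <= e)%R -> 0 <= s1 -> 0 <= s2 -> 0 <= q ->
    2%:E * s <= s1 + s2 + e%:E * q ->
  2%:E * (w%:E * s) <= e%:E * (w%:E * q) + (w%:E * s1 + w%:E * s2).
Proof.
move=> w0 e0 s10 s20 q0 H.
have eq0 : 0 <= e%:E * q by rewrite mule_ge0// lee_fin.
rewrite muleCA (muleCA e%:E) -(ge0_muleDr _ s10 s20) -ge0_muleDr ?adde_ge0//.
by apply: lee_wpmul2l; rewrite ?lee_fin// addeC.
Qed.

Section chart_inequality.
Context {R : realType}.
Notation mu := (@lebesgue_measure R).
Notation X := (measurableTypeR R).
Variable f : X -> X -> R.
Hypothesis mf : measurable_fun setT (fun p : X * X => f p.1 p.2).
Hypothesis f0 : forall x y, (0 <= f x y)%R.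
Hypothesis f1 : forall x y, (f x y <= 1)%R.
Hypothesis fin : mass f < +oo.
Variable d : R.
Hypothesis d0 : (0 <= d)%R.

Let mc := measurable_slice_corr f mf f0.
Let c0 := slice_corr_ge0 f f0.
Let mv := measurable_oscillation f mf f0 d.
Let v0 := oscillation_ge0 f d.
Let mw := @measurable_weight R.
Let w0 := @weight_ge0 R.
Let mt := measurable_tent d.
Let t0 := tent_ge0 d.
Let mg := measurable_autocorr f mf f0.
Let g0 := autocorr_ge0 f f0.

Lemma measurable_slice_increment :
  measurable_fun setT (fun p : X * X => slice_increment f p.1 p.2).
Proof.
have ms := measurable_slice f mf f0.
by rewrite slice_increment.unlock; meas.
Qed.

Lemma slice_increment_ge0 e m : 0 <= slice_increment f e m.
Proof. by rewrite slice_increment.unlock; nonneg. Qed.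

Lemma energy_ge0 p q : 0 <= energy d f p q.
Proof. by rewrite energy.unlock; nonneg. Qed.

(** The displacement [s] of the first coordinate shifts the offset of a line of slope
    [- m] by [m * s]. *)
Definition smoothed_slice_corr (b m : X) : \bar R :=
  \int[mu]_s ((tent d s)%:E * slice_corr f m (b + m * s)%R).

Let smoothed_ge0 b m : 0 <= smoothed_slice_corr b m.
Proof. by rewrite /smoothed_slice_corr; nonneg. Qed.

Let measurable_smoothed :
  measurable_fun setT (fun p : X * X => smoothed_slice_corr p.1 p.2).
Proof. by rewrite /smoothed_slice_corr; meas. Qed.

Lemma smoothed_slice_corr_le b m :
  smoothed_slice_corr b m <= (d ^+ 2)%:E * slice_corr f m 0%R.
Proof.
apply: (integral_tent_le d d0); side; move=> s.
exact: slice_corr_le0.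
Qed.

Lemma smoothed_slice_corr_increment m :
  2%:E * smoothed_slice_corr 0%R m <= smoothed_slice_corr d m +
    smoothed_slice_corr (- d)%R m + (d ^+ 2)%:E * slice_increment f d m.
Proof.
have mq := measurable_slice_increment; have q0 := slice_increment_ge0.
rewrite /smoothed_slice_corr -(integral_tent d d0).
rewrite -ge0_integralZl; side.
rewrite -ge0_integralZr; side.
rewrite -ge0_integralD; side.
rewrite -ge0_integralD; side.
apply: ge0_le_integral; side; move=> s _.
rewrite -ge0_muleDr; side.
rewrite -ge0_muleDr; side.
rewrite muleCA; apply: lee_wpmul2l; first by rewrite lee_fin.
rewrite add0r; exact: slice_corr_increment.
Qed.

Lemma integral_autocorr_slices b :
  \int[mu]_a \int[mu]_m ((weight m)%:E * \int[mu]_s ((tent d s)%:E *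
        autocorr f (a + s)%R (b - m * a)%R)) =
  \int[mu]_m ((weight m)%:E * smoothed_slice_corr b m).
Proof.
rewrite tonelli; side; apply: eq_integral => m _.
rewrite ge0_integralZl; side; apply: eq_mule => //.
rewrite tonelli; side; apply: eq_integral => s _.
rewrite ge0_integralZl; side; apply: eq_mule => //.
rewrite slice_corrE//.
rewrite -[RHS](integral_shift _ _ _ s); side.
by apply: eq_integral => a _; congr (autocorr f _ _); ring.
Qed.

(** [chart_identity] integrated over [a]. *)
Lemma chart_energy :
  2%:E * energy d f 1 0 + (energy d f 1 2 + energy d f 1 (- 2)) +
    (\int[mu]_m ((weight m)%:E * smoothed_slice_corr d m) +
     \int[mu]_m ((weight m)%:E * smoothed_slice_corr (- d)%R m)) =
  2%:E * \int[mu]_m ((weight m)%:E * smoothed_slice_corr 0%R m) +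
    2%:E * (energy d f 1 2^-1 + energy d f 1 (- 2^-1)).
Proof.
rewrite -!integral_autocorr_slices.
have EE q : energy d f 1 q = \int[mu]_a ((a^-1 ^+ 2)%:E * oscillation d f a (q * a)%R).
  by rewrite energy.unlock; apply: eq_integral => a _; rewrite mul1r.
rewrite !EE.
rewrite -ge0_integralZl; side.
rewrite -ge0_integralD; side.
rewrite -ge0_integralD; side.
rewrite -ge0_integralD; side.
rewrite -ge0_integralD; side.
rewrite -ge0_integralD; side.
rewrite -ge0_integralZl; side.
rewrite -ge0_integralZl; side.
rewrite -ge0_integralD; side.
apply: ge0_ae_eq_integral; side.
apply: filterS (@ae_neq0 R) => a a0 _.
have := chart_identity f mf f0 f1 d a d0 fin a0.
have q0 : 0 <= (a^-1 ^+ 2)%:E :> \bar R by rewrite lee_fin sqr_ge0.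
rewrite mul0r !mulNr.
move: (v0 a 0%R) (v0 a (2 * a)%R) (v0 a (- (2 * a))%R) (v0 a (2^-1 * a)%R)
  (v0 a (- (2^-1 * a))%R).
move: (oscillation d f a 0%R) (oscillation d f a (2 * a)%R)
  (oscillation d f a (- (2 * a))%R) (oscillation d f a (2^-1 * a)%R)
  (oscillation d f a (- (2^-1 * a))%R) => u u2 u2' uh uh' h h2 h2' hh hh'.
have two0 : 0 <= 2%:E :> \bar R by rewrite lee_fin.
rewrite ge0_muleDr ?adde_ge0 ?mule_ge0// (muleCA _ 2%:E) ge0_muleDr// => ->.
by rewrite (muleCA _ 2%:E) (ge0_muleDr _ hh hh').
Qed.

(** The slopes have finite total correlation, so the terms of the identity that
    only depend on the slices can be cancelled up to their increments. *)
Lemma chart_inequality :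
    \int[mu]_m ((weight m)%:E * slice_corr f m 0%R) < +oo ->
  2%:E * energy d f 1 0 + (energy d f 1 2 + energy d f 1 (- 2)) <=
  2%:E * (energy d f 1 2^-1 + energy d f 1 (- 2^-1)) +
    (d ^+ 2)%:E * \int[mu]_m ((weight m)%:E * slice_increment f d m).
Proof.
move=> cfin.
have mq := measurable_slice_increment; have q0 := slice_increment_ge0.
have Xfin b : \int[mu]_m ((weight m)%:E * smoothed_slice_corr b m) \is a fin_num.
  rewrite ge0_fin_numE; side.
  apply: (@le_lt_trans _ _ ((d ^+ 2)%:E *
      \int[mu]_m ((weight m)%:E * slice_corr f m 0%R))).
    rewrite -ge0_integralZl; side.
    apply: ge0_le_integral; side; move=> m _; rewrite muleCA.
    by apply: lee_wpmul2l; [rewrite lee_fin|exact: smoothed_slice_corr_le].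
  by apply: lte_mul_pinfty => //; rewrite lee_fin sqr_ge0.
have Xle : 2%:E * \int[mu]_m ((weight m)%:E * smoothed_slice_corr 0%R m) <=
    (d ^+ 2)%:E * \int[mu]_m ((weight m)%:E * slice_increment f d m) +
    (\int[mu]_m ((weight m)%:E * smoothed_slice_corr d m) +
     \int[mu]_m ((weight m)%:E * smoothed_slice_corr (- d)%R m)).
  rewrite -ge0_integralZl; side.
  rewrite -ge0_integralZl; side.
  rewrite -ge0_integralD; side.
  rewrite -ge0_integralD; side.
  apply: ge0_le_integral; side; move=> m _.
  apply: weighted_bound => //; first exact: sqr_ge0.
  exact: smoothed_slice_corr_increment.
rewrite -(@leeD2rE _ (\int[mu]_m ((weight m)%:E * smoothed_slice_corr d m) +
    \int[mu]_m ((weight m)%:E * smoothed_slice_corr (- d)%R m))); last first.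
  by rewrite fin_numD; apply/andP; split; exact: Xfin.
rewrite chart_energy [X in X <= _]addeC -[X in _ <= X]addeA.
by apply: leeD2l; exact: Xle.
Qed.

End chart_inequality.

(** * Finiteness and homogeneity of the energies *)

Section energy_finite.
Context {R : realType}.
Notation mu := (@lebesgue_measure R).
Notation X := (measurableTypeR R).

Lemma integral_oneDsqr_lty : \int[mu]_x ((1 + x ^+ 2)^-1)%:E < +oo :> \bar R.
Proof.
have [h hE] : {h : X -> \bar R | h = ((fun x => ((1 + x ^+ 2)^-1)%:E) \_ `[0%R, +oo[)}.
  by eexists.
have m1 : measurable_fun setT (fun x : X => ((1 + x ^+ 2)^-1)%:E : \bar R) by meas.
have p1 (x : R) : (0 <= (1 + x ^+ 2)^-1)%R by rewrite invr_ge0 addr_ge0// sqr_ge0.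
have mh : measurable_fun setT (fun x : X => h x).
  by rewrite hE; apply/(measurable_restrictT _ _).1 => //; exact: measurable_funTS.
have h0 x : 0 <= h x by rewrite hE /patch; case: ifP => // _; rewrite lee_fin.
have hfin : \int[mu]_x h x < +oo.
  rewrite hE -integral_mkcond.
  by have := @integral0y_oneDsqr R; rewrite /oneDsqr => ->; rewrite ltry.
apply: (@le_lt_trans _ _ (\int[mu]_x (h x + h (- x)%R))).
  have mh' : measurable_fun setT (fun x : X => h (- x)%R) by meas.
  apply: ge0_le_integral; side.
  move=> x _; have [x0|x0] := leP 0%R x.
    have -> : h x = ((1 + x ^+ 2)^-1)%:E by rewrite hE /patch mem_setE in_itv/= x0.
    exact: leeDl.
  have -> : h (- x)%R = ((1 + x ^+ 2)^-1)%:E.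
    by rewrite hE /patch mem_setE in_itv/= oppr_ge0 (ltW x0) sqrrN.
  exact: leeDr.
rewrite ge0_integralD; side.
by rewrite integral_opp// lte_add_pinfty.
Qed.

Section fixed_function.
Variable f : X -> X -> R.
Hypothesis mf : measurable_fun setT (fun p : X * X => f p.1 p.2).
Hypothesis f0 : forall x y, (0 <= f x y)%R.
Hypothesis f1 : forall x y, (f x y <= 1)%R.
Hypothesis fin : mass f < +oo.
Variable d : R.
Hypothesis d0 : (0 <= d)%R.

Let mv := measurable_oscillation f mf f0 d.
Let v0 := oscillation_ge0 f d.

Lemma oscillation_second_axis b :
  oscillation d f 0%R b <= (2 * (b ^+ 2 * d ^+ 2))%:E * mass f.
Proof.
rewrite -oscillation_swap// -mass_swap//.
apply: oscillation_first_axis => //; first exact: meas_swap.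
by rewrite mass_swap.
Qed.

Lemma oscillation_le_smooth a b : oscillation d f a b <= smooth_corr d f 0%R 0%R.
Proof.
rewrite -(smooth_corrD_oscillation f mf f0 f1 d d0 a b).
by apply: leeDr; exact: smooth_corr_ge0.
Qed.

(** The oscillation is bounded, and of order [a ^+ 2] near [0] by [oscillation_le_axes]
    and the bounds on the axes, so the integrand is dominated by a multiple of
    [1 / (1 + a ^+ 2)]. *)
Lemma energy_lty p q : energy d f p q < +oo.
Proof.
have fM : mass f = (fine (mass f))%:E.
  by rewrite fineK// ge0_fin_numE// mass_ge0.
have fS : smooth_corr d f 0%R 0%R = (fine (smooth_corr d f 0%R 0%R))%:E.
  by rewrite fineK// smooth_corr_fin_num.
have C0 : (0 <= fine (mass f))%R by rewrite fine_ge0// mass_ge0.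
have S0 : (0 <= fine (smooth_corr d f 0%R 0%R))%R by rewrite fine_ge0// smooth_corr_ge0.
move: fM fS C0 S0; move: (fine (mass f)) (fine (smooth_corr d f 0%R 0%R)) => M S fM fS M0 S0.
pose K : R := (2 * S + 8 * (p ^+ 2 + q ^+ 2) * d ^+ 2 * M)%R.
rewrite energy.unlock.
have p1 (x : R) : (0 < 1 + x ^+ 2)%R by rewrite ltr_pwDl// sqr_ge0.
have K0 : (0 <= K)%R.
  by rewrite addr_ge0 ?mulr_ge0// ?addr_ge0// ?sqr_ge0.
have i0 (x : R) : (0 <= (1 + x ^+ 2)^-1)%R by rewrite invr_ge0 ltW.
apply: (@le_lt_trans _ _ (\int[mu]_a (K%:E * ((1 + a ^+ 2)^-1)%:E))); last first.
  rewrite ge0_integralZl; side.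
  by apply: lte_mul_pinfty => //; exact: integral_oneDsqr_lty.
apply: ge0_le_integral; side; move=> a _.
have V1 : oscillation d f (p * a)%R (q * a)%R <= S%:E.
  by rewrite -fS; exact: oscillation_le_smooth.
have V2 : oscillation d f (p * a)%R (q * a)%R <=
    (4 * ((p ^+ 2 + q ^+ 2) * a ^+ 2) * d ^+ 2 * M)%:E.
  apply: le_trans (oscillation_le_axes f mf f0 f1 d d0 _ _) _.
  have h1 := oscillation_first_axis f mf f0 f1 d d0 (p * a)%R fin.
  have h2 := oscillation_second_axis (q * a)%R.
  have two0 : 0 <= 2%:E :> \bar R by rewrite lee_fin.
  apply: le_trans (leeD (lee_wpmul2l two0 h1) (lee_wpmul2l two0 h2)) _.
  by rewrite fM -!EFinM -EFinD lee_fin le_eqVlt; apply/orP; left; apply/eqP; ring.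
have := v0 (p * a)%R (q * a)%R.
move: (oscillation d f (p * a)%R (q * a)%R) V1 V2 => [v| |]// V1 V2 v_ge0.
rewrite -!EFinM !lee_fin in V1 V2 v_ge0 *.
rewrite -ler_pdivrMr ?invr_gt0// invrK.
have [->|an0] := eqVneq a 0%R.
  by rewrite invr0 expr0n/= !mul0r.
have a2 : (0 < a ^+ 2)%R by rewrite exprn_even_gt0.
rewrite exprVn [(_^-1 * v)%R]mulrC mulrAC ler_pdivrMr// /K.
by have := sqr_ge0 p; have := sqr_ge0 q; have := sqr_ge0 d; nra.
Qed.

Lemma energy_scale c p q : c != 0%R ->
  energy d f (c * p) (c * q) = `|c|%:E * energy d f p q.
Proof.
move=> cn0; have c_gt0 : (0 < `|c|)%R by rewrite normr_gt0.
rewrite energy.unlock.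
have [h hE] : {h : X -> \bar R | h = fun a =>
   (a^-1 ^+ 2)%R%:E * oscillation d f (p * a)%R (q * a)%R} by eexists.
have mh : measurable_fun setT h by rewrite hE; meas.
have h0 x : 0 <= h x by rewrite hE; nonneg.
have -> : \int[mu]_a ((a^-1 ^+ 2)%R%:E * oscillation d f (p * a)%R (q * a)%R) =
  \int[mu]_a h a by rewrite hE.
transitivity (\int[mu]_a ((c ^+ 2)%:E * h (c * a)%R)).
  apply: eq_integral => a _; rewrite hE muleA -EFinM.
  have -> : (c ^+ 2 * (c * a)^-1 ^+ 2 = a^-1 ^+ 2)%R.
    by rewrite -exprMn invfM mulrA mulfV// mul1r.
  by congr (_ * oscillation d f _ _); ring.
have mh' : measurable_fun setT (fun a : X => h (c * a)%R) by meas.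
rewrite ge0_integralZl; side.
rewrite integral_scale// muleA -EFinM -real_normK ?num_real// expr2 mulfK//.
by rewrite gt_eqF.
Qed.

Lemma energy_swap p q : energy d (fun x y => f y x) p q = energy d f q p.
Proof.
by rewrite energy.unlock; apply: eq_integral => a _; rewrite oscillation_swap.
Qed.

End fixed_function.
End energy_finite.

(** * Adding the two charts *)

Section two_charts.
Context {R : realType}.
Notation mu := (@lebesgue_measure R).
Notation X := (measurableTypeR R).
Variable f : X -> X -> R.
Hypothesis mf : measurable_fun setT (fun p : X * X => f p.1 p.2).
Hypothesis f0 : forall x y, (0 <= f x y)%R.
Hypothesis f1 : forall x y, (f x y <= 1)%R.
Hypothesis fin : mass f < +oo.
Let f' x y := f y x.
Hypothesis corr_fin : \int[mu]_m ((weight m)%:E * slice_corr f m 0%R) < +oo.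
Hypothesis corr_fin' : \int[mu]_m ((weight m)%:E * slice_corr f' m 0%R) < +oo.

(** Exchanging the axes maps the directions [(1, 2)] and [(1, -2)] to [(2, 1)] and
    [(-2, 1)], and [(2, 1)] has twice the energy of [(1, 1 / 2)]. In the sum of the two
    inequalities of [chart_inequality] all energies of oblique directions
    cancel, because they are finite. *)
Lemma energy_two_charts d : (0 < d)%R ->
  energy d f 1 0 <= (d ^+ 2)%:E *
    (\int[mu]_m ((weight m)%:E * slice_increment f d m) +
     \int[mu]_m ((weight m)%:E * slice_increment f' d m)).
Proof.
move=> d_gt0; have d0 := ltW d_gt0.
have mf' : measurable_fun setT (fun p : X * X => f' p.1 p.2) by exact: meas_swap.
have fin' : mass f' < +oo by rewrite mass_swap.
have I1 := chart_inequality f mf f0 f1 fin d d0 corr_fin.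
have I2 := chart_inequality f' mf' (fun x y => f0 y x) (fun x y => f1 y x) fin' d d0 corr_fin'.
have mw := @measurable_weight R; have w0 := @weight_ge0 R.
have mq := measurable_slice_increment f mf f0; have q0 := slice_increment_ge0 f.
have mq' := measurable_slice_increment f' mf' (fun x y => f0 y x).
have q0' := slice_increment_ge0 f'.
have P0 : 0 <= \int[mu]_m ((weight m)%:E * slice_increment f d m) by nonneg.
have P0' : 0 <= \int[mu]_m ((weight m)%:E * slice_increment f' d m) by nonneg.
move: I1 I2 P0 P0'.
move: (\int[mu]_m _) (\int[mu]_m _) => P P' I1 I2 P0 P0'.
have sw p q : energy d f' p q = energy d f q p by exact: energy_swap.
rewrite !sw in I2.
have n2 : (2 != 0 :> R)%R by [].
have n2' : (- 2 != 0 :> R)%R by rewrite oppr_eq0.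
have sc := energy_scale f mf f0 d.
have e12 : energy d f 1 2 = 2%:E * energy d f 2^-1 1.
  have := sc 2%R 2^-1%R 1%R n2.
  by rewrite mulr1 mulfV// ger0_norm.
have e12' : energy d f 1 (- 2) = 2%:E * energy d f (- 2^-1) 1.
  have := sc (- 2)%R (- 2^-1)%R 1%R n2'.
  by rewrite mulr1 mulrNN mulfV// normrN ger0_norm.
have e21 : energy d f 2 1 = 2%:E * energy d f 1 2^-1.
  have := sc 2%R 1%R 2^-1%R n2.
  by rewrite mulr1 mulfV// ger0_norm.
have e21' : energy d f (- 2) 1 = 2%:E * energy d f 1 (- 2^-1).
  have := sc (- 2)%R 1%R (- 2^-1)%R n2'.
  by rewrite mulr1 mulrNN mulfV// normrN ger0_norm.
rewrite e12 e12' in I1; rewrite e21 e21' in I2.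
have E0 p q := energy_ge0 f d p q.
have Efin p q := energy_lty f mf f0 f1 fin d d0 p q.
have EE p q : energy d f p q = (fine (energy d f p q))%:E.
  by rewrite fineK// ge0_fin_numE.
have F0 p q : (0 <= fine (energy d f p q))%R by rewrite fine_ge0.
have d20 : (0 < d ^+ 2)%R by rewrite exprn_gt0.
have F01 := F0 0%R 1%R; have F10 := F0 1%R 0%R.
move: I1 I2; rewrite (EE 1%R 0%R) (EE 0%R 1%R) (EE 2^-1%R 1%R) (EE (- 2^-1)%R 1%R)
  (EE 1%R 2^-1%R) (EE 1%R (- 2^-1)%R).
move: F01 F10.
move: (fine (energy d f 0 1)) (fine (energy d f 1 0)) (fine (energy d f 2^-1 1))
  (fine (energy d f (- 2^-1) 1)) (fine (energy d f 1 2^-1)) (fine (energy d f 1 (- 2^-1))).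
move=> e01 e10 ea eb ec ed e01_ge0 e10_ge0.
have infE : (d ^+ 2)%:E * +oo = +oo :> \bar R by rewrite gt0_muley// lte_fin.
move: P0 P0'; case: P => [P| |]; case: P' => [P'| |] // P0 P0' I1 I2;
  rewrite ?addye ?addey ?infE ?leey//.
have {}I1 : (2 * e10 + (2 * ea + 2 * eb) <= 2 * (ec + ed) + d ^+ 2 * P')%R.
  by rewrite -lee_fin; exact: I1.
have {}I2 : (2 * e01 + (2 * ec + 2 * ed) <= 2 * (ea + eb) + d ^+ 2 * P)%R.
  by rewrite -lee_fin; exact: I2.
suff : (e10 <= d ^+ 2 * (P' + P))%R by rewrite -lee_fin.
by lra.
Qed.

End two_charts.

(** * Autocorrelation of a set *)

Section autocorrelation.
Context {R : realType}.
Notation mu := (@lebesgue_measure R).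
Notation X := (measurableTypeR R).
Variable f : X -> X -> R.
Hypothesis mf : measurable_fun setT (fun p : X * X => f p.1 p.2).
Hypothesis f01 : forall x y, f x y = 0%R \/ f x y = 1%R.

Let f0 x y : (0 <= f x y)%R. Proof. by case: (f01 x y) => ->. Qed.
Let f1 x y : (f x y <= 1)%R. Proof. by case: (f01 x y) => ->. Qed.

Lemma autocorr0 : autocorr f 0%R 0%R = mass f.
Proof.
rewrite autocorr.unlock mass.unlock.
apply: eq_integral => x _; apply: eq_integral => y _; rewrite !addr0.
by case: (f01 x y) => ->; rewrite ?mulr0 ?mulr1.
Qed.

(** If [f] is the indicator of [A], then [mass f - autocorr f a b] is the measure of the
    points of [A] that leave [A] when translated by [(a, b)]. A point that leaves
    [A] under the sum of two translations leaves it under the first one, or its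
    translate by the first one leaves it under the second one. *)
Lemma autocorr_subadditive a b a' b' :
  autocorr f a b + autocorr f a' b' <= mass f + autocorr f (a + a')%R (b + b')%R.
Proof.
have -> : mass f = \int[mu]_x \int[mu]_y (f (x + a)%R (y + b)%R)%:E.
  by rewrite (integral_shift2 (fun x y => (f x y)%:E)) ?mass.unlock//; side.
have -> : autocorr f a' b' = \int[mu]_x \int[mu]_y
    (f (x + a) (y + b) * f (x + a + a') (y + b + b'))%:E.
  by rewrite (integral_shift2 (fun x y => (f x y * f (x + a') (y + b'))%:E)) ?autocorr.unlock//; side.
rewrite autocorr.unlock.
rewrite -ge0_integralD; side.
rewrite -ge0_integralD; side.
apply: ge0_le_integral; side; move=> x _.
rewrite -ge0_integralD; side.
rewrite -ge0_integralD; side.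
apply: ge0_le_integral; side; move=> y _.
rewrite -!EFinD lee_fin !addrA.
by case: (f01 x y) => ->; case: (f01 (x + a)%R (y + b)%R) => ->;
  case: (f01 (x + a + a')%R (y + b + b')%R) => ->; lra.
Qed.

End autocorrelation.

(** * Continuity of translations *)

Section translations.
Context {R : realType}.
Notation mu := (@lebesgue_measure R).
Notation X := (measurableTypeR R).

Let one (A : set X) (x : X) : R := \1_A x.

Let one_ge0 A x : (0 <= one A x)%R. Proof. by rewrite /one indicE. Qed.

Let measurable_one A : measurable A -> measurable_fun setT (one A : X -> X).
Proof. by move=> mA; exact: measurable_indic. Qed.

Let integral_one A : measurable A -> \int[mu]_x (one A x)%:E = mu A.
Proof. by move=> mA; rewrite integral_indic// setIT. Qed.

(** A point of an open set stays in it under small translations. *)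
Lemma cvg_open_translate (U : set X) (s : nat -> R) : open (U : set R) ->
    mu U < +oo -> s @ \oo --> 0%R ->
  \int[mu]_x (one U x * one U (x + s n)%R)%:E @[n --> \oo] --> mu U.
Proof.
move=> oU Ufin s0.
have mU : measurable U by exact: open_measurable.
have m1 := measurable_one U mU.
have i1 : mu.-integrable setT (fun x => (one U x)%:E).
  apply/integrableP; split; first by meas.
  under eq_integral => x _ do rewrite gee0_abs ?lee_fin//.
  by rewrite integral_one.
have [] := @dominated_convergence _ X R mu setT measurableT
  (fun n x => (one U x * one U (x + s n)%R)%:E) (fun x => (one U x)%:E)
  (fun x => (one U x)%:E).
- by move=> n; meas.
- by meas.
- apply: aeW => x _; apply: cvg_near_cst.
  have [Ux|nUx] := pselect (U x); last first.
    by apply: nearW => n; rewrite /one indicE memNset// mul0r.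
  have : \forall y \near x, U y by exact: open_nbhs_nbhs.
  have xs : (x + s n)%R @[n --> \oo] --> (x : R).
    by rewrite -[X in _ --> X]addr0; apply: cvgD => //; exact: cvg_cst.
  move=> /xs H; have {H} : \forall n \near \oo, U (x + s n)%R by exact: H.
  apply: filterS => n Uxs.
  by rewrite /one !indicE !mem_set// mulr1.
- exact: i1.
- apply: aeW => x n _; rewrite gee0_abs ?lee_fin ?mulr_ge0//.
  by rewrite -[leRHS]mulr1 ler_wpM2l// /one indicE lern1 leq_b1.
by move=> _ _; rewrite integral_one.
Qed.

(** An open set containing [A] and of nearly the same measure has nearly the same
    overlaps with its translates as [A]. *)
Lemma cvg_set_translate (A : set X) (s : nat -> R) : measurable A ->
    mu A < +oo -> s @ \oo --> 0%R ->
  \int[mu]_x (one A x * one A (x + s n)%R)%:E @[n --> \oo] --> mu A.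
Proof.
move=> mA Afin s0; have m1 := measurable_one A mA.
pose v n := \int[mu]_x (one A x * one A (x + s n)%R)%:E.
have v0 n : 0 <= v n by rewrite /v; nonneg.
have vA n : v n <= mu A.
  rewrite -integral_one// /v; apply: ge0_le_integral; side; move=> x _.
  by rewrite lee_fin -[leRHS]mulr1 ler_wpM2l// /one indicE lern1 leq_b1.
have fA : mu A \is a fin_num by rewrite ge0_fin_numE.
have fv n : v n \is a fin_num by rewrite ge0_fin_numE// (le_lt_trans (vA n)).
rewrite -(fineK fA); apply: cvg_EFin; first by apply: nearW.
apply/cvgrPdist_le => e e0.
have e4 : (0 < e / 4)%R by rewrite divr_gt0.
have [U [oU AU UA]] := lebesgue_regularity_outer mA Afin e4.
have mU : measurable (U : set X) by exact: open_measurable.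
have mUA : measurable (U `\` A : set X) by exact: measurableD.
have UE : mu U = mu A + mu (U `\` A).
  rewrite -measureU//; first by rewrite setDUK.
  by rewrite setDIK.
have Ufin : mu U < +oo.
  by rewrite UE lte_add_pinfty// (lt_le_trans UA)// leey.
have fU : mu U \is a fin_num by rewrite ge0_fin_numE.
have fUA : mu (U `\` A) \is a fin_num.
  by rewrite ge0_fin_numE// (lt_le_trans UA)// leey.
have := cvg_open_translate U s oU Ufin s0.
rewrite -(fineK fU) => /fine_cvgP[fin_u] /cvgrPdist_le /(_ _ e4).
apply: filterS2 fin_u => n fin_u Hn.
have m2 := measurable_one U mU; have m3 := measurable_one (U `\` A) mUA.
have key : \int[mu]_x (one U x * one U (x + s n)%R)%:E <=
    v n + (mu (U `\` A) + mu (U `\` A)).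
  rewrite -integral_one//.
  rewrite -{2}(integral_shift (fun x => (one (U `\` A) x)%:E) _ _ (s n)); side.
  rewrite -ge0_integralD; side.
  rewrite /v -ge0_integralD; side.
  apply: ge0_le_integral; side; move=> x _.
  have bool_le (a u b w : bool) : (a -> u) -> (b -> w) ->
      (u%:R * w%:R <= a%:R * b%:R + ((u && ~~ a)%:R + (w && ~~ b)%:R) :> R)%R.
    move: a u b w => [] [] [] [] //= h h'; try by [have := h isT|have := h' isT];
      rewrite ?mulr0 ?mulr1 ?mul0r; lra.
  have AU' y : y \in A -> y \in U by rewrite !inE; exact: AU.
  have oneD y : one (U `\` A) y = ((y \in U) && ~~ (y \in A))%:R.
    by rewrite /one indicE in_setD.
  have := bool_le _ _ _ _ (AU' x) (AU' (x + s n)%R).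
  by rewrite !oneD -lee_fin /one !indicE.
move: UE UA key Hn.
rewrite -(fineK fA) -(fineK fU) -(fineK fUA) -(fineK fin_u) -(fineK (fv n)) /=.
move=> [UE] UA' key' Hn.
have {UA'}UA : (fine (mu (U `\` A)) < e / 4)%R by rewrite -lte_fin fineK.
have {}key := key'; rewrite -!EFinD lee_fin in key.
have va : (fine (v n) <= fine (mu A))%R by rewrite fine_le.
rewrite -/(v n) ger0_norm ?subr_ge0//.
move: Hn; rewrite ler_norml => /andP[_].
move: UE UA key va; move: (fine (v n)) (fine (mu A)) (fine (mu U))
  (fine (mu (U `\` A))) (fine _) => r1 r2 r3 r4 r5 h1 h2 h3 h4 h5.
by lra.
Qed.

End translations.

(** * The energies of a set of positive measure are unbounded *)

Section set_energy.
Context {R : realType}.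
Notation mu := (@lebesgue_measure R).
Notation X := (measurableTypeR R).

Lemma autocorr_swap (f : X -> X -> R) a b :
    measurable_fun setT (fun p : X * X => f p.1 p.2) -> (forall x y, (0 <= f x y)%R) ->
  autocorr (fun x y => f y x) a b = autocorr f b a.
Proof. by move=> mf f0; rewrite autocorr.unlock tonelli; side. Qed.

Section axis.
Variable f : X -> X -> R.
Hypothesis mf : measurable_fun setT (fun p : X * X => f p.1 p.2).
Hypothesis f01 : forall x y, f x y = 0%R \/ f x y = 1%R.
Hypothesis fin : mass f < +oo.

Let f0 x y : (0 <= f x y)%R. Proof. by case: (f01 x y) => ->. Qed.
Let f1 x y : (f x y <= 1)%R. Proof. by case: (f01 x y) => ->. Qed.
Let mg := measurable_autocorr f mf f0.
Let g0 := autocorr_ge0 f f0.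
Let gM := autocorr_le_mass f mf f0 f1.
Let fM : mass f \is a fin_num. Proof. by rewrite ge0_fin_numE// mass_ge0. Qed.

(** On each horizontal line, translations are continuous; the lengths of the overlaps
    are dominated by those of the sections of the set. *)
Lemma cvg_autocorr_axis (s : nat -> R) : s @ \oo --> 0%R ->
  autocorr f (s n) 0%R @[n --> \oo] --> mass f.
Proof.
move=> s0.
have massE : mass f = \int[mu]_y \int[mu]_x (f x y)%:E.
  by rewrite mass.unlock tonelli; side.
pose h n y := \int[mu]_x (f x y * f (x + s n)%R y)%:E.
have hE n : autocorr f (s n) 0%R = \int[mu]_y h n y.
  rewrite autocorr.unlock tonelli; side.
  by apply: eq_integral => y _; apply: eq_integral => x _; rewrite addr0.
have iH : mu.-integrable setT (fun y => \int[mu]_x (f x y)%:E).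
  apply/integrableP; split; first by meas.
  have H0 y : 0 <= \int[mu]_x (f x y)%:E by nonneg.
  by under eq_integral => y _ do rewrite (gee0_abs (H0 y)); rewrite -massE.
have [] := @dominated_convergence _ X R mu setT measurableT h
  (fun y => \int[mu]_x (f x y)%:E) (fun y => \int[mu]_x (f x y)%:E).
- by move=> n; rewrite /h; meas.
- by meas.
- have := integrable_ae measurableT iH.
  apply: filterS => y /(_ I) yfin _.
  have fE x : f x y = \1_([set x | f x y = 1%R] : set X) x.
    rewrite indicE; case: (f01 x y) => E; rewrite E.
      by rewrite memNset//= E => /esym/eqP; rewrite oner_eq0.
    by rewrite mem_set.
  have mA : measurable ([set x | f x y = 1%R] : set X).
    have my : measurable_fun setT (fun x : X => f x y : X) by meas.
    rewrite (_ : [set x | _] = setT `&` (fun x : X => f x y : X) @^-1` [set 1%R]).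
      exact: my.
    by rewrite setTI.
  have AE : mu [set x | f x y = 1%R] = \int[mu]_x (f x y)%:E.
    transitivity (\int[mu]_x (\1_([set x | f x y = 1%R] : set X) x)%:E).
      by rewrite integral_indic// setIT.
    by apply: eq_integral => x _; rewrite -fE.
  rewrite -AE /h.
  rewrite [X in X @ _](_ : _ = fun n => \int[mu]_x (\1_([set x | f x y = 1%R] : set X) x *
      \1_([set x | f x y = 1%R] : set X) (x + s n)%R)%:E).
    apply: cvg_set_translate => //.
    by rewrite AE -ge0_fin_numE//; nonneg.
  by apply/funext => n; apply: eq_integral => x _; rewrite -!fE.
- exact: iH.
- apply: aeW => y n _; rewrite gee0_abs; last by rewrite /h; nonneg.
  apply: ge0_le_integral; side; move=> x _.
  by rewrite lee_fin -[leRHS]mulr1 ler_wpM2l.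
move=> _ _; rewrite -massE; apply: cvg_trans.
by apply: near_eq_cvg; apply: nearW => n; rewrite hE.
Qed.

Lemma autocorr_axis_ge e : (0 < e)%R ->
  exists2 d : R, (0 < d)%R & forall s : R, (`|s| <= d)%R ->
    mass f <= autocorr f s 0%R + e%:E.
Proof.
move=> e0; apply: contrapT => H.
have {}H n : exists s : R, (`|s| <= n.+1%:R^-1)%R /\ autocorr f s 0%R + e%:E < mass f.
  apply: contrapT => Hn; apply: H; exists n.+1%:R^-1%R => // s sn.
  by rewrite leNgt; apply/negP => lt; apply: Hn; exists s.
have [s sP] := choice H.
have s0 : s @ \oo --> 0%R.
  apply/cvgr0Pnorm_le => t t0.
  have := near_infty_natSinv_lt (PosNum t0); apply: filterS => n /= nt.
  by apply: le_trans (sP n).1 _; exact: ltW.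
have := cvg_autocorr_axis s s0.
rewrite -(fineK fM) => /fine_cvgP[_ /cvgrPdist_lt /(_ _ e0)] [n _ /(_ n (leqnn n))] /=.
have [_] := sP n.
have gfin : autocorr f (s n) 0%R \is a fin_num.
  by rewrite ge0_fin_numE// (le_lt_trans (gM _ _)).
rewrite -(fineK fM) -(fineK gfin) -EFinD lte_fin /= => h1 h2.
have := ler_norm (fine (mass f) - fine (autocorr f (s n) 0%R))%R.
move: h1 h2; move: (fine (mass f)) (fine (autocorr f (s n) 0%R)) => p q h1 h2 h3.
by lra.
Qed.

(** Once the translation is longer than the size of a part carrying three
    quarters of the mass, at most half of the mass can overlap. *)
Lemma autocorr_axis_decay : (0 < fine (mass f))%R ->
  exists2 Y : R, (0 < Y)%R & forall a : R, (Y <= a)%R ->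
    autocorr f a 0%R <= (fine (mass f) / 2)%:E.
Proof.
move=> m0.
pose F x := \int[mu]_y (f x y)%:E.
have F0 x : 0 <= F x by rewrite /F; nonneg.
have mF : measurable_fun setT (fun x : X => F x) by rewrite /F; meas.
pose B (n : nat) := `[(- n%:R)%R, n%:R%R]%classic : set R.
have mB n : measurable (B n : set X) by exact: measurable_itv.
have cvgB : \int[mu]_(x in B n) F x @[n --> \oo] --> mass f.
  have := @ge0_nondecreasing_set_cvg_integral _ X R B F mu.
  have -> : \bigcup_i B i = setT.
    apply/seteqP; split => // x _.
    exists (Num.trunc `|x|%R).+1 => //; rewrite /B/= in_itv/= -ler_norml.
    by apply/ltW; exact: truncnS_gt.
  have -> : \int[mu]_x F x = mass f by rewrite mass.unlock.
  apply => //.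
  - move=> n m nm; rewrite /B; apply/subsetPset => x /=; rewrite !in_itv/= => /andP[h1 h2].
    have : (n%:R <= m%:R :> R)%R by rewrite ler_nat.
    by move: h1 h2 => h1 h2 h3; apply/andP; split; lra.
  - by move=> n; exact: measurable_funTS.
have subF (D : set X) : measurable D -> \int[mu]_(x in D) F x <= mass f.
  move=> mD; have -> : mass f = \int[mu]_(x in setT) F x by rewrite mass.unlock.
  by apply: ge0_subset_integral.
have m4 : (0 < fine (mass f) / 4)%R by rewrite divr_gt0.
have Bfin n : \int[mu]_(x in B n) F x \is a fin_num.
  rewrite ge0_fin_numE; last by apply: integral_ge0.
  by apply: le_lt_trans fin; exact: subF.
have [n Hn] : exists n, (fine (mass f) - fine (\int[mu]_(x in B n) F x) <= fine (mass f) / 4)%R.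
  move: cvgB; rewrite -(fineK fM) => /fine_cvgP[_ /cvgrPdist_le /(_ _ m4)] [n _ /(_ n (leqnn n))] /=.
  by move=> H; exists n; apply: le_trans H; exact: ler_norm.
have tailE : \int[mu]_(x in ~` B n) F x <= (fine (mass f) / 4)%:E.
  have mBC : measurable (~` B n : set X) by apply: measurableC; exact: mB.
  have E : mass f = \int[mu]_(x in B n) F x + \int[mu]_(x in ~` B n) F x.
    rewrite -ge0_integral_setU//.
    - by rewrite setUv mass.unlock.
    - by rewrite setUv.
    - by apply/disj_setPCl.
  have tfin : \int[mu]_(x in ~` B n) F x \is a fin_num.
    rewrite ge0_fin_numE; last by apply: integral_ge0.
    by apply: le_lt_trans fin; exact: subF.
  rewrite -(fineK tfin) lee_fin.
  move: E; rewrite -(fineK (Bfin n)) -(fineK tfin) -EFinD => /(congr1 fine) /= E.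
  by move: E Hn; move: (fine _) (fine _) (fine _) => p q r E; lra.
exists (2 * n%:R + 1)%R => [|a ha]; first by rewrite ltr_wpDl// mulr_ge0.
pose t x : \bar R := ((\1_(~` B n) x)%:E * F x).
have mt : measurable_fun setT (fun x : X => t x).
  apply: emeasurable_funM => //; apply/measurable_EFinP; apply: measurable_indic.
  exact: measurableC.
have t0 x : 0 <= t x by rewrite mule_ge0// lee_fin indicE.
have tE : \int[mu]_x t x = \int[mu]_(x in ~` B n) F x.
  rewrite [RHS]integral_mkcond; apply: eq_integral => x _.
  by rewrite /t /patch indicE; case: ifP => /= _; rewrite ?mul1e ?mul0e.
apply: (@le_trans _ _ (\int[mu]_x (t x + t (x + a)%R))).
  rewrite autocorr.unlock; apply: ge0_le_integral; side; move=> x _.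
  have [xB|xB] := pselect (B n x).
    have xaB : ~ B n (x + a)%R.
      move: xB; rewrite /B/= !in_itv/= => /andP[h1 h2] /andP[h3 h4].
      by move: h1 h2 h3 h4 ha; move: (n%:R : R)%R => r; lra.
    apply: (@le_trans _ _ (t (x + a)%R)); last exact: leeDr.
    rewrite /t indicE mem_set// mul1e /F.
    apply: ge0_le_integral; side; move=> y _.
    by rewrite addr0 lee_fin -[leRHS]mul1r ler_wpM2r.
  apply: (@le_trans _ _ (t x)); last exact: leeDl.
  rewrite /t indicE mem_set// mul1e /F.
  apply: ge0_le_integral; side; move=> y _.
  by rewrite lee_fin -[leRHS]mulr1 ler_wpM2l.
rewrite ge0_integralD; side.
rewrite (integral_shift t)// tE.
apply: le_trans (leeD tailE tailE) _.
by rewrite -EFinD lee_fin; lra.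
Qed.

End axis.
End set_energy.

Section core.
Context {R : realType}.
Notation mu := (@lebesgue_measure R).
Notation X := (measurableTypeR R).
Variable f : X -> X -> R.
Hypothesis mf : measurable_fun setT (fun p : X * X => f p.1 p.2).
Hypothesis f01 : forall x y, f x y = 0%R \/ f x y = 1%R.
Hypothesis fin : mass f < +oo.

Let f0 x y : (0 <= f x y)%R. Proof. by case: (f01 x y) => ->. Qed.
Let f1 x y : (f x y <= 1)%R. Proof. by case: (f01 x y) => ->. Qed.
Let mg := measurable_autocorr f mf f0.
Let g0 := autocorr_ge0 f f0.
Let gM := autocorr_le_mass f mf f0 f1.
Let fM : mass f \is a fin_num. Proof. by rewrite ge0_fin_numE// mass_ge0. Qed.
Let gfin a b : autocorr f a b \is a fin_num.
Proof. by rewrite ge0_fin_numE// (le_lt_trans (gM _ _)). Qed.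

Let m := fine (mass f).
Let g a b := fine (autocorr f a b).
Let gE a b : autocorr f a b = (g a b)%:E. Proof. by rewrite fineK. Qed.
Let mE : mass f = m%:E. Proof. by rewrite fineK. Qed.

(** Subadditivity reduces to translations along the axes. *)
Lemma autocorr_near0 e : (0 < e)%R -> exists2 d : R, (0 < d)%R &
  forall s t : R, (`|s| <= d)%R -> (`|t| <= d)%R -> (m <= g s t + e)%R.
Proof.
move=> e0; have e2 : (0 < e / 2)%R by rewrite divr_gt0.
have [d1 d1_gt0 H1] := autocorr_axis_ge f mf f01 fin _ e2.
have [||d2 d2_gt0 H2] := autocorr_axis_ge (fun x y => f y x) _ (fun x y => f01 y x) _ _ e2.
- exact: meas_swap.
- by rewrite mass_swap.
exists (Num.min d1 d2); first by rewrite lt_min d1_gt0.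
move=> s t; rewrite !le_min => /andP[sd _] /andP[_ td].
have := H1 _ sd; have := H2 _ td.
rewrite mass_swap// autocorr_swap// mE !gE -!EFinD !lee_fin.
have := autocorr_subadditive f mf f01 s 0%R 0%R t.
rewrite addr0 add0r mE !gE -!EFinD lee_fin.
move: (g s 0%R) (g 0%R t) (g s t) => u v w h1 h2 h3.
by lra.
Qed.

(** The loss at [n * a] is at most [n] times the loss at [a]. For [n * a] between [Y] and
    [2 * Y] it is at least half of the mass, so the loss at [a] is at least
    [m / (2 * n)], and [n] is at most [2 * Y / a]. *)
Lemma autocorr_linear_growth : (0 < m)%R -> exists c Y : R, [/\ (0 < c)%R, (0 < Y)%R &
  forall a : R, (0 < a)%R -> (a <= Y)%R -> (c * a <= m - g a 0%R)%R].
Proof.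
move=> m0.
have [Y Y0 HY] := autocorr_axis_decay f mf f01 fin m0.
exists (m / (4 * Y))%R, Y; split => //; first by rewrite divr_gt0// mulr_gt0.
move=> a a0 aY.
have multi n : (m - g (n%:R * a) 0 <= n%:R * (m - g a 0))%R.
  elim: n => [|n IH].
    by rewrite !mul0r subr_le0 -lee_fin -gE -mE -(autocorr0 f f01).
  have := autocorr_subadditive f mf f01 (n%:R * a)%R 0%R a 0%R.
  have -> : (n.+1%:R * a = n%:R * a + a)%R by rewrite -natr1 mulrDl mul1r.
  rewrite addr0 mE !gE -!EFinD lee_fin => h.
  rewrite -natr1 mulrDl mul1r; move: IH h.
  by move: (g _ _) (g _ _) (g _ _) => u v w IH h; lra.
pose n := (Num.trunc (Y / a)).+1.
have Yn : (Y <= n%:R * a)%R.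
  by rewrite -ler_pdivrMr//; apply/ltW; exact: truncnS_gt.
have nY : (n%:R * a <= 2 * Y)%R.
  have : ((Num.trunc (Y / a))%:R <= Y / a)%R.
    by have /andP[] := truncn_itv (divr_ge0 (ltW Y0) (ltW a0)).
  by rewrite ler_pdivlMr// /n -natr1 mulrDl mul1r => h; lra.
have := HY _ Yn; rewrite gE lee_fin -/m => gn.
have := multi n; move: gn; move: (g _ _) (g _ _) => v u gn.
have n0 : (0 < n%:R :> R)%R by rewrite ltr0n.
move=> h; rewrite mulrAC ler_pdivrMr ?mulr_gt0//.
have h2 : (m / 2 <= n%:R * (m - v))%R by lra.
have v0 : (0 < m - v)%R.
  by rewrite -(pmulr_rgt0 _ n0); apply: lt_le_trans h2; rewrite divr_gt0.
have : (m / 2 * a <= 2 * Y * (m - v))%R.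
  apply: le_trans (ler_wpM2r (ltW a0) h2) _.
  by rewrite mulrAC ler_wpM2r// ltW.
by lra.
Qed.

(** Tents of width [d] only see the correlations at distance at most [d]. *)
Lemma tent_integral_le (d : R) (k l : X -> \bar R) :
    measurable_fun setT k -> (forall x, 0 <= k x) ->
    measurable_fun setT l -> (forall x, 0 <= l x) ->
    (forall s : R, (`|s| <= d)%R -> k s <= l s) ->
  \int[mu]_s ((tent d s)%:E * k s) <= \int[mu]_s ((tent d s)%:E * l s).
Proof.
move=> mk k0 ml l0 kl.
have mt := measurable_tent d; have t0 := tent_ge0 d.
apply: ge0_le_integral; side; move=> s _.
have [sd|sd] := leP (`|s|)%R d; first by apply: lee_wpmul2l; [rewrite lee_fin|exact: kl].
by rewrite /tent max_r ?mul0e// subr_le0 ltW.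
Qed.

(** Up to the total weight [d ^+ 4] of the two tents, smoothing changes the overlap at
    [0] by at most [e], and also the overlap at [(a, 0)] by subadditivity. *)
Lemma oscillation_ge d e a : (0 < d)%R -> (0 <= e)%R ->
  (forall s t : R, (`|s| <= d)%R -> (`|t| <= d)%R -> (m <= g s t + e)%R) ->
  (d ^+ 4 * (m - g a 0 - 2 * e))%:E <= oscillation d f a 0%R.
Proof.
move=> d_gt0 e0 near0; have d0 := ltW d_gt0.
have mt := measurable_tent d; have t0 := tent_ge0 d.
have m0 : (0 <= m)%R by rewrite fine_ge0// mass_ge0.
have ge0 a' b' : (0 <= g a' b')%R by rewrite fine_ge0.
have constE (M : R) : (0 <= M)%R -> \int[mu]_s ((tent d s)%:E *
    \int[mu]_t ((tent d t)%:E * M%:E)) = (d ^+ 4 * M)%:E.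
  move=> M0.
  rewrite ge0_integralZr; side.
  rewrite ge0_integralZr; side.
  by rewrite integral_tent// -!EFinM; congr (_%:E); ring.
have S0 : (d ^+ 4 * m)%:E <= smooth_corr d f 0%R 0%R + (d ^+ 4 * e)%:E.
  rewrite -!constE// smooth_corr.unlock -ge0_integralD; side.
  apply: (@le_trans _ _ (\int[mu]_s ((tent d s)%:E * \int[mu]_t ((tent d t)%:E *
     (autocorr f (0 + s)%R (0 + t)%R + e%:E))))).
    apply: tent_integral_le; side; move=> s sd.
    apply: tent_integral_le; side; move=> t td.
    by rewrite !add0r gE -EFinD lee_fin; exact: near0.
  apply: ge0_le_integral; side; move=> s _.
  rewrite -ge0_muleDr; side.
  apply: lee_wpmul2l; first by rewrite lee_fin.
  rewrite -ge0_integralD; side.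
  apply: ge0_le_integral; side; move=> t _.
  by rewrite ge0_muleDr ?lee_fin.
have Sa : smooth_corr d f a 0%R <= (d ^+ 4 * (g a 0 + e))%:E.
  rewrite -constE ?addr_ge0// smooth_corr.unlock.
  have ge1 : (0 <= g a 0 + e)%R by rewrite addr_ge0.
  apply: tent_integral_le; side; move=> s sd.
  apply: tent_integral_le; side; move=> t td; rewrite gE lee_fin.
  have := autocorr_subadditive f mf f01 (a + s)%R (0 + t)%R (- s)%R (- t)%R.
  rewrite !addrK mE !gE -!EFinD lee_fin.
  have := near0 (- s)%R (- t)%R; rewrite !normrN => /(_ sd td).
  by move: (g _ _) (g _ _) (g _ _) => u v w h1 h2; lra.
have := smooth_corrD_oscillation f mf f0 f1 d d0 a 0%R.
move: S0 Sa.
have fS b := smooth_corr_fin_num f mf f0 f1 d d0 b 0%R fin.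
rewrite -(fineK (fS 0%R)) -(fineK (fS a)).
move: (fine (smooth_corr d f 0%R 0%R)) (fine (smooth_corr d f a 0%R)) => p q.
rewrite -EFinD !lee_fin => hp hq.
have := oscillation_ge0 f d a 0%R.
move: (oscillation d f a 0%R) => [v| |]//= _ [E].
rewrite lee_fin; move: hp hq E.
rewrite !(mulrDr, mulrBr, mulrN) !mulrA.
by move: (d ^+ 4)%R (g a 0%R) => D w hp hq E; lra.
Qed.

End core.

Section contradiction.
Context {R : realType}.
Notation mu := (@lebesgue_measure R).
Notation X := (measurableTypeR R).

Lemma integral_inv (a b : R) : (0 < a)%R -> (a < b)%R ->
  \int[mu]_(x in `[a, b]) (x^-1)%:E = (ln b - ln a)%:E.
Proof.
move=> a0 ab.
have inv_cont x : (a <= x)%R -> {for x, continuous (@GRing.inv R)}.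
  by move=> ax; apply: inv_continuous; rewrite gt_eqF// (lt_le_trans a0).
have pos x : (a <= x)%R -> (0 < x)%R by exact: lt_le_trans.
rewrite EFinB; apply: continuous_FTC2 => //.
- apply: continuous_in_subspaceT => x; rewrite inE /= in_itv/= => /andP[ax _].
  exact: inv_cont.
- split.
  + by move=> x; rewrite in_itv/= => /andP[ax _]; have /@ex_derive := is_derive1_ln (pos _ (ltW ax)).
  + by apply: cvg_at_right_filter; apply: continuous_ln.
  + by apply: cvg_at_left_filter; apply: continuous_ln; apply: pos; exact: ltW.
- move=> x; rewrite in_itv/= => /andP[ax _]; rewrite derive1E.
  by have /@derive_val := is_derive1_ln (pos _ (ltW ax)).
Qed.

Variable f : X -> X -> R.
Hypothesis mf : measurable_fun setT (fun p : X * X => f p.1 p.2).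
Hypothesis f01 : forall x y, f x y = 0%R \/ f x y = 1%R.
Hypothesis fin : mass f < +oo.

Let f0 x y : (0 <= f x y)%R. Proof. by case: (f01 x y) => ->. Qed.

(** The linear growth of the defect [mass f - autocorr f a 0] makes the energy of
    order [d ^+ 4] times the divergent integral of [a^-1] near [0], cut off at an
    arbitrarily small threshold. *)
Theorem energy_bound_mass0 (C : R) :
  (forall d : R, (0 < d)%R -> (d <= 1)%R -> energy d f 1 0 <= (C * d ^+ 4)%:E) ->
  mass f = 0.
Proof.
move=> bound.
have fM : mass f \is a fin_num by rewrite ge0_fin_numE// mass_ge0.
apply/eqP; rewrite eq_le mass_ge0// andbT leNgt; apply/negP => m_gt0.
have m0 : (0 < fine (mass f))%R by rewrite fine_gt0// m_gt0.
have [c [Y [c0 Y0 growth]]] := autocorr_linear_growth f mf f01 fin m0.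
(* The length [L] of the logarithmic range from [a0] to [Y] makes [c / 2 * L]
   larger than [C]. *)
pose L : R := (2 * `|C| / c + 1)%R.
have L0 : (0 < L)%R by rewrite ltr_wpDl// divr_ge0 ?mulr_ge0// ltW.
pose a0 := (Y * expR (- L))%R.
have a0_gt0 : (0 < a0)%R by rewrite mulr_gt0// expR_gt0.
have a0Y : (a0 < Y)%R by rewrite gtr_pMr// expR_lt1// oppr_lt0.
have lnL : (ln Y - ln a0 = L)%R by rewrite lnM ?posrE ?expR_gt0// expRK; lra.
(* The smoothing error [2 * e] takes at most half of the loss [c * a] for [a >= a0]. *)
pose e := (c * a0 / 4)%R.
have e0 : (0 < e)%R by rewrite divr_gt0// mulr_gt0.
have [d1 d1_gt0 near0] := autocorr_near0 f mf f01 fin _ e0.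
pose d := Num.min d1 1%R.
have d0 : (0 < d)%R by rewrite lt_min d1_gt0 ltr01.
have dd1 : (d <= d1)%R by rewrite ge_min lexx.
have near0d : forall s t : R, (`|s| <= d)%R -> (`|t| <= d)%R ->
    (fine (mass f) <= fine (autocorr f s t) + e)%R.
  by move=> s t sd td; apply: near0; exact: (le_trans _ dd1).
have dge : (d <= 1)%R by rewrite ge_min lexx orbT.
have := bound _ d0 dge; apply/negP; rewrite -ltNge.
have low : (d ^+ 4 * (c / 2) * L)%:E <= energy d f 1 0.
  rewrite -lnL EFinM -integral_inv// energy.unlock.
  rewrite -ge0_integralZl//; last 3 first.
  - by apply: measurable_funTS; apply/measurable_EFinP; exact: measurable_inv.
  - by move=> x /=; rewrite in_itv/= => /andP[ax _]; rewrite lee_fin invr_ge0 (le_trans (ltW a0_gt0)).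
  - by rewrite lee_fin !mulr_ge0// ?exprn_ge0// ltW.
  have mo := measurable_oscillation f mf f0 d.
  have o0 := oscillation_ge0 f d.
  have mE : measurable_fun setT (fun a : X => (a^-1 ^+ 2)%R%:E * oscillation d f (1 * a)%R (0 * a)%R).
    by meas.
  apply: (@le_trans _ _ (\int[mu]_(a in `[a0, Y]) ((a^-1 ^+ 2)%R%:E * oscillation d f (1 * a)%R (0 * a)%R))); last first.
    by apply: ge0_subset_integral => //; nonneg.
  apply: ge0_le_integral => //.
  - move=> x /=; rewrite in_itv/= => /andP[ax _]; rewrite -EFinM lee_fin !mulr_ge0// ?exprn_ge0// ?ltW// invr_gt0.
    exact: lt_le_trans ax.
  - by apply: measurable_funTS; apply: measurable_funeM; apply/measurable_EFinP; exact: measurable_inv.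
  - exact: measurable_funTS.
  move=> x /=; rewrite in_itv/= => /andP[ax xY]; rewrite mul1r mul0r.
  have x0 : (0 < x)%R by exact: lt_le_trans ax.
  have := oscillation_ge f mf f01 fin _ _ x d0 (ltW e0) near0d => osc.
  apply: le_trans (lee_wpmul2l _ osc); last by rewrite lee_fin sqr_ge0.
  rewrite -!EFinM lee_fin.
  have -> : (d ^+ 4 * (c / 2) * x^-1 = x^-1 ^+ 2 * (d ^+ 4 * (c / 2 * x)))%R.
    by field; rewrite gt_eqF.
  apply: ler_wpM2l; first exact: sqr_ge0.
  apply: ler_wpM2l; first by rewrite exprn_ge0// ltW.
  have := growth _ x0 xY.
  have : (c * a0 <= c * x)%R by rewrite ler_wpM2l// ltW.
  rewrite /e; move: (c * a0)%R => z; rewrite mulrAC.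
  move: (c * x)%R (fine _ - fine _)%R => u v h1 h2; lra.
apply: lt_le_trans low; rewrite lte_fin.
have d4 : (0 < d ^+ 4)%R by rewrite exprn_gt0.
rewrite mulrC -mulrA ltr_pM2l//.
have -> : (c / 2 * L = `|C| + c / 2)%R by rewrite /L; field; rewrite gt_eqF.
by rewrite (le_lt_trans (ler_norm C))// ltrDl divr_gt0.
Qed.

End contradiction.

(** * Hausdorff measure on the line and Lipschitz maps *)

Section hausdorff_basics.
Context {R : realType} {T : Type} (d : T -> T -> R).
Implicit Types A B : set T.

Lemma diameter_ge0 A : 0 <= diameter d A.
Proof. by apply: ereal_sup_ubound; left. Qed.

Lemma le_diameter A (D : R) : (0 <= D)%R ->
  (forall x y, A x -> A y -> (d x y <= D)%R) -> diameter d A <= D%:E.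
Proof.
move=> D0 AD; apply: ub_ereal_sup => _ [->|[[x y] [/= Ax Ay] <-]].
  by rewrite lee_fin.
by rewrite lee_fin AD.
Qed.

Lemma diameter_ge A x y : A x -> A y -> (d x y)%:E <= diameter d A.
Proof. by move=> Ax Ay; apply: ereal_sup_ubound; right; exists (x, y). Qed.

Lemma hausdorff1_premeasure_ge0 delta A : 0 <= hausdorff1_premeasure d delta A.
Proof.
apply: le_ereal_inf_tmp => _ [U _ <-].
by apply: nneseries_ge0 => n _ _; exact: diameter_ge0.
Qed.

Lemma hausdorff1_premeasure_le delta A : (0 < delta)%R ->
  hausdorff1_premeasure d delta A <= hausdorff1 d A.
Proof. by move=> delta0; apply: ereal_sup_ubound; exists delta. Qed.

Lemma hausdorff1_le_premeasure A b :
  (forall delta : R, (0 < delta)%R -> hausdorff1_premeasure d delta A <= b) ->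
  hausdorff1 d A <= b.
Proof. by move=> Ab; apply: ub_ereal_sup => _ [delta /= delta0 <-]; exact: Ab. Qed.

Lemma hausdorff1_ge0 A : 0 <= hausdorff1 d A.
Proof.
exact: le_trans (hausdorff1_premeasure_ge0 1%R A) (hausdorff1_premeasure_le _ A ltr01).
Qed.

Lemma subset_hausdorff1 A B : A `<=` B -> hausdorff1 d A <= hausdorff1 d B.
Proof.
move=> AB; apply: hausdorff1_le_premeasure => delta delta0.
apply: le_trans (hausdorff1_premeasure_le _ B delta0).
apply: le_ereal_inf_tmp => _ [U [BU dU] <-]; apply: ereal_inf_lbound; exists U => //.
by split => //; exact: subset_trans BU.
Qed.

(** A doubly indexed cover is as good as a sequence. *)
Lemma hausdorff1_premeasure_cover2 (delta : R) A (V : nat -> nat -> set T) :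
    A `<=` \bigcup_i \bigcup_j V i j ->
    (forall i j, diameter d (V i j) <= delta%:E) ->
  hausdorff1_premeasure d delta A <=
    \sum_(0 <= i <oo) \sum_(0 <= j <oo) diameter d (V i j).
Proof.
move=> AV dV.
have dV0 i j : 0 <= diameter d (V i j) by exact: diameter_ge0.
have -> : \sum_(0 <= i <oo) \sum_(0 <= j <oo) diameter d (V i j) =
    \esum_(k in [set: nat * nat]) diameter d (V k.1 k.2).
  rewrite nneseries_esumT; last by move=> i; exact: nneseries_ge0.
  rewrite (eq_esum (b := fun i => \esum_(j in [set: nat]) diameter d (V i j))); last first.
    by move=> i _; rewrite nneseries_esumT.
  by rewrite esum_esum//; congr esum; apply/seteqP.
have /card_esym/ppcard_eqP[h] := card_nat2.
rewrite (reindex_esum setT setT h)//.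
rewrite -nneseries_esumT//; apply: ereal_inf_lbound.
exists (fun n => V (h n).1 (h n).2) => //; split => // x /AV[i _ [j _ Vx]].
by exists (h^-1%FUN (i, j)) => //=; rewrite invK ?inE.
Qed.

End hausdorff_basics.

Section hausdorff_lipschitz.
Context {R : realType} {T T' : Type} (d : T -> T -> R) (d' : T' -> T' -> R).

(** The images of the sets of a cover by sets of diameter at most [delta / K] have
    diameter at most [delta]. *)
Lemma hausdorff1_image (h : T -> T') (K : R) (A : set T) :
    (0 < K)%R -> (forall x y, A x -> A y -> (d' (h x) (h y) <= K * d x y)%R) ->
  hausdorff1 d' (h @` A) <= K%:E * hausdorff1 d A.
Proof.
move=> K0 hK; apply: ub_ereal_sup => _ [delta /= delta0 <-].
have dK : (0 < delta / K)%R by rewrite divr_gt0.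
apply: le_trans (lee_wpmul2l _ (hausdorff1_premeasure_le d _ A dK)); last first.
  by rewrite lee_fin ltW.
rewrite -lee_pdivrMl//; apply: le_ereal_inf_tmp => _ [U [AU dU] <-].
rewrite lee_pdivrMl// -nneseriesZl; last by move=> i _; exact: diameter_ge0.
have dV i : diameter d' (h @` (A `&` U i)) <= K%:E * diameter d (U i).
  apply: ub_ereal_sup => _ [->|[[_ _] [/= [x [Ax Ux] <-] [y [Ay Uy] <-]] <-]].
    by rewrite mule_ge0 ?diameter_ge0// lee_fin ltW.
  apply: (@le_trans _ _ (K * d x y)%:E); first by rewrite lee_fin hK.
  by rewrite EFinM lee_wpmul2l ?lee_fin ?(ltW K0)// diameter_ge.
apply: (@le_trans _ _ (\sum_(0 <= i <oo) diameter d' (h @` (A `&` U i)))).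
  apply: ereal_inf_lbound; exists (fun i => h @` (A `&` U i)) => //; split.
    by move=> _ [x Ax <-]; have [i _ Ux] := AU _ Ax; exists i => //; exists x.
  move=> i; apply: le_trans (dV i) _.
  have -> : delta = (K * (delta / K))%R by field; rewrite gt_eqF.
  by rewrite EFinM lee_wpmul2l ?lee_fin ?(ltW K0).
apply: lee_nneseries => i _; last exact: dV.
by move=> _; exact: diameter_ge0.
Qed.

End hausdorff_lipschitz.

Section hausdorff_line.
Context {R : realType}.
Notation mu := (@lebesgue_measure R).
Notation X := (measurableTypeR R).
Local Notation dist := (fun s t : R => `|s - t|%R).

(** The closed interval from the infimum to the supremum of a bounded set has the same
    diameter. *)
Lemma lebesgue_measure_cover_diameter (U : set R) :
  exists2 B : set X, measurable B & U `<=` B /\ mu B <= diameter dist U.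
Proof.
have [->|U0] := eqVneq U set0.
  by exists set0 => //; split => //; rewrite measure0 diameter_ge0.
have /set0P[x Ux] := U0.
have := diameter_ge0 dist U; case E : (diameter dist U) => [D| |]//; last first.
  by exists setT => //; split => //; exact: leey.
rewrite lee_fin => D0.
have UD y z : U y -> U z -> (y - z <= D)%R.
  move=> Uy Uz; apply: le_trans (ler_norm _) _.
  by rewrite -lee_fin -E; exact: (@diameter_ge _ _ dist).
have hs : has_sup U by split; [exists x|exists (x + D)%R => y Uy; rewrite addrC -lerBlDr UD].
have hi : has_inf U by split; [exists x|exists (x - D)%R => y Uy; rewrite lerBlDr addrC -lerBlDr UD].
exists `[inf U, sup U]%classic; first exact: measurable_itv.
split=> [y Uy|].
  by rewrite /= in_itv/=; apply/andP; split; [exact: (ge_inf (proj2 hi) Uy)|exact: (ub_le_sup (proj2 hs) Uy)].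
have le_is : (inf U <= sup U)%R.
  by exact: le_trans (ge_inf (proj2 hi) Ux) (ub_le_sup (proj2 hs) Ux).
have : (sup U - D <= inf U)%R.
  apply: lb_le_inf; first by exists x.
  move=> y Uy; rewrite lerBlDr; apply: ge_sup; first by exists x.
  by move=> z Uz; rewrite addrC -lerBlDr UD.
by rewrite lebesgue_measure_itv/= lte_fin; case: ifP => _ h; rewrite lee_fin; lra.
Qed.

Lemma lebesgue_le_hausdorff1 (A : set X) : measurable A -> mu A <= hausdorff1 dist A.
Proof.
move=> mA; apply: le_trans (hausdorff1_premeasure_le dist _ A ltr01).
apply: le_ereal_inf_tmp => _ [U [AU _] <-].
have [B BU] : {B : nat -> set X & forall i, measurable (B i) /\ (U i `<=` B i /\ mu (B i) <= diameter dist (U i))}.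
  apply: (@choice _ _ (fun i B => measurable B /\ (U i `<=` B /\ mu B <= diameter dist (U i)))) => i.
  by have [B] := lebesgue_measure_cover_diameter (U i); exists B.
apply: (@le_trans _ _ (\sum_(0 <= i <oo) mu (B i))); last first.
  by apply: lee_nneseries => // i _; have [_ []] := BU i.
apply: measure_sigma_subadditive => //; first by move=> i; have [] := BU i.
by move=> x /AU[i _ Ux]; exists i => //; have [_ [UB _]] := BU i; exact: UB.
Qed.

(** Cut the interval into pieces of length [delta], which keeps the total length. *)
Lemma hausdorff1_premeasure_itv (delta a b : R) : (0 < delta)%R -> (a <= b)%R ->
  exists V : nat -> set R, [/\ `]a, b]%classic `<=` \bigcup_j V j,
    forall j, diameter dist (V j) <= delta%:E &
    \sum_(0 <= j <oo) diameter dist (V j) <= (b - a)%:E].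
Proof.
move=> delta0 ab.
pose p j := Num.min b (a + j%:R * delta)%R.
have pS j : (p j <= p j.+1)%R.
  rewrite /p le_min ge_min lexx/= ge_min.
  by rewrite lerD2l ler_wpM2r ?orbT ?ler_nat// ltW.
have dp j : (p j.+1 - p j <= delta)%R.
  have : (a + j.+1%:R * delta = a + j%:R * delta + delta)%R by rewrite -natr1; ring.
  rewrite /p => ->; move: (a + _)%R => z.
  by rewrite !minEle; case: (leP b z) => ?; case: (leP b (z + delta)%R) => ?; lra.
have dV j : diameter dist (`[p j, p j.+1]%classic : set R) <= (p j.+1 - p j)%:E.
  apply: le_diameter; first by rewrite subr_ge0.
  move=> x y; rewrite /= !in_itv/= => /andP[? ?] /andP[? ?].
  by rewrite ler_norml; apply/andP; split; lra.
exists (fun j => `[p j, p j.+1]%classic); split.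
- move=> x; rewrite /= in_itv/= => /andP[ax xb].
  exists (Num.trunc ((x - a) / delta)) => //=.
  have xa0 : (0 <= (x - a) / delta)%R by rewrite divr_ge0 ?subr_ge0// ltW.
  have /andP[lo hi] := truncn_itv xa0.
  move: lo hi; rewrite ler_pdivlMr// ltr_pdivrMr// => lo hi.
  rewrite in_itv/= /p ge_min le_min xb/=; apply/andP; split.
    by apply/orP; right; lra.
  by lra.
- by move=> j; apply: le_trans (dV j) _; rewrite lee_fin.
apply: lime_le; first by apply: is_cvg_nneseries => j _ _; exact: diameter_ge0.
apply: nearW => n; apply: (@le_trans _ _ (\sum_(0 <= j < n) (p j.+1 - p j)%:E)).
  exact: lee_sum.
rewrite sumEFin telescope_sumr// lee_fin /p mul0r addr0 (min_r ab) lerD2r.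
by rewrite ge_min lexx.
Qed.

(** Lebesgue outer measure is computed by covers with half-open intervals, which can be
    cut into short pieces. *)
Lemma hausdorff1_le_lebesgue (A : set X) : hausdorff1 dist A <= mu A.
Proof.
apply: hausdorff1_le_premeasure => delta delta0.
apply: le_ereal_inf_tmp => _ [F [mF AF] <-].
have [V VF] : {V : nat -> nat -> set R & forall i, [/\ F i `<=` \bigcup_j V i j,
    forall j, diameter dist (V i j) <= delta%:E &
    \sum_(0 <= j <oo) diameter dist (V i j) <= wlength idfun (F i)]}.
  apply: (@choice _ _ (fun i V => [/\ F i `<=` \bigcup_j V j,
    forall j, diameter dist (V j) <= delta%:E &
    \sum_(0 <= j <oo) diameter dist (V j) <= wlength idfun (F i)])) => i.
  have /ocitvP[->|[[a b] /= ab ->]] := mF i.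
    exists (fun=> set0); split => //.
    - by move=> j; apply: le_diameter => //; exact: ltW.
    - rewrite wlength0; apply: lime_le; first by apply: is_cvg_nneseries => j _ _; exact: diameter_ge0.
      by apply: nearW => n; rewrite big1// => j _; apply/eqP; rewrite eq_le diameter_ge0 andbT; exact: le_diameter.
  have [V [V1 V2 V3]] := hausdorff1_premeasure_itv _ _ _ delta0 (ltW ab).
  by exists V; split => //; rewrite wlength_itv_bnd//; exact: ltW.
apply: le_trans (hausdorff1_premeasure_cover2 dist delta A V _ _) _.
- by move=> x /AF[i _ Fx]; have [h _ _] := VF i; have [j _ Vx] := h _ Fx; exists i => //; exists j.
- by move=> i j; have [] := VF i.
apply: lee_nneseries => i _; last by have [] := VF i.
by move=> _; apply: nneseries_ge0 => j _ _; exact: diameter_ge0.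
Qed.

Lemma hausdorff1_lebesgue (A : set X) : measurable A -> hausdorff1 dist A = mu A.
Proof.
by move=> mA; apply/eqP; rewrite eq_le hausdorff1_le_lebesgue lebesgue_le_hausdorff1.
Qed.

End hausdorff_line.

(** * Integrals along lines *)

Section graph.
Context {R : realType}.
Local Notation dist := (fun s t : R => `|s - t|%R).
Implicit Types (E : set (R * R)) (w : R * R).

(** A line of unit normal [w] is a graph over the first axis whose projection shrinks
    distances by the factor [`|w.2|]. *)
Lemma euclidean_dist_line w t (p q : R * R) : unit_circle w -> w.2 != 0%R ->
  line w t p -> line w t q -> euclidean_dist p q = (`|w.2|^-1 * `|p.1 - q.1|)%R.
Proof.
rewrite /unit_circle /line /inner /= => w1 w2 pt qt.
rewrite /euclidean_dist.
have -> : ((p.1 - q.1) ^+ 2 + (p.2 - q.2) ^+ 2 = (w.2^-1 * (p.1 - q.1)) ^+ 2)%R.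
  have E : ((p.2 - q.2) * w.2 = - ((p.1 - q.1) * w.1))%R by move: pt; rewrite -qt; lra.
  have -> : (p.2 - q.2 = - ((p.1 - q.1) * w.1) / w.2)%R by rewrite -E mulfK.
  have : (w.1 ^+ 2 = 1 - w.2 ^+ 2)%R by rewrite -w1; ring.
  move: (p.1 - q.1)%R w.1 w.2 w2 => x a b b0 a2.
  rewrite expr_div_n sqrrN exprMn a2; field.
  by rewrite b0.
by rewrite sqrtr_sqr normrM normfV.
Qed.

(** The graph map and the projection are Lipschitz with inverse constants. *)
Lemma radon_indic_graph E w u : unit_circle w -> w.2 != 0%R ->
  radon_indic E w (w.2 * u) = (`|w.2|^-1)%:E *
    hausdorff1 dist [set x : R | E (x, u - w.1 / w.2 * x)%R].
Proof.
move=> w1 w2; rewrite /radon_indic.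
set S := [set x : R | _].
have lineP x : line w (w.2 * u) (x, u - w.1 / w.2 * x)%R.
  by rewrite /line /inner /=; field.
have w20 : (0 < `|w.2|)%R by rewrite normr_gt0.
have SE : (fun x : R => (x, u - w.1 / w.2 * x)%R) @` S = E `&` line w (w.2 * u)%R.
  apply/seteqP; split => [_ [x Sx <-]|[x y] [Exy xy]]; first by split.
  have yE : y = (u - w.1 / w.2 * x)%R.
    have -> : (u = (x * w.1 + y * w.2) / w.2)%R.
      by rewrite /line /inner /= in xy; rewrite xy mulrC mulKf.
    by field.
  by exists x; rewrite /S/= -?yE.
have SE' : (@fst R R) @` (E `&` line w (w.2 * u)%R) = S.
  rewrite -SE; apply/seteqP; split => [_ [_ [x Sx <-] <-]//|x Sx].
  by exists (x, u - w.1 / w.2 * x)%R => //; exists x.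
apply/eqP; rewrite eq_le; apply/andP; split.
  rewrite -SE; apply: hausdorff1_image; first by rewrite invr_gt0.
  by move=> x y _ _; rewrite (euclidean_dist_line w (w.2 * u)%R).
rewrite lee_pdivrMl//.
rewrite -{1}SE'; apply: hausdorff1_image => // x y [_ xt] [_ yt].
by rewrite (euclidean_dist_line w (w.2 * u)%R)// mulrA divff ?mul1r// gt_eqF.
Qed.

(** Exchanging the coordinates is an isometry. *)
Lemma radon_indic_swap E w t :
  radon_indic [set p | E (p.2, p.1)] (w.2, w.1) t = radon_indic E w t.
Proof.
suff le E' w' : radon_indic [set p | E' (p.2, p.1)] (w'.2, w'.1) t <= radon_indic E' w' t.
  apply/eqP; rewrite eq_le le/=.
  have := le [set p | E (p.2, p.1)] (w.2, w.1).
  have -> : [set p | [set p | E (p.2, p.1)] (p.2, p.1)] = E by apply/seteqP; split=> -[x y].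
  by case: (w).
rewrite /radon_indic -[leRHS]mul1e.
have -> : [set p | E' (p.2, p.1)] `&` line (w'.2, w'.1) t =
    (fun p : R * R => (p.2, p.1)) @` (E' `&` line w' t).
  apply/seteqP; split => [[x y] [/= Eyx xy]|_ [[x y] [/= Exy xy] <-]].
    by exists (y, x) => //; split => //; move: xy; rewrite /line /inner /= addrC.
  by split => //; move: xy; rewrite /line /inner /= addrC.
apply: hausdorff1_image => // x y _ _.
by rewrite mul1r /euclidean_dist addrC.
Qed.

Lemma Lip_swap E w : Lip [set p | E (p.2, p.1)] (w.2, w.1) = Lip E w.
Proof.
rewrite /Lip; have -> // : radon_indic [set p | E (p.2, p.1)] (w.2, w.1) = radon_indic E w.
by apply/funext => t; exact: radon_indic_swap.
Qed.

End graph.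

Section sandwich.
Context {R : realType}.
Notation mu := (@lebesgue_measure R).
Notation X := (measurableTypeR R).
Local Notation dist := (fun s t : R => `|s - t|%R).

Lemma slice_indicator (f : X -> X -> R) (m u : R) :
    measurable_fun setT (fun p : X * X => f p.1 p.2) ->
    (forall x y, f x y = 0%R \/ f x y = 1%R) ->
  measurable ([set x | f x (u - m * x)%R = 1%R] : set X) /\
  slice f m u = mu [set x | f x (u - m * x)%R = 1%R].
Proof.
move=> mf f01.
have mfu : measurable_fun setT (fun x : X => f x (u - m * x)%R : X) by meas.
have mS : measurable ([set x | f x (u - m * x)%R = 1%R] : set X).
  by rewrite -[X in measurable X]setTI; exact: (mfu measurableT [set 1%R]).
split => //; rewrite slice.unlock.
rewrite -[X in mu X]setIT -integral_indic//.
apply: eq_integral => x _; congr (_%:E); rewrite indicE.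
case: (f01 x (u - m * x)%R) => fE; rewrite fE.
  by rewrite memNset// /= fE => /eqP; rewrite eq_sym oner_eq0.
by rewrite mem_set.
Qed.

Variables (E : set (R * R)) (f n : X -> X -> R).
Hypothesis mf : measurable_fun setT (fun p : X * X => f p.1 p.2).
Hypothesis mn : measurable_fun setT (fun p : X * X => n p.1 p.2).
Hypothesis f01 : forall x y, f x y = 0%R \/ f x y = 1%R.
Hypothesis n01 : forall x y, n x y = 0%R \/ n x y = 1%R.
Hypothesis fE : forall x y, f x y = 1%R -> E (x, y).
Hypothesis Efn : forall x y, E (x, y) -> f x y = 1%R \/ n x y = 1%R.
Hypothesis null : mass n = 0.

(** Almost all slices of the null set [n] are null, so almost all slices of [E] differ
    from the Borel slices of [f] by a null set. *)
Lemma ae_radon_slice w : unit_circle w -> w.2 != 0%R ->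
  {ae mu, forall u : X, radon_indic E w (w.2 * u)%R =
    (`|w.2|^-1)%:E * slice f (w.1 / w.2)%R u}.
Proof.
move=> w1 w2; set m : R := (w.1 / w.2)%R.
have n0 x y : (0 <= n x y)%R by case: (n01 x y) => ->.
have : {ae mu, forall u : X, slice n m u = 0}.
  have ms := measurable_slice n mn n0.
  have m1 : measurable_fun setT (slice n m : X -> \bar R) by meas.
  have [+ _] := ae_eq_integral_abs mu measurableT m1; move=> ae0.
  have : \int[mu]_u `|slice n m u| = 0.
    rewrite -null -(integral_slice n mn n0 m); apply: eq_integral => x _.
    by rewrite gee0_abs// slice_ge0.
  by move=> /ae0; apply: filterS => u; exact.
apply: filterS => u nu.
rewrite radon_indic_graph//; congr (_ * _).
have [mSf SfE] := slice_indicator f m u mf f01.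
have [mSn SnE] := slice_indicator n m u mn n01.
apply/eqP; rewrite eq_le; apply/andP; split.
  apply: (@le_trans _ _ (hausdorff1 dist ([set x | f x (u - m * x)%R = 1%R] `|` [set x | n x (u - m * x)%R = 1%R]))).
    by apply: subset_hausdorff1 => x /Efn.
  rewrite hausdorff1_lebesgue; last exact: measurableU.
  apply: le_trans (measureU2 mu mSf mSn) _.
  apply: (@le_trans _ _ (slice f m u + slice n m u)); last by rewrite nu adde0.
  by rewrite SfE SnE.
rewrite SfE; apply: le_trans (lebesgue_le_hausdorff1 _ mSf) _.
by apply: subset_hausdorff1 => x; exact: fE.
Qed.

End sandwich.

(** * Lipschitz functions with small support *)

Section lipschitz_support.
Context {R : realType}.
Notation mu := (@lebesgue_measure R).
Notation X := (measurableTypeR R).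
Variables (h : X -> R) (k B : R).
Hypothesis k0 : (0 <= k)%R.
Hypothesis B0 : (0 <= B)%R.
Hypothesis h0 : forall u, (0 <= h u)%R.
Hypothesis hk : forall s t : R, (`|h s - h t| <= k * `|s - t|)%R.

Lemma measurable_lipschitz : measurable_fun setT (h : X -> X).
Proof.
apply: continuous_measurable_fun => x; apply/cvgrPdist_lt => e e0.
have k1 : (0 < k + 1)%R by rewrite ltr_wpDl.
have ek : (0 < e / (k + 1))%R by rewrite divr_gt0.
near=> t; apply: le_lt_trans (hk x t) _.
have : (`|x - t| < e / (k + 1))%R by near: t; apply: cvgr_dist_lt.
rewrite ltr_pdivlMr// => xt; apply: le_lt_trans xt.
by rewrite mulrC ler_wpM2l// lerDl.
Unshelve. all: by end_near.
Qed.

Lemma measurable_lipschitz_support : measurable ([set u | h u != 0%R] : set X).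
Proof.
rewrite -[X in measurable X]setTI; apply: (measurable_lipschitz measurableT [set x : X | x != 0%R]).
have -> : [set x : X | x != 0%R] = ~` [set 0%R] by apply/seteqP; split=> x /= /eqP.
exact: measurableC.
Qed.

Let P : set X := [set u | h u != 0%R].
Let mP : measurable P := measurable_lipschitz_support.
Hypothesis PB : mu P <= B%:E.

(** An interval of length [B + 1] is longer than the support, so it contains a zero. *)
Lemma lipschitz_support_le u : (h u <= k * (B + 1))%R.
Proof.
pose I : set X := `[u, (u + (B + 1))%R]%classic.
have [t It ht] : exists2 t, I t & h t = 0%R.
  apply: contrapT => noz.
  have IP : I `<=` P.
    by move=> t It; apply/negP => /eqP ht; apply: noz; exists t.
  have : mu I <= B%:E.
    by apply: le_trans PB; apply: le_measure => //; rewrite inE//; exact: measurable_itv.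
  by rewrite lebesgue_measure_itv/= lte_fin ltrDl ltr_wpDl// -EFinD lee_fin; lra.
have := hk u t; rewrite ht subr0 ger0_norm// => /le_trans; apply.
apply: ler_wpM2l => //.
by move: It; rewrite /I/= in_itv/= ler_norml => /andP[? ?]; apply/andP; split; lra.
Qed.

Let mh := measurable_lipschitz.

Let supportE (c : R) : \int[mu]_u (c * \1_P u)%:E = c%:E * mu P.
Proof.
transitivity (\int[mu]_u (c%:E * (\1_P u)%:E)).
  by apply: eq_integral => u _; rewrite EFinM.
rewrite integralZl//; first by rewrite integral_indic// setIT.
apply/integrableP; split; first by apply/measurable_EFinP; exact: measurable_indic.
under eq_integral => u _ do rewrite gee0_abs ?lee_fin//.
by rewrite integral_indic// setIT (le_lt_trans PB)// ltry.
Qed.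

Let h_le u : (h u <= k * (B + 1) * \1_P u)%R.
Proof.
rewrite indicE; case: (boolP (u \in P)) => [_|]; first by rewrite mulr1 lipschitz_support_le.
by move/negP => uP; rewrite mulr0 leNgt; apply/negP => hu; apply: uP; rewrite inE /P/= gt_eqF.
Qed.

Lemma integral_lipschitz : \int[mu]_u (h u)%:E <= (k * (B + 1) * B)%:E.
Proof.
have kB : (0 <= k * (B + 1))%R by rewrite mulr_ge0// addr_ge0.
apply: (@le_trans _ _ (\int[mu]_u (k * (B + 1) * \1_P u)%:E)).
  apply: ge0_le_integral => //.
  - by move=> u _; rewrite lee_fin.
  - by apply/measurable_EFinP.
  - by apply/measurable_EFinP; apply: measurable_funM => //; exact: measurable_indic.
  - by move=> u _; rewrite lee_fin.
by rewrite supportE [leRHS]EFinM lee_wpmul2l.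
Qed.

Lemma integral_lipschitz_sqr : \int[mu]_u (h u * h u)%:E <= ((k * (B + 1)) ^+ 2 * B)%:E.
Proof.
have kB : (0 <= k * (B + 1))%R by rewrite mulr_ge0// addr_ge0.
apply: (@le_trans _ _ (\int[mu]_u ((k * (B + 1)) ^+ 2 * \1_P u)%:E)).
  apply: ge0_le_integral => //.
  - by move=> u _; rewrite lee_fin mulr_ge0.
  - by apply/measurable_EFinP; exact: measurable_funM.
  - by apply/measurable_EFinP; apply: measurable_funM => //; exact: measurable_indic.
  - move=> u _; rewrite lee_fin.
    have := h_le u; rewrite indicE; case: (u \in P); rewrite ?mulr1 ?mulr0 => hu.
      by rewrite expr2 ler_pM.
    have -> : h u = 0%R by apply/eqP; rewrite eq_le hu h0.
    by rewrite mul0r.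
by rewrite supportE [leRHS]EFinM lee_wpmul2l ?lee_fin ?sqr_ge0.
Qed.

(** The increment is at most [k * d], and vanishes unless [u] or [u + d] is in the support. *)
Lemma integral_lipschitz_increment d :
  \int[mu]_u ((h (u + d)%R - h u) ^+ 2)%:E <= (k ^+ 2 * (2 * B) * d ^+ 2)%:E.
Proof.
have kd0 : (0 <= k ^+ 2 * d ^+ 2)%R by rewrite mulr_ge0// sqr_ge0.
have mS := measurable_shift d.
have mi : measurable_fun setT (\1_P : X -> X) by exact: measurable_indic.
have mi' : measurable_fun setT (fun u : X => \1_P (u + d)%R : X) by exact: measurableT_comp mi mS.
apply: (@le_trans _ _ (\int[mu]_u ((k ^+ 2 * d ^+ 2 * \1_P u)%:E + (k ^+ 2 * d ^+ 2 * \1_P (u + d)%R)%:E))).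
  apply: ge0_le_integral => //.
  - by move=> u _; rewrite lee_fin sqr_ge0.
  - by apply/measurable_EFinP; meas.
  - by apply: emeasurable_funD; apply/measurable_EFinP; apply: measurable_funM.
  move=> u _; rewrite -EFinD lee_fin.
  have H : ((h (u + d) - h u) ^+ 2 <= k ^+ 2 * d ^+ 2)%R.
    rewrite -exprMn -[leLHS]real_normK ?num_real// -[leRHS]real_normK ?num_real//.
    rewrite lerXn2r ?nnegrE// normrM (ger0_norm k0).
    by apply: le_trans (hk _ _) _; rewrite [X in (_ * `|X|)%R]addrC addKr.
  have i0 v : (0 <= (\1_P v : R))%R by [].
  rewrite !indicE; case: (boolP (u \in P)) => uP /=.
    by rewrite mulr1 -[leLHS]addr0 lerD// mulr_ge0.
  case: (boolP (_ \in P)) => udP /=; first by rewrite mulr0 add0r mulr1.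
  move: uP udP; rewrite !notin_setE /P /= => /negP; rewrite negbK => /eqP-> /negP; rewrite negbK => /eqP->.
  by rewrite subrr expr0n /= mulr0 addr0.
rewrite ge0_integralD//; last 4 first.
- by move=> u _; rewrite lee_fin mulr_ge0.
- by apply/measurable_EFinP; apply: measurable_funM.
- by move=> u _; rewrite lee_fin mulr_ge0.
- by apply/measurable_EFinP; apply: measurable_funM.
rewrite (integral_shift (fun u : X => (k ^+ 2 * d ^+ 2 * \1_P u)%:E)); last 2 first.
- by apply/measurable_EFinP; apply: measurable_funM.
- by move=> u; rewrite lee_fin mulr_ge0.
rewrite supportE.
have : (k ^+ 2 * d ^+ 2)%:E * mu P <= (k ^+ 2 * d ^+ 2 * B)%:E.
  by rewrite [leRHS]EFinM lee_wpmul2l.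
move=> H; apply: le_trans (leeD H H) _.
rewrite -EFinD lee_fin le_eqVlt; apply/orP; left; apply/eqP; ring.
Qed.

End lipschitz_support.

(** * The Lipschitz constant in one direction *)

Section direction.
Context {R : realType}.
Notation mu := (@lebesgue_measure R).
Notation X := (measurableTypeR R).
Local Notation dist := (fun s t : R => `|s - t|%R).

(** The infimum in [Lip] is approached by Lipschitz constants, which are nonnegative. *)
Lemma Lip_approx (E : set (R * R)) w : Lip E w < +oo ->
  (forall t, radon_indic E w t \is a fin_num) /\
  exists2 L : R, (0 <= L)%R & Lip E w = L%:E /\ forall e : R, (0 < e)%R ->
    exists k : R, [/\ (0 <= k)%R, (k <= L + e)%R &
      forall s t : R, (`|fine (radon_indic E w s) - fine (radon_indic E w t)| <=
        k * `|s - t|)%R].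
Proof.
rewrite /Lip; case: asboolP => [|noinf]; first by rewrite ltxx.
set K := [set k%:E | k in _] => Kfin.
have r0 t : 0 <= radon_indic E w t by exact: hausdorff1_ge0.
split=> [t|].
  by rewrite ge0_fin_numE// ltey; apply/negP => /eqP Et; apply: noinf; exists t.
have kP (k : R) : k.-lipschitz (fun t => fine (radon_indic E w t) : R) ->
    forall s t : R, (`|fine (radon_indic E w s) - fine (radon_indic E w t)| <=
      k * `|s - t|)%R.
  by move=> kl s t; exact: (kl (s, t)).
have k_ge0 (k : R) : k.-lipschitz (fun t => fine (radon_indic E w t) : R) -> (0 <= k)%R.
  move=> /kP /(_ 1%R 0%R); rewrite subr0 normr1 mulr1.
  exact: le_trans.
have inf0 : 0 <= ereal_inf K.
  by apply: le_ereal_inf_tmp => _ [k /k_ge0 k0 <-]; rewrite lee_fin.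
have fK : ereal_inf K \is a fin_num by rewrite ge0_fin_numE.
exists (fine (ereal_inf K)); first exact: fine_ge0.
split=> [|e e0]; first by rewrite fineK.
have [_ [k kl <-] ke] := lb_ereal_inf_adherent e0 fK.
exists k; split; [exact: k_ge0|by rewrite -lee_fin EFinD fineK// ltW|exact: kP].
Qed.

(** Transfers a bound quadratic in the Lipschitz constants to their infimum. *)
Lemma le_coef_sqr (q : \bar R) (c L : R) : (0 <= c)%R -> (0 <= L)%R ->
    (forall e : R, (0 < e)%R -> exists k : R,
      [/\ (0 <= k)%R, (k <= L + e)%R & q <= (c * k ^+ 2)%:E]) ->
  q <= (c * L ^+ 2)%:E.
Proof.
move=> c0 L0 H; apply/lee_addgt0Pr => e e0.
have cL : (0 < c * (2 * L + 1) + 1)%R by rewrite ltr_wpDl// mulr_ge0// addr_ge0// mulr_ge0.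
pose eta := Num.min 1%R (e / (c * (2 * L + 1) + 1))%R.
have eta0 : (0 < eta)%R by rewrite lt_min ltr01 divr_gt0.
have eta1 : (eta <= 1)%R by rewrite ge_min lexx.
have etae : (eta * (c * (2 * L + 1) + 1) <= e)%R by rewrite -ler_pdivlMr// ge_min lexx orbT.
have [k [k0 kL qk]] := H _ eta0.
apply: le_trans qk _; rewrite -EFinD lee_fin.
have kk : (k ^+ 2 <= (L + eta) ^+ 2)%R by rewrite lerXn2r// nnegrE// addr_ge0// ltW.
apply: le_trans (ler_wpM2l c0 kk) _.
have : (0 <= c * (eta * (1 - eta)))%R by rewrite !mulr_ge0// ?subr_ge0// ltW.
lra.
Qed.

Variables (E : set (R * R)) (f n : X -> X -> R).
Hypothesis mf : measurable_fun setT (fun p : X * X => f p.1 p.2).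
Hypothesis mn : measurable_fun setT (fun p : X * X => n p.1 p.2).
Hypothesis f01 : forall x y, f x y = 0%R \/ f x y = 1%R.
Hypothesis n01 : forall x y, n x y = 0%R \/ n x y = 1%R.
Hypothesis fE : forall x y, f x y = 1%R -> E (x, y).
Hypothesis Efn : forall x y, E (x, y) -> f x y = 1%R \/ n x y = 1%R.
Hypothesis null : mass n = 0.
Variables (M : R) (w : R * R).
Hypothesis w1 : unit_circle w.
Hypothesis w12 : (`|w.1| <= 2 * `|w.2|)%R.
Hypothesis support : hausdorff1 dist [set t : R | radon_indic E w t != 0] <= M%:E.

Let f0 x y : (0 <= f x y)%R. Proof. by case: (f01 x y) => ->. Qed.
(* The offset of a line is its signed distance to [0] divided by [w.2], and
   [`|w.2|^-1] is at most [3] when the slope is at most [2]; the summand [1] makes [B]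
   positive, which matters when [Lip E w] is infinite. *)
Let B := (3 * `|M| + 1)%R.
Let B1 : (1 <= B)%R. Proof. by rewrite lerDr mulr_ge0. Qed.
Let m := (w.1 / w.2)%R.

Let w2_le1 : (`|w.2| <= 1)%R.
Proof.
rewrite -(expr_le1 (n := 2))//; have := w1; rewrite /unit_circle /inner /= -!expr2 => <-.
by rewrite real_normK ?num_real// lerDr sqr_ge0.
Qed.

Let w2_ge : (1 <= 3 * `|w.2|)%R.
Proof.
rewrite leNgt; apply/negP => lt.
have := w1; rewrite /unit_circle /inner /= -!expr2.
rewrite -[(w.1 ^+ 2)%R]real_normK ?num_real// -[(w.2 ^+ 2)%R]real_normK ?num_real//.
have := normr_ge0 w.1; have := normr_ge0 w.2; move: w12 lt.
by move: (`|w.1|)%R (`|w.2|)%R => a b; nra.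
Qed.

Let w2_gt0 : (0 < `|w.2|)%R. Proof. by have := w2_ge; lra. Qed.
Let w2 : w.2 != 0%R. Proof. by rewrite -normr_gt0. Qed.

(** The line integrals, as functions of the offset, agree almost everywhere with a
    Lipschitz function supported on a set of measure at most [B]. *)
Lemma slice_bounds (k d : R) : (0 <= k)%R ->
    (forall t, radon_indic E w t \is a fin_num) ->
    (forall s t : R, (`|fine (radon_indic E w s) - fine (radon_indic E w t)| <=
      k * `|s - t|)%R) ->
  [/\ slice_increment f d m <= (2 * B * d ^+ 2 * k ^+ 2)%:E,
      slice_corr f m 0%R <= ((B + 1) ^+ 2 * B * k ^+ 2)%:E &
      mass f < +oo].
Proof.
move=> k0 rfin kl.
pose h u := (`|w.2| * fine (radon_indic E w (w.2 * u)))%R.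
have r0 t : 0 <= radon_indic E w t by exact: hausdorff1_ge0.
have h0 u : (0 <= h u)%R by rewrite mulr_ge0// fine_ge0.
have hk (s t : R) : (`|h s - h t| <= k * `|s - t|)%R.
  rewrite -mulrBr normrM normr_id.
  apply: (@le_trans _ _ (`|w.2| * (k * (`|w.2| * `|s - t|)))%R).
    by rewrite ler_wpM2l// -normrM mulrBr; exact: kl.
  have : (0 <= k * `|s - t|)%R by rewrite mulr_ge0.
  have := w2_le1; have := ltW w2_gt0; move: (`|w.2|)%R (`|s - t|)%R => a D a0 a1 kD.
  have -> : (a * (k * (a * D)) = k * D * (a * a))%R by ring.
  by rewrite ler_piMr// mulr_ile1.
have mh := measurable_lipschitz h k k0 hk.
have PB : mu [set u | h u != 0%R] <= B%:E.
  apply: le_trans (lebesgue_le_hausdorff1 _ (measurable_lipschitz_support h k k0 hk)) _.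
  have -> : [set u | h u != 0%R] = (fun t : R => w.2^-1 * t)%R @` [set t | radon_indic E w t != 0].
    apply/seteqP; split => [u /= hu|_ [t /= rt <-]].
      exists (w.2 * u)%R; last by rewrite mulKf.
      by apply/eqP => r; move/eqP: hu; apply; rewrite /h r mulr0.
    rewrite /h mulVKf// mulf_neq0//; first by rewrite gt_eqF.
    by rewrite fine_eq0.
  apply: le_trans (hausdorff1_image _ dist _ 3%R _ _ _) _ => //.
    move=> s t _ _; rewrite -mulrBr normrM normfV; apply: ler_wpM2r => //.
    by rewrite -[leLHS]mul1r ler_pdivrMr.
  apply: (@le_trans _ _ (3%:E * M%:E)); first by rewrite lee_wpmul2l.
  by rewrite -EFinM lee_fin /B; have := ler_norm M; lra.
have B0 : (0 <= B)%R by rewrite (le_trans _ B1).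
have ae : {ae mu, forall u : X, slice f m u = (h u)%:E}.
  apply: filterS (ae_radon_slice E f n mf mn f01 n01 fE Efn null w w1 w2) => u ru.
  rewrite /h ru fineM//; last first.
    have := rfin (w.2 * u)%R; rewrite ru; have := slice_ge0 f f0 m u.
    by rewrite -/m; case: (slice f m u) => [v| |]//=; rewrite gt0_muley// lte_fin invr_gt0.
  have := rfin (w.2 * u)%R; rewrite ru -/m; have := slice_ge0 f f0 m u.
  case: (slice f m u) => [v| |]//=; last by rewrite gt0_muley// lte_fin invr_gt0.
  by move=> _ _; congr (_%:E); rewrite mulVKf// gt_eqF.
have mh1 : measurable_fun setT (fun u : X => h u : X) by exact: mh.
have ms := measurable_slice f mf f0; have s0 := slice_ge0 f f0.
split.
- rewrite slice_increment.unlock.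
  have -> : \int[mu]_u ((fine (slice f m (u + d)%R) - fine (slice f m u)) ^+ 2)%:E =
      \int[mu]_u ((h (u + d)%R - h u) ^+ 2)%:E.
    apply: ge0_ae_eq_integral; side.
    have ae' := ae_shift _ d ae.
    by apply: filterS2 ae ae' => u -> -> _.
  apply: le_trans (integral_lipschitz_increment h k B k0 hk PB d) _.
  by rewrite lee_fin le_eqVlt; apply/orP; left; apply/eqP; ring.
- rewrite slice_corr.unlock.
  have -> : \int[mu]_u (slice f m u * slice f m (u + 0)%R) = \int[mu]_u (h u * h u)%:E.
    apply: ge0_ae_eq_integral; side.
    by apply: filterS ae => u ue _; rewrite addr0 ue EFinM.
  apply: le_trans (integral_lipschitz_sqr h k B k0 B0 h0 hk PB) _.
  by rewrite lee_fin le_eqVlt; apply/orP; left; apply/eqP; ring.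
- rewrite -(integral_slice f mf f0 m).
  have -> : \int[mu]_u slice f m u = \int[mu]_u (h u)%:E.
    apply: ge0_ae_eq_integral; side.
    by apply: filterS ae => u ue _; rewrite ue.
  exact: le_lt_trans (integral_lipschitz h k B k0 B0 h0 hk PB) (ltry _).
Qed.

Lemma slice_Lip_bounds d : (0 < d)%R ->
  [/\ slice_increment f d m <= (2 * B * d ^+ 2)%:E * (Lip E w * Lip E w),
      slice_corr f m 0%R <= ((B + 1) ^+ 2 * B)%:E * (Lip E w * Lip E w) &
      Lip E w < +oo -> mass f < +oo].
Proof.
move=> d0; have B0 : (0 < B)%R by exact: lt_le_trans B1.
have c1 : (0 < 2 * B * d ^+ 2)%R by rewrite !mulr_gt0// exprn_gt0.
have c2 : (0 < (B + 1) ^+ 2 * B)%R by rewrite mulr_gt0// exprn_gt0// addr_gt0.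
have [Lfin|] := ltP (Lip E w) +oo; last first.
  rewrite leye_eq => /eqP ->; rewrite mulyy !gt0_muley ?lte_fin//.
  by split; rewrite ?leey.
have [rfin [L L0 [-> HL]]] := Lip_approx E w Lfin.
rewrite -!EFinM -!expr2; split.
- apply: le_coef_sqr => //; first exact: ltW.
  move=> e /HL[k [k0 kL kl]]; exists k; split => //.
  by have [] := slice_bounds k d k0 rfin kl.
- apply: le_coef_sqr => //; first exact: ltW.
  move=> e /HL[k [k0 kL kl]]; exists k; split => //.
  by have [] := slice_bounds k d k0 rfin kl.
- move=> _; have [k [k0 kL kl]] := HL _ ltr01.
  by have [] := slice_bounds k d k0 rfin kl.
Qed.

End direction.

(** * From slopes to angles *)

Section slopes.
Context {R : realType}.
Notation mu := (@lebesgue_measure R).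
Notation X := (measurableTypeR R).
Local Notation dist := (fun s t : R => `|s - t|%R).

(** The mean value theorem. *)
Lemma norm_sin_le (x : R) : (`|sin x| <= `|x|)%R.
Proof.
wlog x0 : x / (0 < x)%R => [H|].
  have [x0|x0|->] := ltgtP x 0%R; [|exact: H|by rewrite sin0].
  by rewrite -normrN -sinN -[leRHS]normrN; apply: H; rewrite oppr_gt0.
have [c _] : exists2 c, c \in `]0%R, x[%R & (sin x - sin 0 = cos c * (x - 0))%R.
  apply: MVT => //.
  by apply: continuous_subspaceT => t; exact: continuous_sin.
rewrite sin0 !subr0 => ->; rewrite normrM ler_piMl//; exact: cos_max.
Qed.

(** Slope [0] is left out, because [x / 0 = 0]. *)
Definition slopes : set X := [set m | m != 0%R /\ (`|m| <= 2)%R].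

Lemma measurable_slopes : measurable slopes.
Proof.
have -> : slopes = `[(-2)%R, 2%R] `&` ~` [set 0%R].
  apply/seteqP; split => m; rewrite /slopes/= in_itv/= ler_norml => -[].
    by move=> /eqP m0 ->.
  by move=> -> /eqP ->.
by apply: measurableI; [exact: measurable_itv|exact: measurableC].
Qed.

Variables c s : X -> X.
Hypothesis mc : measurable_fun setT c.
Hypothesis ms : measurable_fun setT s.
Hypothesis circle : forall a, (c a ^+ 2 + s a ^+ 2 = 1)%R.
Hypothesis chord : forall a b : R, (`|c a * s b - c b * s a| <= `|a - b|)%R.
Hypothesis onto : forall m : R, exists a : R,
  [/\ `[0%R, (2 * pi)%R[%classic a, s a != 0%R & (c a / s a)%R = m].

Let psi (a : X) : X := (c a / s a)%R.

Let mpsi : measurable_fun setT psi.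
Proof. by rewrite /psi; meas. Qed.

(** A slope at most [2] means [1 <= 5 * s a ^+ 2], and the difference of two slopes is the
    cross product of the two vectors divided by the product of their [s]. *)
Lemma slope_lipschitz a b : slopes (psi a) -> slopes (psi b) ->
  (`|psi a - psi b| <= 5 * `|a - b|)%R.
Proof.
have bound t : slopes (psi t) -> s t != 0%R /\ (1 <= 5 * s t ^+ 2)%R.
  move=> [+ psi2]; rewrite /psi mulf_eq0 negb_or invr_eq0 => /andP[_ s0]; split=> //.
  have : (`|c t| <= 2 * `|s t|)%R.
    by move: psi2; rewrite /psi normrM normfV ler_pdivrMr// normr_gt0.
  have := circle t.
  rewrite -[(c t ^+ 2)%R]real_normK ?num_real// -[(s t ^+ 2)%R]real_normK ?num_real//.
  have := normr_ge0 (c t); have := normr_ge0 (s t).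
  by move: (`|c t|)%R (`|s t|)%R => x y; nra.
move=> /bound[sa a5] /bound[sb b5].
have -> : (psi a - psi b = (c a * s b - c b * s a) / (s a * s b))%R.
  by rewrite /psi; field; rewrite sb sa.
have ss : (0 < `|s a * s b|)%R by rewrite normr_gt0 mulf_neq0.
rewrite normrM normfV ler_pdivrMr//.
apply: le_trans (chord a b) _; rewrite mulrAC ler_peMl//.
rewrite -(ler_pXn2r (n := 2)) ?nnegrE// ?mulr_ge0// expr1n exprMn real_normK ?num_real// exprMn.
by move: a5 b5; move: (s a ^+ 2)%R (s b ^+ 2)%R => x y; nra.
Qed.

(** The slope is a Lipschitz function of the angle, so it does not map small sets of
    angles to large sets of slopes. *)
Lemma slopes_measure_le (S : set X) : measurable S ->
  mu (S `&` slopes) <= 5%:E * @lebesgue_turn R (psi @^-1` S).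
Proof.
move=> mS; have mI := measurable_slopes.
pose A : set X := psi @^-1` (S `&` slopes) `&` `[0%R, (2 * pi)%R[.
have mA : measurable A.
  apply: measurableI; last exact: measurable_itv.
  by rewrite -[X in measurable X]setTI; apply: mpsi => //; exact: measurableI.
apply: (@le_trans _ _ (5%:E * mu A)); last first.
  apply: lee_wpmul2l => //; rewrite /lebesgue_turn /mrestr.
  apply: le_measure; rewrite ?inE//.
    apply: measurableI; last exact: measurable_itv.
    by rewrite -[X in measurable X]setTI; exact: mpsi.
  by move=> a [[]].
apply: le_trans (lebesgue_le_hausdorff1 _ (measurableI _ _ mS mI)) _.
rewrite -(hausdorff1_lebesgue _ mA).
have -> : S `&` slopes = psi @` A.
  apply/seteqP; split => [m [Sm Im]|_ [a [aS _] <-]//].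
  by have [a [a0 sa am]] := onto m; exists a => //; split => //=; rewrite /psi am.
apply: hausdorff1_image => // a b [[_ ?] _] [[_ ?] _].
exact: slope_lipschitz.
Qed.

Lemma slopes_integral_le (q : X -> \bar R) : measurable_fun setT q -> (forall m, 0 <= q m) ->
  \int[mu]_(m in slopes) q m <=
    5%:E * \int[@lebesgue_turn R]_(a in psi @^-1` slopes) q (psi a).
Proof.
move=> mq q0; have mI := measurable_slopes.
have five : (0 <= 5 :> R)%R by [].
pose m1 : measure X R := mrestr mu mI.
pose turn : measure X R := @measure_function_pushforward__canonical__measure_function_Measure
  _ _ _ _ _ (@lebesgue_turn R) psi mpsi.
pose m2 : measure X R := mscale (NngNum five) turn.
have -> : \int[mu]_(m in slopes) q m = \int[m1]_(m in slopes) q m.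
  by apply: eq_measure_integral => A mA AI; rewrite -[in LHS](setIidl AI).
have : \int[m1]_(m in slopes) q m <= \int[m2]_(m in slopes) q m.
  by apply: ge0_le_measure_integral => // S mS; exact: slopes_measure_le.
move=> /le_trans; apply.
rewrite ge0_integral_mscale//; last exact: measurable_funTS.
by rewrite ge0_integral_pushforward//; exact: measurable_funTS.
Qed.

End slopes.

Section upper_integral.
Import HBNNSimple.
Context d (T : measurableType d) {R : realType} (mu : {measure set T -> \bar R}).
Implicit Types f g : T -> \bar R.

(** The integral of an arbitrary nonnegative function is a supremum over the simple
    functions below it. *)
Lemma le_integral_upper f g : (forall x, 0 <= f x) -> (forall x, f x <= g x) ->
  \int[mu]_x f x <= \int[mu]_x g x.
Proof.
move=> f0 fg; have g0 x : 0 <= g x by exact: le_trans (fg x).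
rewrite !ge0_integralTE//; apply: le_ereal_sup => _ [h hf <-]; exists h => // x.
exact: le_trans (fg x).
Qed.

Lemma integral_upper_le f b : (forall x, 0 <= f x) ->
    (forall h : T -> R, measurable_fun setT h -> (forall x, (0 <= h x)%R) ->
      (forall x, (h x)%:E <= f x) -> \int[mu]_x (h x)%:E <= b) ->
  \int[mu]_x f x <= b.
Proof.
move=> f0 H; rewrite ge0_integralTE//; apply: ub_ereal_sup => _ [h hf <-].
have := H h; rewrite integralT_nnsfun; apply => //.
Qed.

End upper_integral.

Section circle.
Context {R : realType}.
Notation mu := (@lebesgue_measure R).
Notation X := (measurableTypeR R).

Lemma unit_circle_param (a : R) : unit_circle (circle_param a).
Proof. by rewrite /unit_circle /inner /= -!expr2 cos2Dsin2. Qed.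

Lemma sin_chord (a b : R) : (`|sin a * cos b - sin b * cos a| <= `|a - b|)%R.
Proof. by rewrite [(sin b * _)%R]mulrC -sinB; exact: norm_sin_le. Qed.

Lemma cos_chord (a b : R) : (`|cos a * sin b - cos b * sin a| <= `|a - b|)%R.
Proof.
by rewrite [(cos a * _)%R]mulrC [(cos b * _)%R]mulrC distrC; exact: sin_chord.
Qed.

Lemma cos_atan_gt0 (m : R) : (0 < cos (atan m))%R.
Proof. by apply: cos_gt0_pihalf; rewrite atan_gtNpi2 atan_ltpi2. Qed.

(** The angle [atan m] itself may be negative. *)
Lemma tan_onto (m : R) : exists a : R,
  [/\ `[0%R, (2 * pi)%R[%classic a, cos a != 0%R & (sin a / cos a)%R = m].
Proof.
have c0 := cos_atan_gt0 m.
exists (atan m + pi)%R; rewrite /= in_itv/= sinDpi cosDpi oppr_eq0 gt_eqF//; split => //.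
  have := atan_gtNpi2 m; have := atan_ltpi2 m; have := pi_gt0 R => ? ? ?.
  by apply/andP; split; lra.
by rewrite invrN mulrNN -[RHS]atanK.
Qed.

Lemma cot_onto (m : R) : exists a : R,
  [/\ `[0%R, (2 * pi)%R[%classic a, sin a != 0%R & (cos a / sin a)%R = m].
Proof.
have c0 := cos_atan_gt0 m.
exists (pi / 2 - atan m)%R.
rewrite /= in_itv/= sinB cosB sin_pihalf cos_pihalf !mul0r !mul1r subr0 add0r gt_eqF//; split => //.
  have := atan_gtNpi2 m; have := atan_ltpi2 m; have := pi_gt0 R => ? ? ?.
  by apply/andP; split; lra.
by rewrite -[RHS]atanK.
Qed.

(** In both charts the slope is a function [r] on the plane. The function [L] is
    arbitrary, so the bound is integrated below a measurable minorant of it. *)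
Lemma slopes_integral_le_arc (r : R * R -> R) (q : X -> \bar R) (L : R * R -> \bar R) (D : R) :
    measurable_fun setT r ->
    (forall q' : X -> \bar R, measurable_fun setT q' -> (forall m, 0 <= q' m) ->
      \int[mu]_(m in slopes) q' m <= 5%:E *
        \int[@lebesgue_turn R]_(a in (r \o circle_param) @^-1` slopes) q' (r (circle_param a))) ->
    measurable_fun setT q -> (forall m, 0 <= q m) -> (0 < D)%R ->
    (forall w, 0 <= L w) ->
    (forall w, unit_circle w -> slopes (r w) -> q (r w) <= D%:E * L w) ->
  \int[mu]_(m in slopes) q m <= 5%:E * (D%:E * \int[arc_length]_w L w).
Proof.
move=> mr transfer mq q0 D0 L0 qL.
pose Z : set (R * R) := [set w | unit_circle w /\ slopes (r w)].
have mZ : measurable Z.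
  apply: measurableI.
    have mi : measurable_fun setT (fun w : R * R => inner w w).
      by apply: measurable_funD; apply: measurable_funM.
    by rewrite -[X in measurable X]setTI; exact: (mi measurableT [set 1%R]).
  by rewrite -[X in measurable X]setTI; apply: mr => //; exact: measurable_slopes.
pose F (w : R * R) : \bar R := ((fun w => D^-1%:E * q (r w)) \_ Z) w.
have mF : measurable_fun setT F.
  apply/(measurable_restrictT _ mZ).
  by apply: measurable_funTS; apply: measurable_funeM; exact: measurableT_comp mq mr.
have F0 w : 0 <= F w.
  by rewrite /F patchE; case: ifP => // _; rewrite mule_ge0// lee_fin invr_ge0 ltW.
have FL w : F w <= L w.
  rewrite /F patchE; case: ifP => // /set_mem[w1 rw].
  by rewrite lee_pdivrMl// qL.
apply: le_trans (transfer _ mq q0) _.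
apply: lee_wpmul2l => //.
apply: (@le_trans _ _ (D%:E * \int[arc_length]_w F w)); last first.
  by apply: lee_wpmul2l; [rewrite lee_fin ltW|exact: le_integral_upper].
have mcp : measurable_fun setT (@circle_param R : X -> R * R) by exact: measurable_circle_param.
have -> : \int[arc_length]_w F w = \int[@lebesgue_turn R]_a F (circle_param a).
  exact: (ge0_integral_pushforward mcp (@lebesgue_turn R) measurableT mF (fun w _ => F0 w)).
rewrite -ge0_integralZl//; last 2 first.
- exact: measurableT_comp mF mcp.
- by rewrite lee_fin ltW.
rewrite [leLHS]integral_mkcond; apply: le_integral_upper => a.
  by rewrite patchE; case: ifP.
rewrite [leLHS]patchE; case: ifP => [/set_mem ra|_]; last first.
  by apply: mule_ge0; [rewrite lee_fin ltW|exact: F0].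
rewrite /F patchE mem_set; last by split => //; exact: unit_circle_param.
by rewrite muleA -EFinM divff ?gt_eqF// mul1e.
Qed.

Lemma slopes_integral_le_cot (q : X -> \bar R) (L : R * R -> \bar R) (D : R) :
    measurable_fun setT q -> (forall m, 0 <= q m) -> (0 < D)%R ->
    (forall w, 0 <= L w) ->
    (forall w, unit_circle w -> slopes (w.1 / w.2)%R -> q (w.1 / w.2)%R <= D%:E * L w) ->
  \int[mu]_(m in slopes) q m <= 5%:E * (D%:E * \int[arc_length]_w L w).
Proof.
apply: (slopes_integral_le_arc (fun w => w.1 / w.2)%R).
  by apply: measurable_funM => //; exact: measurableT_comp measurable_inv _.
move=> q' mq' q'0; apply: (slopes_integral_le cos sin) => //.
- by apply: continuous_measurable_fun; exact: continuous_cos.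
- by apply: continuous_measurable_fun; exact: continuous_sin.
- by move=> a; rewrite cos2Dsin2.
- exact: cos_chord.
- exact: cot_onto.
Qed.

Lemma slopes_integral_le_tan (q : X -> \bar R) (L : R * R -> \bar R) (D : R) :
    measurable_fun setT q -> (forall m, 0 <= q m) -> (0 < D)%R ->
    (forall w, 0 <= L w) ->
    (forall w, unit_circle w -> slopes (w.2 / w.1)%R -> q (w.2 / w.1)%R <= D%:E * L w) ->
  \int[mu]_(m in slopes) q m <= 5%:E * (D%:E * \int[arc_length]_w L w).
Proof.
apply: (slopes_integral_le_arc (fun w => w.2 / w.1)%R).
  by apply: measurable_funM => //; exact: measurableT_comp measurable_inv _.
move=> q' mq' q'0; apply: (slopes_integral_le sin cos) => //.
- by apply: continuous_measurable_fun; exact: continuous_sin.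
- by apply: continuous_measurable_fun; exact: continuous_cos.
- by move=> a; rewrite addrC cos2Dsin2.
- exact: sin_chord.
- exact: tan_onto.
Qed.

(** [weight] is at most [2] and vanishes beyond the slope [2]. *)
Lemma weight_integral_le (q : X -> \bar R) : measurable_fun setT q -> (forall m, 0 <= q m) ->
  \int[mu]_m ((weight m)%:E * q m) <= 2%:E * \int[mu]_(m in slopes) q m.
Proof.
move=> mq q0; have w0 := @weight_ge0 R; have mw := @measurable_weight R.
have mI := @measurable_slopes R.
rewrite -ge0_integralZl//; last exact: measurable_funTS.
rewrite [leRHS]integral_mkcond.
have -> : \int[mu]_m ((weight m)%:E * q m) =
    \int[mu]_m ((fun m => (weight m)%:E * q m) \_ slopes) m.
  apply: ge0_ae_eq_integral => //.
  - by meas.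
  - by apply/(measurable_restrictT _ mI); apply: measurable_funTS; meas.
  - by move=> m _; rewrite mule_ge0// lee_fin.
  - by move=> m _; rewrite patchE; case: ifP => // _; rewrite mule_ge0// lee_fin.
  apply: filterS (@ae_neq0 R) => m m0 _; rewrite patchE; case: ifP => // /negP mS.
  have m2 : (2 < `|m|)%R.
    by rewrite ltNge; apply/negP => m2; apply: mS; rewrite inE; split.
  have -> : weight m = 0%R.
    rewrite /weight /tent max_r ?subr_le0 ?ltW// max_r ?mulr0 ?subrr//.
    by rewrite subr_le0 ltW//; lra.
  by rewrite mul0e.
apply: le_integral_upper => m; rewrite !patchE; case: ifP => // _.
  by rewrite mule_ge0// lee_fin.
apply: lee_wpmul2r => //; rewrite lee_fin /weight.
have : (tent 2 m <= 2)%R by rewrite /tent ge_max gerBl normr_ge0 ler0n.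
by have := tent_ge0 2^-1 m; lra.
Qed.

End circle.

(** * Conclusion *)

Section chart_control.
Context {R : realType}.
Notation mu := (@lebesgue_measure R).
Notation X := (measurableTypeR R).
Local Notation dist := (fun s t : R => `|s - t|%R).
Variables (E : set (R * R)) (f n : X -> X -> R) (M : R) (J : \bar R).
Hypothesis mf : measurable_fun setT (fun p : X * X => f p.1 p.2).
Hypothesis mn : measurable_fun setT (fun p : X * X => n p.1 p.2).
Hypothesis f01 : forall x y, f x y = 0%R \/ f x y = 1%R.
Hypothesis n01 : forall x y, n x y = 0%R \/ n x y = 1%R.
Hypothesis fE : forall x y, f x y = 1%R -> E (x, y).
Hypothesis Efn : forall x y, E (x, y) -> f x y = 1%R \/ n x y = 1%R.
Hypothesis null : mass n = 0.
Hypothesis support : forall w, unit_circle w ->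
  hausdorff1 dist [set t : R | radon_indic E w t != 0] <= M%:E.
Hypothesis Jfin : J \is a fin_num.
Hypothesis transfer : forall (q : X -> \bar R) (D : R),
  measurable_fun setT q -> (forall m, 0 <= q m) -> (0 < D)%R ->
  (forall w, unit_circle w -> slopes (w.1 / w.2)%R ->
    q (w.1 / w.2)%R <= D%:E * (Lip E w * Lip E w)) ->
  \int[mu]_(m in slopes) q m <= 5%:E * (D%:E * J).

Let f0 x y : (0 <= f x y)%R. Proof. by case: (f01 x y) => ->. Qed.
Let B := (3 * `|M| + 1)%R.
Let B0 : (0 < B)%R. Proof. by rewrite ltr_wpDl// mulr_ge0. Qed.

Let bounds w d : unit_circle w -> slopes (w.1 / w.2)%R -> (0 < d)%R ->
  [/\ slice_increment f d (w.1 / w.2)%R <= (2 * B * d ^+ 2)%:E * (Lip E w * Lip E w),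
      slice_corr f (w.1 / w.2)%R 0%R <= ((B + 1) ^+ 2 * B)%:E * (Lip E w * Lip E w) &
      Lip E w < +oo -> mass f < +oo].
Proof.
move=> w1 [+ m2]; rewrite mulf_eq0 negb_or invr_eq0 => /andP[_ w2].
apply: (slice_Lip_bounds E f n) => //; last exact: support.
by move: m2; rewrite normrM normfV ler_pdivrMr// normr_gt0.
Qed.

(** Infinite mass would make the Lipschitz constant infinite in every direction of
    the chart. *)
Lemma mass_lty : mass f < +oo.
Proof.
rewrite ltey; apply/negP => /eqP minf.
have : \int[mu]_(m in slopes) (cst +oo : X -> \bar R) m <= 5%:E * (1%:E * J).
  apply: transfer; [exact: measurable_cst|by move=> m; exact: leey|exact: ltr01|].
  move=> w w1 ws; rewrite mul1e.
  have [_ _] := bounds w 1%R w1 ws ltr01; rewrite minf ltxx => Linf.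
  have -> : Lip E w = +oo by apply/eqP; rewrite -leye_eq leNgt; apply/negP => /Linf.
  by rewrite mulyy.
rewrite integral_cst; last exact: measurable_slopes.
rewrite gt0_mulye; last first.
  have I12 : `[1%R, 2%R]%classic `<=` (@slopes R : set X).
    move=> m; rewrite /= in_itv/= => /andP[m1 m2]; have m0 : (0 < m)%R by exact: lt_le_trans m1.
    by split; [rewrite gt_eqF|rewrite ger0_norm// ltW].
  have : mu (`[1%R, 2%R]%classic : set X) <= mu slopes.
    by apply: le_measure => //; rewrite inE; [exact: measurable_itv|exact: measurable_slopes].
  by apply: lt_le_trans; rewrite lebesgue_measure_itv/= lte_fin ltr1n -EFinD lte_fin; lra.
by rewrite leye_eq -(fineK Jfin).
Qed.

Lemma slice_corr_weight_lty : \int[mu]_m ((weight m)%:E * slice_corr f m 0%R) < +oo.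
Proof.
have mc := measurable_slice_corr f mf f0; have c0 := slice_corr_ge0 f f0.
have mc1 : measurable_fun setT (fun m : X => slice_corr f m 0%R) by meas.
apply: le_lt_trans (weight_integral_le _ mc1 (fun m => c0 m 0%R)) _.
have D0 : (0 < (B + 1) ^+ 2 * B)%R by rewrite mulr_gt0// exprn_gt0// addr_gt0.
apply: (@le_lt_trans _ _ (2%:E * (5%:E * (((B + 1) ^+ 2 * B)%:E * J)))).
  apply: lee_wpmul2l => //; apply: transfer => // w w1 ws.
  by have [] := bounds w 1%R w1 ws ltr01.
by rewrite -(fineK Jfin) -!EFinM ltry.
Qed.

Lemma slice_increment_weight_le : exists C : R, forall d : R, (0 < d)%R ->
  \int[mu]_m ((weight m)%:E * slice_increment f d m) <= (C * d ^+ 2)%:E.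
Proof.
exists (2 * (5 * (2 * B * fine J)))%R => d d0.
have mi := measurable_slice_increment f mf f0; have i0 := slice_increment_ge0 f d.
have mi1 : measurable_fun setT (fun m : X => slice_increment f d m) by meas.
apply: le_trans (weight_integral_le _ mi1 i0) _.
have D0 : (0 < 2 * B * d ^+ 2)%R by rewrite !mulr_gt0// exprn_gt0.
apply: (@le_trans _ _ (2%:E * (5%:E * ((2 * B * d ^+ 2)%:E * J)))).
  apply: lee_wpmul2l => //; apply: transfer => // w w1 ws.
  by have [] := bounds w d w1 ws d0.
rewrite -(fineK Jfin) -!EFinM lee_fin le_eqVlt; apply/orP; left; apply/eqP => /=.
by ring.
Qed.

End chart_control.

Section conclusion.
Context {R : realType}.
Notation mu := (@lebesgue_measure R).
Notation X := (measurableTypeR R).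
Local Notation dist := (fun s t : R => `|s - t|%R).

Lemma Lip_ge0 (E : set (R * R)) w : 0 <= Lip E w.
Proof.
have [Lfin|Linf] := ltP (Lip E w) +oo; last exact: le_trans Linf.
by have [_ [L L0 [-> _]]] := Lip_approx E w Lfin.
Qed.

Lemma poweR2 (x : \bar R) : 0 <= x -> `|x| `^ 2 = x * x.
Proof.
case: x => [x| |]//; last by rewrite gee0_abs ?leey// poweRyr// mulyy.
by rewrite lee_fin => x0; rewrite gee0_abs ?lee_fin// poweR_EFin powR_mulrn// expr2 EFinM.
Qed.

Lemma integral_Lip_sqr_lty (E : set (R * R)) : square_integrable_S1 (Lip E) ->
  \int[arc_length]_w (Lip E w * Lip E w) < +oo.
Proof.
rewrite /square_integrable_S1 => /(poweR_lty 2); rewrite poweR_Lnorm//.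
by under eq_integral => w _ do rewrite poweR2 ?Lip_ge0//.
Qed.

Lemma measurable_curried (A : set (X * X)) : measurable A ->
  measurable_fun setT (fun p : X * X => \1_A (p.1, p.2) : X).
Proof.
move=> mA; have -> : (fun p : X * X => \1_A (p.1, p.2) : X) = \1_A by apply/funext => -[].
exact: measurable_indic.
Qed.

(** The product measure is defined by integrating the measures of the sections. *)
Lemma mass_indic (A : set (X * X)) : measurable A ->
  mass (fun x y => \1_A (x, y)) = plane_measure A.
Proof.
move=> mA; rewrite mass.unlock /plane_measure /product_measure1.
apply: eq_integral => x _ /=.
rewrite -[xsection A x]setIT -integral_indic//; last exact: measurable_xsection.
by apply: eq_integral => y _; rewrite !indicE mem_xsection.
Qed.

Lemma indic01 (A : set (X * X)) x y : \1_A (x, y) = 0%R :> R \/ \1_A (x, y) = 1%R :> R.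
Proof. by rewrite indicE; case: (_ \in _); [right|left]. Qed.

(** The second chart is the first one for the set with exchanged coordinates. *)
Lemma square_integrable_mass0 (E : set (R * R)) (f n : X -> X -> R) (M : R) :
    measurable_fun setT (fun p : X * X => f p.1 p.2) ->
    measurable_fun setT (fun p : X * X => n p.1 p.2) ->
    (forall x y, f x y = 0%R \/ f x y = 1%R) ->
    (forall x y, n x y = 0%R \/ n x y = 1%R) ->
    (forall x y, f x y = 1%R -> E (x, y)) ->
    (forall x y, E (x, y) -> f x y = 1%R \/ n x y = 1%R) ->
    mass n = 0 ->
    (forall w, unit_circle w ->
      hausdorff1 dist [set t : R | radon_indic E w t != 0] <= M%:E) ->
    \int[arc_length]_w (Lip E w * Lip E w) < +oo ->
  mass f = 0.
Proof.
move=> mf mn f01 n01 fE Efn null support Ifin.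
have f0 x y : (0 <= f x y)%R by case: (f01 x y) => ->.
have f1 x y : (f x y <= 1)%R by case: (f01 x y) => ->.
have n0 x y : (0 <= n x y)%R by case: (n01 x y) => ->.
have LL w : 0 <= Lip E w * Lip E w by apply: mule_ge0; exact: Lip_ge0.
set I := \int[arc_length]_w (Lip E w * Lip E w) in Ifin.
have If : I \is a fin_num by rewrite ge0_fin_numE//; exact: integral_ge0.
have tr1 (q : X -> \bar R) (D : R) : measurable_fun setT q -> (forall m, 0 <= q m) -> (0 < D)%R ->
    (forall w, unit_circle w -> slopes (w.1 / w.2)%R ->
      q (w.1 / w.2)%R <= D%:E * (Lip E w * Lip E w)) ->
    \int[mu]_(m in slopes) q m <= 5%:E * (D%:E * I).
  by move=> mq q0 D0 qL; exact: slopes_integral_le_cot.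
pose E' : set (R * R) := [set p | E (p.2, p.1)].
have tr2 (q : X -> \bar R) (D : R) : measurable_fun setT q -> (forall m, 0 <= q m) -> (0 < D)%R ->
    (forall w, unit_circle w -> slopes (w.1 / w.2)%R ->
      q (w.1 / w.2)%R <= D%:E * (Lip E' w * Lip E' w)) ->
    \int[mu]_(m in slopes) q m <= 5%:E * (D%:E * I).
  move=> mq q0 D0 qL; apply: slopes_integral_le_tan => // w w1 ws.
  rewrite -(Lip_swap E w); apply: (qL (w.2, w.1)) => //.
  by move: w1; rewrite /unit_circle /inner /= addrC.
have support' w : unit_circle w ->
    hausdorff1 dist [set t : R | radon_indic E' w t != 0] <= M%:E.
  move=> w1.
  have -> : [set t : R | radon_indic E' w t != 0] = [set t : R | radon_indic E (w.2, w.1) t != 0].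
    by apply/seteqP; split => t /=; rewrite -(radon_indic_swap E (w.2, w.1)); case: (w).
  by apply: support; move: w1; rewrite /unit_circle /inner /= addrC.
pose f' x y := f y x; pose n' x y := n y x.
have mf' : measurable_fun setT (fun p : X * X => f' p.1 p.2) by exact: meas_swap.
have mn' : measurable_fun setT (fun p : X * X => n' p.1 p.2) by exact: meas_swap.
have null' : mass n' = 0 by rewrite mass_swap.
have f01' x y : f' x y = 0%R \/ f' x y = 1%R by exact: f01.
have n01' x y : n' x y = 0%R \/ n' x y = 1%R by exact: n01.
have fE' x y : f' x y = 1%R -> E' (x, y) by exact: fE.
have Efn' x y : E' (x, y) -> f' x y = 1%R \/ n' x y = 1%R by exact: Efn.
have fin := mass_lty E f n M I mf mn f01 n01 fE Efn null support If tr1.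
have c1 := slice_corr_weight_lty E f n M I mf mn f01 n01 fE Efn null support If tr1.
have c2 := slice_corr_weight_lty E' f' n' M I mf' mn' f01' n01' fE' Efn' null' support' If tr2.
have [C1 H1] := slice_increment_weight_le E f n M I mf mn f01 n01 fE Efn null support If tr1.
have [C2 H2] := slice_increment_weight_le E' f' n' M I mf' mn' f01' n01' fE' Efn' null' support' If tr2.
apply: (energy_bound_mass0 f mf f01 fin (C1 + C2)%R) => d d0 _.
apply: le_trans (energy_two_charts f mf f0 f1 fin c1 c2 d d0) _.
apply: (@le_trans _ _ ((d ^+ 2)%:E * ((C1 * d ^+ 2)%:E + (C2 * d ^+ 2)%:E))).
  apply: lee_wpmul2l; first by rewrite lee_fin sqr_ge0.
  by apply: leeD; [exact: H1|exact: H2].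
rewrite -EFinD -EFinM lee_fin le_eqVlt; apply/orP; left; apply/eqP; ring.
Qed.

Lemma arc_length_bounded_sqr (L : R * R -> \bar R) (M : R) : (forall w, 0 <= L w) ->
  (forall w, unit_circle w -> L w <= M%:E) -> square_integrable_S1 L.
Proof.
move=> L0 LM; have M0 : (0 <= M)%R.
  by have := LM _ (unit_circle_param 0%R); rewrite -lee_fin; exact: le_trans.
rewrite /square_integrable_S1 Lnorm.unlock; apply: poweR_lty.
apply: (@le_lt_trans _ _ (\int[@lebesgue_turn R]_a (cst (M * M)%:E) a)).
  have mcp : measurable_fun setT (@circle_param R : X -> R * R) by exact: measurable_circle_param.
  apply: integral_upper_le => [w|h mh h0 hL]; first exact: poweR_ge0.
  have -> : \int[arc_length]_w (h w)%:E = \int[@lebesgue_turn R]_a (h (circle_param a))%:E.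
    apply: (ge0_integral_pushforward mcp (@lebesgue_turn R) measurableT).
      exact/measurable_EFinP.
    by move=> w _; rewrite lee_fin.
  apply: le_integral_upper => a; first by rewrite lee_fin.
  apply: le_trans (hL _) _; rewrite poweR2//.
  by rewrite /= EFinM; apply: lee_pmul => //; exact: LM (unit_circle_param a).
rewrite integral_cst//.
have -> : @lebesgue_turn R setT = mu `[0%R, (2 * pi)%R[%classic by rewrite -[in RHS](setTI `[_, _[%classic).
rewrite lebesgue_measure_itv/= lte_fin.
by case: ifP => _; rewrite -?EFinD ?mule0// -EFinM ltry.
Qed.

End conclusion.

Theorem theorem2 (R : realType) (E : set (R * R)) :
  plane_measurable E ->
  ~ plane_measure.-negligible E ->
  (exists M : R, forall w : R * R, unit_circle w ->
     hausdorff1 (fun s t : R => `|s - t|%R)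
       [set t : R | radon_indic (closure E) w t != 0] <= M%:E) ->
  ~ square_integrable_S1 (Lip E) /\
  ~ (exists M : R, forall w : R * R, unit_circle w -> Lip E w <= M%:E).
Proof.
move=> [A mA [N [N0 [mN0 N00 NN0]] AE]] nonnull [M HM].
(* [E] is squeezed between the Borel sets [A] and [A `|` N0], with [N0] null. *)
suff key : ~ square_integrable_S1 (Lip E).
  split=> // -[K LK]; apply: key.
  exact: arc_length_bounded_sqr (Lip_ge0 E) LK.
move=> /integral_Lip_sqr_lty Ifin; apply: nonnull.
have A0 : plane_measure A = 0.
  rewrite -mass_indic//.
  apply: (square_integrable_mass0 E (fun x y => \1_A (x, y)) (fun x y => \1_N0 (x, y)) M) => //.
  - exact: measurable_curried.
  - exact: measurable_curried.
  - exact: indic01.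
  - exact: indic01.
  - move=> x y; rewrite indicE; case: (boolP (_ \in _)) => [/set_mem Axy _|_ /eqP].
      by rewrite -AE; left.
    by rewrite eq_sym oner_eq0.
  - move=> x y; rewrite -AE => -[Axy|Nxy]; [left|right]; rewrite indicE mem_set//.
    exact: NN0.
  - by rewrite mass_indic.
  (* A line that meets [closure E] in a null set meets [E] in a null set. *)
  move=> w w1; apply: le_trans (HM w w1); apply: subset_hausdorff1 => t /=.
  apply: contra => /eqP H0; rewrite eq_le hausdorff1_ge0 andbT -H0.
  apply: subset_hausdorff1 => p [Ep wp]; split => //.
  exact: subset_closure.
exists (A `|` N0); split.
- exact: measurableU.
- apply/eqP; rewrite eq_le measure_ge0 andbT.
  apply: (@le_trans _ _ (plane_measure A + plane_measure N0)).
    exact: (measureU2 plane_measure mA mN0).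
  by rewrite A0 add0e le_eqVlt; apply/orP; left; apply/eqP.
- by rewrite -AE; apply: setUS.
Qed.
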